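(* Let $N\ge3$, let $U_1,\dots,U_N\in\mathbb R(x,y)$ be non-constant rational functions with singular locus $\Sigma$, let $\omega\in\mathbb R^2\setminus\Sigma$ and $\omega_i=U_i(\omega)$. Let $(F_1,\dots,F_N)$ be germs of real-valued measurable functions, $F_i$ at $\omega_i$, such that $\sum_{i=1}^N F_i(U_i(x,y))=0$ in a (real) neighbourhood of $\omega$. Then each $F_i$ is in fact an analytic germ at $\omega_i$. Its complexification is a germ $F_i^{\mathbb C}$ of holomorphic function at $\omega_i$, and $(F_1^{\mathbb C},\dots,F_N^{\mathbb C})$ is a holomorphic solution at $\omega$ of the same equation, i.e. $\sum_{i=1}^N F_i^{\mathbb C}(U_i)=0$ as a germ of holomorphic function at $\omega\in\mathbb C^2$.
   Context: Each non-constant $U_i\in\mathbb R(x,y)$ is regarded as a holomorphic map $\mathbb{CP}^2\setminus S_i\to\mathbb{CP}^1$, where $S_i$ is its (finite) indeterminacy locus. $\mathcal F_i$ denotes the singular foliation of $\mathbb{CP}^2$ whose leaves are the level curves of $U_i$, and $\mathsf S_i$ its singular locus. The singular locus is $$\Sigma=\Big(\bigcup_{i=1}^N\mathsf S_i\Big)\cup\Big(\bigcup_{i\ne j}\{\eta\in\mathbb{CP}^2\setminus(S_i\cup S_j)\;:\;(dU_i\wedge dU_j)(\eta)=0\}\Big)$$ (where $U_i$ takes the value $\infty$, $dU_i$ is read in a local coordinate of $\mathbb{CP}^1$). *)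

(* Defs.v *)
From HB Require Import structures.
From mathcomp Require Import all_boot all_order all_algebra.
From mathcomp Require Import polyXY fraction.
From mathcomp Require Import complex.
From mathcomp Require Import all_classical all_reals all_analysis.
From mathcomp Require Import measurable_realfun zify.

Set Implicit Arguments.
Unset Strict Implicit.
Unset Printing Implicit Defensive.

Import Order.TTheory GRing.Theory Num.Theory.
Import numFieldNormedType.Exports.

Local Open Scope classical_set_scope.
Local Open Scope ring_scope.

(** {poly {poly K}} is K[x, y], with x the outer and y the inner variable: this
    is the convention of the evaluation [P.[x, y]] of polyXY. *)

Section Bivariate.
Variable K : fieldType.
Implicit Types (P Q D A B G : {poly {poly K}}) (f : {poly {poly K}} * {poly {poly K}}).
Implicit Types eta : K * K.

Definition dX P := P^`().
Definition dY P := map_poly (fun q : {poly K} => q^`()) P.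

Definition coprimeXY P Q : Prop :=
  forall D A B, P = D * A -> Q = D * B -> D \is a GRing.unit.

Definition is_coprime_part P Q (AB : {poly {poly K}} * {poly {poly K}}) : Prop :=
  coprimeXY AB.1 AB.2 /\ exists G, P = G * AB.1 /\ Q = G * AB.2.

(** (P, Q) divided by its gcd; well defined up to a nonzero constant when
    (P, Q) <> (0, 0) (see [coprime_partP]). *)
Definition coprime_part P Q : {poly {poly K}} * {poly {poly K}} :=
  xget (P, Q) [set AB | is_coprime_part P Q AB].

(** Below, a pair f = (P, Q) of coprime polynomials with Q != 0 stands for the
    rational function P / Q, as a map to the projective line P^1(K), encoded as
    [option K] with [None] the point at infinity. *)
Definition indeterminacy f : set (K * K) :=
  [set eta | f.1.[eta.1, eta.2] = 0 /\ f.2.[eta.1, eta.2] = 0].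

(** Relevant only outside [indeterminacy f]. *)
Definition ratval f eta : option K :=
  if f.2.[eta.1, eta.2] == 0 then None
  else Some (f.1.[eta.1, eta.2] / f.2.[eta.1, eta.2]).

(** The polynomial 1-form Q dP - P dQ = Q^2 d(P / Q), by its two components. *)
Definition level_form f : {poly {poly K}} * {poly {poly K}} :=
  (f.2 * dX f.1 - f.1 * dX f.2, f.2 * dY f.1 - f.1 * dY f.2).

(** The foliation by the level curves of P / Q is defined by [level_form f]
    divided by the gcd of its components, and is singular where that form
    vanishes. *)
Definition foliation_form f : {poly {poly K}} * {poly {poly K}} :=
  coprime_part (level_form f).1 (level_form f).2.

Definition sing_foliation f : set (K * K) :=
  [set eta | (foliation_form f).1.[eta.1, eta.2] = 0 /\
             (foliation_form f).2.[eta.1, eta.2] = 0].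

Definition quotient_d P Q eta : K * K :=
  let ev T := T.[eta.1, eta.2] in
  ((ev (dX P) * ev Q - ev P * ev (dX Q)) / ev Q ^+ 2,
   (ev (dY P) * ev Q - ev P * ev (dY Q)) / ev Q ^+ 2).

(** The differential at eta of P / Q, read in the coordinate 1 / u of the
    projective line if P / Q has a pole at eta. *)
Definition local_d f eta : K * K :=
  if f.2.[eta.1, eta.2] == 0 then quotient_d f.2 f.1 eta
  else quotient_d f.1 f.2 eta.

Definition tangency f g : set (K * K) :=
  [set eta | [/\ ~ indeterminacy f eta, ~ indeterminacy g eta &
    (local_d f eta).1 * (local_d g eta).2
      - (local_d f eta).2 * (local_d g eta).1 = 0]].

(** The part of the singular locus in the affine chart K^2 of the plane. *)
Definition singular_locus (N : nat)
    (f : 'I_N -> {poly {poly K}} * {poly {poly K}}) : set (K * K) :=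
  [set eta | (exists i, sing_foliation (f i) eta) \/
             (exists i j, i != j /\ tangency (f i) (f j) eta)].

Definition is_lowest_terms (u : {fraction {poly {poly K}}}) f : Prop :=
  [/\ coprimeXY f.1 f.2, f.2 != 0 & u = tofrac f.1 / tofrac f.2].

(** Unique up to a common nonzero constant. *)
Definition lowest_terms (u : {fraction {poly {poly K}}}) :=
  xget (0, 1) [set f | is_lowest_terms u f].

Definition nonconstant (u : {fraction {poly {poly K}}}) : Prop :=
  forall c : K, u <> tofrac c%:P%:P.

Let mu P := (size P + size (lead_coef P))%N.

Lemma coprime_part_ex P Q : (P != 0) || (Q != 0) ->
  exists AB, is_coprime_part P Q AB.
Proof.
wlog P0 : P Q / P != 0.
  move=> W /orP[P0|Q0]; first by apply: W; rewrite ?P0.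
  have [|[A B] [/= c [G [eQ eP]]]] := W Q P Q0; first by rewrite Q0.
  by exists (B, A); split; [move=> D A' B' h1 h2; apply: c h2 h1 | exists G].
move=> _; have [n] := ubnP (mu P); elim: n => // n IH in P Q P0 *; rewrite ltnS => le_n.
have [cPQ|] := pselect (coprimeXY P Q).
  by exists (P, Q); split=> //; exists 1; rewrite !mul1r.
move=> /existsNP[D] /existsNP[A] /existsNP[B] /not_implyP[eP] /not_implyP[eQ nu].
have [D0 A0] : D != 0 /\ A != 0.
  by apply/andP; move: P0; rewrite eP mulf_eq0 negb_or.
have [lD lA] : lead_coef D != 0 /\ lead_coef A != 0 by rewrite !lead_coef_eq0.
have ltA : (mu A < mu P)%N.
  rewrite /mu eP lead_coefM !size_mul //.
  have [sD0 sA0] : (0 < size D)%N /\ (0 < size A)%N by rewrite !size_poly_gt0.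
  have [sl0 sm0] : (0 < size (lead_coef D))%N /\ (0 < size (lead_coef A))%N.
    by rewrite !size_poly_gt0.
  have [sD|] := leqP (size D) 1; last first.
    move: sD0 sA0 sl0 sm0;
    move: (size D) (size A) (size (lead_coef D)) (size (lead_coef A)) => a b c d; lia.
  have [sl|] := leqP (size (lead_coef D)) 1; last first.
    move: sD0 sA0 sl0 sm0;
    move: (size D) (size A) (size (lead_coef D)) (size (lead_coef A)) => a b c d; lia.
  case: nu; have /size_poly1P[d d0 eD] : size D == 1 by rewrite eqn_leq sD sD0.
  rewrite eD poly_unitE size_polyC d0 coefC /= poly_unitE.
  move: sl; rewrite eD lead_coefC => sl.
  have /size_poly1P[e e0 ->] : size d == 1 by rewrite eqn_leq sl size_poly_gt0 d0.
  by rewrite size_polyC e0 coefC /= unitfE.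
have [AB [c [G [eA eB]]]] := IH A B A0 (leq_trans ltA le_n).
by exists AB; split=> //; exists (D * G); rewrite -!mulrA -eA -eB.
Qed.

Lemma coprime_partP P Q : (P != 0) || (Q != 0) ->
  is_coprime_part P Q (coprime_part P Q).
Proof. by move=> /coprime_part_ex[AB h]; exact: (xgetPex _ (ex_intro _ AB h)). Qed.

Lemma lowest_termsP u : is_lowest_terms u (lowest_terms u).
Proof.
suff [f h] : exists f, is_lowest_terms u f by exact: (xgetPex _ (ex_intro _ f h)).
have [[[P Q] /= Q0] ->] : exists r : {ratio {poly {poly K}}}, u = tofrac r.1 / tofrac r.2.
  elim/quotW: u => r; exists r.
  apply: (canRL (mulfK _)); first by rewrite tofrac_eq0 denom_ratioP.
  unlock FracField.tofrac; rewrite -[LHS]FracField.pi_mul.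
  apply/eqmodP; rewrite /= FracField.equivfE /FracField.mulf.
  by rewrite !numden_Ratio ?mulr1 ?oner_neq0 ?denom_ratioP // mulrC.
have [|[A B] [/= c [G [eP eQ]]]] := @coprime_part_ex P Q; first by rewrite Q0 orbT.
have [G0 B0] : G != 0 /\ B != 0.
  by apply/andP; move: Q0; rewrite eQ mulf_eq0 negb_or.
exists (A, B); split=> //=; rewrite eP eQ !rmorphM /= -mulf_div divff ?mul1r //.
by rewrite tofrac_eq0.
Qed.

End Bivariate.

(** Local parametrization of the projective line around p: [u = t] around a
    finite point, [u = 1 / t] around infinity; [coord p] is the value of the
    parameter at p. *)
Section ProjectiveLine.
Variable K : numFieldType.

Definition param (p : option K) (t : K) : option K :=
  if p is Some _ then Some t else if t == 0 then None else Some t^-1.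

Definition coord (p : option K) : K := if p is Some a then a else 0.

(** Meant for K = R[i], where this is holomorphy of the germ of G at p. *)
Definition holomorphic_germ (G : option K -> K) (p : option K) : Prop :=
  \forall t \near coord p, derivable (fun s : K => G (param p s)) t 1.

Definition solution_germ (N : nat)
    (f : 'I_N -> {poly {poly K}} * {poly {poly K}})
    (F : 'I_N -> option K -> K) (eta : K * K) : Prop :=
  \forall z \near eta, \sum_(i < N) F i (ratval (f i) z) = 0.

End ProjectiveLine.

Section RealComplex.
Variable R : realType.

Local Notation C := (R[i] : numFieldType).

(** Lebesgue (not just Borel) measurability, on some open neighbourhood. *)
Definition measurable_germ (F : option R -> R) (p : option R) : Prop :=
  exists2 V : set R, open_nbhs (coord p) V &
    measurable_fun (V : set (g_sigma_algebraType
                              (completed_algebra_gen (@lebesgue_measure R))))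
                   (fun t => F (param p t) : R).

Definition analytic_germ (F : option R -> R) (p : option R) : Prop :=
  exists c : nat -> R, \forall t \near coord p,
    pseries c (t - coord p) @ \oo --> F (param p t).

Definition toC (x : R) : C := real_complex R x.

Definition toC2 (eta : R * R) : C * C := (toC eta.1, toC eta.2).

Definition ratC (f : {poly {poly R}} * {poly {poly R}}) :
    {poly {poly C}} * {poly {poly C}} :=
  (map_poly (map_poly toC) f.1, map_poly (map_poly toC) f.2).

(** G is a holomorphic germ at p extending F; as a germ it is unique. *)
Definition complexification (F : option R -> R) (p : option R)
    (G : option C -> C) : Prop :=
  holomorphic_germ G (omap toC p) /\
  \forall t \near coord p, G (omap toC (param p t)) = toC (F (param p t)).

End RealComplex.

(* Main.v *)
Require Import Defs.
From mathcomp Require Import all_boot all_order all_algebra.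
From mathcomp Require Import polyXY fraction complex.
From mathcomp Require Import all_classical all_reals all_analysis.
From mathcomp Require Import measurable_realfun ring lra zify.

Set Implicit Arguments.
Unset Strict Implicit.
Unset Printing Implicit Defensive.

Import Order.TTheory GRing.Theory Num.Theory.
Import numFieldNormedType.Exports.

Local Open Scope classical_set_scope.
Local Open Scope ring_scope.

(** Near omega each U_i is read in a coordinate of the projective line, giving rational
    functions u_i regular at omega: U_i is determinate there, because a common zero of
    its coprime numerator and denominator is a singular point of its foliation.  After
    a shear d u_i / dx <> 0, and the slopes m_i = (d u_i / dy) / (d u_i / dx) are
    pairwise distinct since d u_i /\ d u_j <> 0.

    Measurable implies continuous: by Lusin's theorem F_j is continuous on a compact
    set of almost full measure.  Two nearby points of a level range of u_i can be
    realized on a common line y = const along which all the other u_j take values in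
    these compact sets, so the relation carries continuity over to F_i.

    Continuous implies analytic: for psi vanishing at a and b, the y-derivative of the
    integral over [a, b] of F_j(u_j) psi is the integral of F_j(u_j) T_j psi, where
    T_j psi = psi_y - (m_j psi)_x.  Applying this N - 1 times to a psi vanishing to
    high order at both ends, and differentiating in b as often, turns the relation into
    a Vandermonde system which expresses F_j(u_j) through integrals g of the
    F_l(u_l); these solve a linear system g' = C(b) g with rational coefficients.
    Hence F_j(u_j(x, 0)) is analytic, and so is F_j.

    Complexification: the sum of the F_i^C(u_i) is a convergent power series in
    each variable, uniformly in the other one, and vanishes at the real points. *)

(** * Complex power series *)

(** Analyticity is carried throughout by power series whose coefficient sum, weighted by the powers
    of a radius, is bounded. This norm is complete and submultiplicative, so products, compositions,
    reciprocals, solutions of linear systems and inverse functions are sums estimated term by term,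
    and each real germ comes with its complex extension.

    [F_j] being merely continuous, the relation itself cannot be differentiated: [T_j] moves the
    y-derivative to the test function. The Vandermonde matrix of the N slopes needs the powers 0 to
    n = N - 1. For [psi = (x - a)^n (b - x)^n] the power k comes from n - k derivatives in x
    followed by k operators [T_j]: the order of vanishing drops to 0, and one derivative in b then
    gives the boundary values [F_j(u_j(b, 0)) m_j^k] times a common nonzero factor. As [psi] is
    polynomial in b, finitely many integrals occur and the system closes.

    In the measurable step the points of a level curve are chosen without any regularity in y; an
    expansion estimate is enough to control the bad y. *)

Section ComplexLimit.
Variable R : realType.
Local Notation C := R[i].
Implicit Types (u v : nat -> C) (a b l z w : C) (B : R).

(** Modulus with values in [R]: the norm of [R[i]] takes its values in [R[i]], which is only
    partially ordered. *)
Definition absc (z : C) : R := ComplexField.Normc.normc z.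

Lemma absc_ge0 z : 0 <= absc z.
Proof. by case: z => a b; exact: sqrtr_ge0. Qed.

Lemma abscM z w : absc (z * w) = absc z * absc w.
Proof. exact: ComplexField.Normc.normcM. Qed.

Lemma absc0 : absc 0 = 0.
Proof. exact: ComplexField.Normc.normc0. Qed.

Lemma absc1 : absc 1 = 1.
Proof. exact: ComplexField.Normc.normc1. Qed.

Lemma absc0_eq0 z : absc z = 0 -> z = 0.
Proof. exact: ComplexField.Normc.eq0_normc. Qed.

Lemma abscX z n : absc (z ^+ n) = absc z ^+ n.
Proof. by elim: n => [|n IH]; rewrite ?expr0 ?absc1// !exprS abscM IH. Qed.

Lemma abscN z : absc (- z) = absc z.
Proof. exact: normcN. Qed.

Lemma abscV z : absc z^-1 = (absc z)^-1.
Proof. exact: ComplexField.Normc.normcV. Qed.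

Lemma absc_gt0 z : (0 < absc z) = (z != 0).
Proof.
rewrite lt_neqAle absc_ge0 andbT; apply/idP/idP; apply: contra => /eqP.
  by move=> ->; rewrite absc0.
by move=> /esym/absc0_eq0 ->.
Qed.

Lemma abscB z w : absc (z - w) = absc (w - z).
Proof. by rewrite -abscN opprB. Qed.

Lemma absc_triangle z w : absc (z + w) <= absc z + absc w.
Proof. exact: le_normcD. Qed.

Lemma absc_real (x : R) : absc x%:C%C = `|x|.
Proof. by rewrite /absc /= expr0n addr0 sqrtr_sqr. Qed.

Lemma absc_sum (I : Type) (r : seq I) (P : pred I) (F : I -> C) :
  absc (\sum_(i <- r | P i) F i) <= \sum_(i <- r | P i) absc (F i).
Proof.
elim/big_rec2: _ => [|i x y _ le]; first by rewrite absc0.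
by apply: le_trans (absc_triangle _ _) _; rewrite lerD2l.
Qed.

Lemma Re_le_absc z : `|complex.Re z| <= absc z.
Proof.
case: z => a b; rewrite /absc/= -sqrtr_sqr ler_wsqrtr// lerDl.
exact: sqr_ge0.
Qed.

Lemma Im_le_absc z : `|complex.Im z| <= absc z.
Proof.
case: z => a b; rewrite /absc/= -sqrtr_sqr ler_wsqrtr// lerDr.
exact: sqr_ge0.
Qed.

Lemma absc_le_ReIm z : absc z <= `|complex.Re z| + `|complex.Im z|.
Proof.
case: z => a b; have {1}-> : (a +i* b = a%:C + 'i * b%:C)%C by simpc.
apply: le_trans (absc_triangle _ _) _; rewrite abscM !absc_real.
have -> : absc 'i%C = 1 by rewrite /absc /= expr0n add0r expr1n sqrtr1.
by rewrite mul1r.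
Qed.

(** Convergence is read on real distances, so that limits in [R[i]] reduce to limits of real
    sequences. *)
Definition clim u l := (fun n => absc (u n - l)) @ \oo --> (0 : R).

Lemma clim_le u l (e : nat -> R) :
  (\forall n \near \oo, absc (u n - l) <= e n) -> e @ \oo --> (0 : R) -> clim u l.
Proof.
move=> le e0; apply: (@squeeze_cvgr _ _ _ _ (fun=> 0) e) => //.
  by near=> n; rewrite absc_ge0 /=; near: n.
exact: cvg_cst.
Unshelve. all: by end_near. Qed.

Lemma climP u l : clim u l <->
  (forall e : R, 0 < e -> \forall n \near \oo, absc (u n - l) < e).
Proof.
split=> [/cvgrPdist_lt h e /h|h].
  by apply: filterS => n; rewrite sub0r normrN ger0_norm ?absc_ge0.
apply/cvgrPdist_lt => e /h.
by apply: filterS => n; rewrite sub0r normrN ger0_norm ?absc_ge0.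
Qed.

Lemma clim_ext u v l : u =1 v -> clim u l -> clim v l.
Proof. by move=> /funext ->. Qed.

Lemma clim_cst a : clim (fun=> a) a.
Proof. by rewrite /clim; under eq_fun do rewrite subrr absc0; exact: cvg_cst. Qed.

Lemma climD u v a b : clim u a -> clim v b -> clim (fun n => u n + v n) (a + b).
Proof.
move=> ua vb; apply: (@clim_le _ _ (fun n => absc (u n - a) + absc (v n - b))).
  by apply: nearW => n; rewrite opprD addrACA absc_triangle.
by rewrite -[X in _ --> X]addr0; exact: cvgD.
Qed.

Lemma climZ k u a : clim u a -> clim (fun n => k * u n) (k * a).
Proof.
move=> ua; apply: (@clim_le _ _ (fun n => absc k * absc (u n - a))).
  by apply: nearW => n; rewrite -mulrBr abscM.
by rewrite -[X in _ --> X](mulr0 (absc k)); apply: cvgM => //; exact: cvg_cst.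
Qed.

Lemma climB u v a b : clim u a -> clim v b -> clim (fun n => u n - v n) (a - b).
Proof.
move=> ua vb; rewrite -mulN1r; apply: climD => //.
by under eq_fun do rewrite -mulN1r; exact: climZ.
Qed.

Lemma clim_sum (I : Type) (r : seq I) (u : I -> nat -> C) (a : I -> C) :
  (forall i, clim (u i) (a i)) ->
  clim (fun n => \sum_(i <- r) u i n) (\sum_(i <- r) a i).
Proof.
move=> h; elim: r => [|i r IH].
  rewrite big_nil; apply: clim_ext (clim_cst 0) => n.
  by rewrite big_nil.
rewrite big_cons; apply: clim_ext (climD (h i) IH) => n.
by rewrite big_cons.
Qed.

Lemma clim_bound u l B : clim u l -> (\forall n \near \oo, absc (u n) <= B) ->
  absc l <= B.
Proof.
move=> ul uB; apply/ler_addgt0Pr => e e0.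
have /climP/(_ e e0) ule := ul.
near \oo => n.
rewrite (_ : l = (l - u n) + u n); last by rewrite subrK.
apply: le_trans (absc_triangle _ _) _; rewrite addrC lerD//; first by near: n.
by rewrite abscB; apply: ltW; near: n.
Unshelve. all: by end_near. Qed.

Lemma clim_unique u a b : clim u a -> clim u b -> a = b.
Proof.
move=> ua ub; apply/eqP; rewrite -subr_eq0; apply/eqP/absc0_eq0/eqP.
rewrite eq_le absc_ge0 andbT; apply: (clim_bound (climB ua ub)).
by apply: nearW => n; rewrite subrr absc0.
Qed.

(** Completeness of the complex numbers in the only form needed: real and imaginary parts are
    dominated by the moduli, so both real series converge absolutely. *)
Lemma abs_series_clim (a : nat -> C) B :
  (forall n, \sum_(i < n) absc (a i) <= B) ->
  exists l, clim (fun n => \sum_(i < n) a i) l.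
Proof.
move=> aB.
have part (f : C -> R) : (forall z, `|f z| <= absc z) ->
    exists l : R, (fun n => \sum_(i < n) f (a i)) @ \oo --> l.
  move=> fle; apply/cvg_ex.
  have : cvgn [normed series (fun i => f (a i))].
    apply: nondecreasing_is_cvgn.
      by apply: nondecreasing_series => n _ _ /=; exact: normr_ge0.
    exists B => _ [n _ <-]; rewrite /= seriesEord.
    by apply: le_trans (aB n); apply: ler_sum => i _; exact: fle.
  move=> /normed_cvg; rewrite (_ : series _ = fun n => \sum_(i < n) f (a i)) //.
  by apply/funext => n; rewrite seriesEord.
have [x hx] := part _ Re_le_absc; have [y hy] := part _ Im_le_absc.
exists (x +i* y)%C; apply: (@clim_le _ _
  (fun n => `|\sum_(i < n) complex.Re (a i) - x| + `|\sum_(i < n) complex.Im (a i) - y|)).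
  apply: nearW => n; apply: le_trans (absc_le_ReIm _) _.
  have -> : \sum_(i < n) a i =
      ((\sum_(i < n) complex.Re (a i)) +i* (\sum_(i < n) complex.Im (a i)))%C.
    elim/big_rec3: _ => // i p q r _ ->; case: (a i) => //.
  by [].
have dist0 (v : nat -> R) (y0 : R) : v @ \oo --> y0 -> (fun n => `|v n - y0|) @ \oo --> (0 : R).
  by move=> h; rewrite -(@normr0 _ R); apply: cvg_norm; apply/subr_cvg0.
by rewrite -[X in _ --> X]addr0; apply: cvgD; exact: dist0.
Qed.
End ComplexLimit.

(** * The weighted l^1 norm on power series *)

Section WeightedNorm.
Variable R : realType.
Local Notation C := R[i].
Implicit Types (c : nat -> C) (h g : C -> C) (z : C) (rho M : R).

Definition psum c z n : C := \sum_(i < n) c i * z ^+ i.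

(** The norm enters through upper bounds only, which avoids a supremum. The values of [h] outside
    the closed disc of radius [rho] are unconstrained. *)
Definition wnorm_le rho h M := exists c,
  (forall n, \sum_(i < n) absc (c i) * rho ^+ i <= M) /\
  (forall z, absc z <= rho -> clim (psum c z) (h z)).

Lemma wnorm_le_ext rho h g M : (forall z, absc z <= rho -> h z = g z) ->
  wnorm_le rho h M -> wnorm_le rho g M.
Proof. by move=> hg [c [cM ch]]; exists c; split=> // z zr; rewrite -hg //; exact: ch. Qed.

Lemma wnorm_le_ge0 rho h M : wnorm_le rho h M -> 0 <= M.
Proof. by move=> [c [/(_ 0%N) + _]]; rewrite big_ord0. Qed.

Lemma wnorm_leW rho rho' h M M' : 0 <= rho' -> rho' <= rho -> M <= M' ->
  wnorm_le rho h M -> wnorm_le rho' h M'.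
Proof.
move=> r0 rr MM [c [cM ch]]; exists c; split=> [n|z zr]; last first.
  by apply: ch; exact: le_trans zr rr.
apply: le_trans MM; apply: le_trans (cM n); apply: ler_sum => i _.
by rewrite ler_wpM2l ?absc_ge0// lerXn2r// nnegrE// (le_trans r0).
Qed.

Lemma psum_bound rho c M z n : absc z <= rho ->
  (forall n, \sum_(i < n) absc (c i) * rho ^+ i <= M) -> absc (psum c z n) <= M.
Proof.
move=> zr cM; apply: le_trans (cM n); apply: le_trans (absc_sum _ _ _) _.
apply: ler_sum => i _; rewrite abscM abscX ler_wpM2l ?absc_ge0//.
by rewrite lerXn2r// nnegrE ?absc_ge0// (le_trans (absc_ge0 z)).
Qed.

Lemma wnorm_le_bound rho h M z : wnorm_le rho h M -> absc z <= rho -> absc (h z) <= M.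
Proof.
move=> [c [cM ch]] zr; apply: clim_bound (ch z zr) _.
by apply: nearW => n; exact: psum_bound zr cM.
Qed.

Lemma eq_cvgn (u v : nat -> R) (l : R) : u =1 v -> u @ \oo --> l -> v @ \oo --> l.
Proof. by move=> /funext ->. Qed.

Lemma sum_ord_eq0 (V : zmodType) (f : nat -> V) m n :
  (forall i, i != m -> f i = 0) -> \sum_(i < n) f i = if (m < n)%N then f m else 0.
Proof.
move=> f0; case: ltnP => mn.
  rewrite (bigD1 (Ordinal mn)) //= big1 ?addr0 // => i im.
  by apply: f0; apply: contra im => /eqP e; apply/eqP/val_inj.
rewrite big1 // => i _; apply: f0; rewrite neq_ltn.
by rewrite (leq_trans (ltn_ord i) mn).
Qed.

Lemma wnorm_le_monom rho (a : C) m : 0 <= rho ->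
  wnorm_le rho (fun z => a * z ^+ m) (absc a * rho ^+ m).
Proof.
move=> r0; exists (fun i => if i == m then a else 0); split=> [n|z zr].
  rewrite (@sum_ord_eq0 _ (fun i => absc (if i == m then a else 0) * rho ^+ i) m).
    by rewrite eqxx; case: ltnP => // _; rewrite mulr_ge0 ?absc_ge0 ?exprn_ge0.
  by move=> i /negPf ->; rewrite absc0 mul0r.
apply: clim_le (cvg_cst (0 : R)); near=> n.
rewrite /psum (@sum_ord_eq0 _ (fun i => (if i == m then a else 0) * z ^+ i) m).
  rewrite eqxx ifT ?subrr ?absc0 //; near: n; exact: nbhs_infty_gt.
by move=> i /negPf ->; rewrite mul0r.
Unshelve. all: by end_near. Qed.

Lemma wnorm_le_cst rho (a : C) : 0 <= rho -> wnorm_le rho (fun=> a) (absc a).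
Proof.
move=> r0; have := wnorm_le_monom a 0 r0; rewrite expr0 mulr1.
by apply: wnorm_le_ext => z _; rewrite expr0 mulr1.
Qed.

Lemma wnorm_le_id rho : 0 <= rho -> wnorm_le rho id rho.
Proof.
move=> r0; have := wnorm_le_monom 1 1 r0; rewrite expr1 absc1 mul1r.
by apply: wnorm_le_ext => z _; rewrite expr1 mul1r.
Qed.

Lemma wnorm_leD rho h g M M' : 0 <= rho -> wnorm_le rho h M -> wnorm_le rho g M' ->
  wnorm_le rho (fun z => h z + g z) (M + M').
Proof.
move=> r0 [c [cM ch]] [d [dM dg]]; exists (fun i => c i + d i); split=> [n|z zr].
  apply: le_trans (lerD (cM n) (dM n)); rewrite -big_split /=; apply: ler_sum => i _.
  by rewrite -mulrDl ler_wpM2r ?exprn_ge0 ?absc_triangle.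
apply: clim_ext (climD (ch z zr) (dg z zr)) => n.
by rewrite /psum -big_split; apply: eq_bigr => i _ /=; rewrite mulrDl.
Qed.

Lemma wnorm_leZ rho h M (a : C) : wnorm_le rho h M ->
  wnorm_le rho (fun z => a * h z) (absc a * M).
Proof.
move=> [c [cM ch]]; exists (fun i => a * c i); split=> [n|z zr].
  apply: le_trans (ler_wpM2l (absc_ge0 a) (cM n)); rewrite mulr_sumr.
  by apply: ler_sum => i _; rewrite abscM mulrA.
apply: clim_ext (climZ a (ch z zr)) => n.
by rewrite /psum mulr_sumr; apply: eq_bigr => i _ /=; rewrite mulrA.
Qed.

Lemma wnorm_leN rho h M : wnorm_le rho h M -> wnorm_le rho (fun z => - h z) M.
Proof.
move=> /(wnorm_leZ (-1)); rewrite abscN absc1 mul1r.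
by apply: wnorm_le_ext => z _; rewrite mulN1r.
Qed.

Lemma wnorm_leB rho h g M M' : 0 <= rho -> wnorm_le rho h M -> wnorm_le rho g M' ->
  wnorm_le rho (fun z => h z - g z) (M + M').
Proof. by move=> r0 hM /wnorm_leN; exact: wnorm_leD. Qed.

Lemma wnorm_le_sum (I : Type) (r : seq I) rho (h : I -> C -> C) (M : I -> R) :
  0 <= rho -> (forall i, wnorm_le rho (h i) (M i)) ->
  wnorm_le rho (fun z => \sum_(i <- r) h i z) (\sum_(i <- r) M i).
Proof.
move=> r0 hM; elim: r => [|i r IH].
  rewrite big_nil -(@absc0 R); apply: wnorm_le_ext (wnorm_le_cst 0 r0) => z _.
  by rewrite big_nil.
rewrite big_cons; apply: wnorm_le_ext (wnorm_leD r0 (hM i) IH) => z _.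
by rewrite big_cons.
Qed.

Lemma wnorm_le_mulX rho h M : 0 <= rho -> wnorm_le rho h M ->
  wnorm_le rho (fun z => z * h z) (rho * M).
Proof.
move=> r0 [c [cM ch]]; have M0 : 0 <= M by have := cM 0%N; rewrite big_ord0.
exists (fun i => if i is j.+1 then c j else 0); split=> [[|n]|z zr].
- by rewrite big_ord0 mulr_ge0.
- rewrite big_ord_recl absc0 mul0r add0r.
  apply: le_trans (ler_wpM2l r0 (cM n)); rewrite mulr_sumr.
  by apply: ler_sum => i _; rewrite lift0 exprS mulrCA.
apply/climP => e e0; have /climP/(_ e e0) := climZ z (ch z zr).
move=> [N _ hN]; exists N.+1 => // -[//|n] /= Nn.
rewrite /psum big_ord_recl mul0r add0r.
under eq_bigr do rewrite lift0 exprS mulrCA.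
by rewrite -mulr_sumr; exact: hN.
Qed.

Lemma wnorm_le_mulXn rho h M n : 0 <= rho -> wnorm_le rho h M ->
  wnorm_le rho (fun z => z ^+ n * h z) (rho ^+ n * M).
Proof.
move=> r0 hM; elim: n => [|n IH].
  by rewrite expr0 mul1r; apply: wnorm_le_ext hM => z _; rewrite expr0 mul1r.
rewrite exprS -mulrA; apply: wnorm_le_ext (wnorm_le_mulX r0 IH) => z _.
by rewrite exprS mulrA.
Qed.

(* Completeness of the weighted l^1 norm, in the form of a countable sum. *)
Lemma wnorm_le_series rho (h : nat -> C -> C) (m : nat -> R) g M : 0 < rho ->
  (forall k, wnorm_le rho (h k) (m k)) ->
  (forall n, \sum_(k < n) m k <= M) ->
  (forall z, absc z <= rho -> clim (fun n => \sum_(k < n) h k z) (g z)) ->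
  wnorm_le rho g M.
Proof.
move=> r0 /choice[c hc] mM hg.
have m0 k : 0 <= m k by have [/(_ 0%N)] := hc k; rewrite big_ord0.
pose T n := \sum_(k < n) m k.
have Tinc : nondecreasing_seq T.
  by apply/nondecreasing_seqP => n; rewrite /T big_ord_recr /= lerDl.
have /cvg_ex[/= S TS] : cvgn T.
  by apply: nondecreasing_is_cvgn => //; exists M => _ [n _ <-]; exact: mM.
have TleS n : T n <= S.
  have := nondecreasing_cvgn_le Tinc (cvgP _ TS) n.
  by rewrite (cvg_lim (@Rhausdorff R) TS).
have cik k i : absc (c k i) * rho ^+ i <= m k.
  have [/(_ i.+1) + _] := hc k; rewrite big_ord_recr /=; apply: le_trans.
  by rewrite lerDr sumr_ge0 // => j _; rewrite mulr_ge0 ?absc_ge0 ?exprn_ge0 ?ltW.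
have coef_cvg i : exists l, clim (fun n => \sum_(k < n) c k i) l.
  apply: (@abs_series_clim _ (c^~ i) (M / rho ^+ i)) => n.
  rewrite ler_pdivlMr ?exprn_gt0 // mulr_suml; apply: le_trans (mM n).
  by apply: ler_sum => k _; exact: cik.
have /choice[l cl] := coef_cvg.
have cl0 n : (fun K => \sum_(i < n) absc (\sum_(k < K) c k i - l i) * rho ^+ i) @ \oo --> (0 : R).
  elim: n => [|n IH]; first by under eq_fun do rewrite big_ord0; exact: cvg_cst.
  apply: (@eq_cvgn (fun K => \sum_(i < n) absc (\sum_(k < K) c k i - l i) * rho ^+ i
      + absc (\sum_(k < K) c k n - l n) * rho ^+ n)).
    by move=> K; rewrite big_ord_recr.
  rewrite -[X in _ --> X]addr0; apply: cvgD => //.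
  rewrite -[X in _ --> X](mul0r (rho ^+ n)); apply: cvgM; last exact: cvg_cst.
  exact: cl.
(* The weighted remainder of the coefficients is bounded by the remainder of the [m k], uniformly in
   [n]. The limits [l i] are replaced by partial sums up to a large [K'], at a cost that [cl0] makes
   small. *)
have tail n K : \sum_(i < n) absc (l i - \sum_(k < K) c k i) * rho ^+ i <= S - T K.
  apply/ler_addgt0Pr => e e0; have /cvgrPdist_lt/(_ e e0) near0 := cl0 n.
  near \oo => K'.
  have KK' : (K <= K')%N by near: K'; exact: nbhs_infty_ge.
  apply: (@le_trans _ _ (T K' - T K + \sum_(i < n) absc (\sum_(k < K') c k i - l i) * rho ^+ i)).
    have -> : T K' - T K = \sum_(K <= k < K') m k.
      by rewrite /T -!(big_mkord xpredT m) (big_cat_nat _ KK') //= addrAC subrr add0r.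
    apply: (@le_trans _ _ (\sum_(K <= k < K') \sum_(i < n) absc (c k i) * rho ^+ i
        + \sum_(i < n) absc (\sum_(k < K') c k i - l i) * rho ^+ i)); last first.
      by rewrite lerD2r; apply: ler_sum => k _; have [+ _] := hc k.
    rewrite exchange_big -big_split /=; apply: ler_sum => i _.
    rewrite -mulr_suml -mulrDl; apply: ler_wpM2r; first by rewrite exprn_ge0 // ltW.
    rewrite -!(big_mkord xpredT (fun k => c k i)).
    rewrite [X in absc X](_ : _ = \sum_(K <= k < K') c k i - (\sum_(0 <= k < K') c k i - l i)).
    apply: le_trans (absc_triangle _ _) _; rewrite abscN lerD2r; exact: absc_sum.
    by rewrite [X in _ - (X - _)](big_cat_nat _ KK') //=; ring.
  apply: lerD; first by rewrite lerD2r.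
  apply: ltW; apply: le_lt_trans (ler_norm _) _.
  by rewrite -normrN -sub0r; near: K'.
exists l; split=> [n|z zr].
  apply: (@le_trans _ _ (S - T 0%N)); last first.
    rewrite /T big_ord0 subr0; rewrite -(cvg_lim (@Rhausdorff R) TS).
    by apply: limr_le; [exact: cvgP TS|exact: nearW].
  apply: le_trans (tail n 0%N); apply: ler_sum => i _.
  by rewrite big_ord0 subr0.
apply/climP => e e0.
have e3 : 0 < e / 3 by rewrite divr_gt0.
have /climP/(_ _ e3) near1 := hg z zr.
have /cvgrPdist_lt/(_ _ e3) near2 := TS.
(* [K] is fixed first: [tail] then handles everything beyond [K] uniformly in [n], and only finitely
   many power series have to be passed to the limit. *)
have [K hK1 hK2] : exists2 K, absc (\sum_(k < K) h k z - g z) < e / 3 & S - T K < e / 3.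
  near \oo => K; exists K; first by near: K.
  by apply: le_lt_trans (ler_norm _) _; near: K.
have /climP/(_ _ e3) : clim (fun n => \sum_(k < K) psum (c k) z n) (\sum_(k < K) h k z).
  by apply: clim_sum => k; have [_] := hc k; exact.
apply: filterS => n hn.
rewrite (_ : psum l z n - g z = (psum l z n - \sum_(k < K) psum (c k) z n)
  + (\sum_(k < K) psum (c k) z n - \sum_(k < K) h k z) + (\sum_(k < K) h k z - g z)); last by ring.
apply: le_lt_trans (absc_triangle _ _) _.
rewrite (_ : e = e / 3 + e / 3 + e / 3); last by field.
apply: ltrD => //; apply: le_lt_trans (absc_triangle _ _) _; apply: ltrD => //.
apply: le_lt_trans hK2; apply: le_trans (tail n K).
rewrite /psum exchange_big -sumrB /=; apply: le_trans (absc_sum _ _ _) _.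
apply: ler_sum => i _; rewrite -mulr_suml -mulrBl abscM abscX ler_wpM2l ?absc_ge0//.
by rewrite lerXn2r// nnegrE ?absc_ge0 // ltW.
Unshelve. all: by end_near. Qed.
End WeightedNorm.

Section WeightedAlgebra.
Variable R : realType.
Local Notation C := R[i].
Implicit Types (c : nat -> C) (h g f v : C -> C) (z w : C) (rho eta M : R).

(** The product is the countable sum of the functions [c k * z ^+ k * g z], so no Cauchy product is
    needed. *)
Lemma wnorm_leM rho h g M M' : 0 < rho -> wnorm_le rho h M -> wnorm_le rho g M' ->
  wnorm_le rho (fun z => h z * g z) (M * M').
Proof.
move=> r0 [c [cM ch]] gM; have M'0 := wnorm_le_ge0 gM.
apply: (@wnorm_le_series _ _ (fun k z => c k * (z ^+ k * g z))
  (fun k => absc (c k) * (rho ^+ k * M'))) => // [k|n|z zr].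
- by apply: wnorm_leZ; apply: wnorm_le_mulXn => //; exact: ltW.
- by under eq_bigr do rewrite mulrA; rewrite -mulr_suml ler_wpM2r.
- rewrite mulrC; apply: clim_ext (climZ (g z) (ch z zr)) => n.
  by rewrite mulrC /psum mulr_suml; apply: eq_bigr => k _; rewrite mulrA.
Qed.

Lemma wnorm_leX rho h M n : 0 < rho -> wnorm_le rho h M ->
  wnorm_le rho (fun z => h z ^+ n) (M ^+ n).
Proof.
move=> r0 hM; elim: n => [|n IH].
  by rewrite expr0 -(@absc1 R); apply: wnorm_le_cst; exact: ltW.
by rewrite exprS; apply: wnorm_le_ext (wnorm_leM r0 hM IH) => z _; rewrite exprS.
Qed.

(** The composition is the sum of the [c k * v ^+ k]; it converges because the norm of [v] does not
    exceed the radius [eta] of [f]. *)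
Lemma wnorm_le_comp rho eta f v M : 0 < rho -> wnorm_le eta f M ->
  wnorm_le rho v eta -> wnorm_le rho (fun z => f (v z)) M.
Proof.
move=> r0 [c [cM cf]] veta.
apply: (@wnorm_le_series _ _ (fun k z => c k * v z ^+ k)
  (fun k => absc (c k) * eta ^+ k)) => // [k|z zr].
  by apply: wnorm_leZ; exact: wnorm_leX.
by apply: cf; exact: wnorm_le_bound veta zr.
Qed.

Lemma wnorm_le_Xdiff rho eta d v v' n : 0 < rho ->
  wnorm_le rho v eta -> wnorm_le rho v' eta -> wnorm_le rho (fun z => v z - v' z) d ->
  wnorm_le rho (fun z => v z ^+ n - v' z ^+ n) (n%:R * eta ^+ n.-1 * d).
Proof.
move=> r0 veta v'eta vd; have eta0 := wnorm_le_ge0 veta.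
elim: n => [|n IH].
  rewrite !mul0r -(@absc0 R); apply: wnorm_le_ext (wnorm_le_cst 0 (ltW r0)) => z _.
  by rewrite subrr.
have -> : n.+1%:R * eta ^+ n.+1.-1 * d = eta * (n%:R * eta ^+ n.-1 * d) + d * eta ^+ n.
  by rewrite -natr1; case: n {IH} => [|n] /=; [ring | rewrite exprS; ring].
apply: wnorm_le_ext (wnorm_leD (ltW r0) (wnorm_leM r0 veta IH)
  (wnorm_leM r0 vd (wnorm_leX n r0 v'eta))) => z _.
by rewrite !exprS; ring.
Qed.

(** The coefficient sum of the derivative of [f] at radius [eta] is a Lipschitz constant for
    composition with [f], in the norm itself. This is the source of the contraction in
    [local_inverse]. *)
Lemma wnorm_le_lip rho eta d v v' f c L : 0 < rho ->
  (forall z, absc z <= eta -> clim (psum c z) (f z)) ->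
  (forall n, \sum_(i < n) absc (c i) * (i%:R * eta ^+ i.-1) <= L) ->
  wnorm_le rho v eta -> wnorm_le rho v' eta -> wnorm_le rho (fun z => v z - v' z) d ->
  wnorm_le rho (fun z => f (v z) - f (v' z)) (L * d).
Proof.
move=> r0 cf cL veta v'eta vd; have d0 := wnorm_le_ge0 vd.
apply: (@wnorm_le_series _ _ (fun k z => c k * (v z ^+ k - v' z ^+ k))
  (fun k => absc (c k) * (k%:R * eta ^+ k.-1 * d))) => // [k|n|z zr].
- by apply: wnorm_leZ; exact: wnorm_le_Xdiff.
- by under eq_bigr do rewrite mulrA; rewrite -mulr_suml ler_wpM2r.
- apply: clim_ext (climB (cf _ (wnorm_le_bound veta zr)) (cf _ (wnorm_le_bound v'eta zr))).
  by move=> n; rewrite /psum -sumrB; apply: eq_bigr => i _; rewrite mulrBr.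
Qed.

(** Without the constant term every monomial gains a factor [q] when the radius is multiplied by
    [q <= 1]; [q = e / (M + 1)] or less brings the norm below [e]. *)
Lemma wnorm_le_shrink rho h M e : 0 < rho -> wnorm_le rho h M -> 0 < e ->
  exists2 s, 0 < s <= rho & wnorm_le s (fun z => h z - h 0) e.
Proof.
move=> r0 [c [cM ch]] e0; have M0 : 0 <= M by have := cM 0%N; rewrite big_ord0.
have c0 : h 0 = c 0.
  apply: (clim_unique (ch 0 _)); first by rewrite absc0 ltW.
  apply/climP => d d0; exists 1%N => // -[//|n] _ /=.
  rewrite /psum big_ord_recl expr0 mulr1 big1 ?addr0 ?subrr ?absc0 // => i _.
  by rewrite lift0 expr0n mulr0.
have q0 : 0 < e / (M + 1) by rewrite divr_gt0 // ltr_wpDl.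
pose q := Num.min 1 (e / (M + 1)).
have [q_gt0 q_le1 q_le] : [/\ 0 < q, q <= 1 & q <= e / (M + 1)].
  by split; rewrite /q ?lt_min ?ltr01 ?q0 // ge_min lexx ?orbT.
exists (q * rho); first by rewrite mulr_gt0 //= ler_piMl // ltW.
exists (fun i => if i is 0%N then 0 else c i); split=> [[|n]|z zr].
- by rewrite big_ord0 ltW.
- rewrite big_ord_recl absc0 mul0r add0r.
  apply: (@le_trans _ _ (\sum_(i < n) q * (absc (c i.+1) * rho ^+ i.+1))).
    apply: ler_sum => i _; rewrite lift0 exprMn mulrCA.
    rewrite ler_wpM2r ?mulr_ge0 ?absc_ge0 ?exprn_ge0 ?(ltW r0) //.
    by rewrite exprS ler_piMr ?exprn_ile1 // ltW.
  rewrite -mulr_sumr; apply: (@le_trans _ _ (q * M)).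
    apply: ler_wpM2l; first exact: ltW.
    apply: le_trans (cM n.+1); rewrite big_ord_recl lerDr.
    by rewrite mulr_ge0 ?absc_ge0 // exprn_ge0 // ltW.
  apply: (@le_trans _ _ (e / (M + 1) * (M + 1))); last by rewrite divfK // gt_eqF // ltr_wpDl.
  by apply: ler_pM; rewrite ?(ltW q_gt0) // lerDl.
- have zrho : absc z <= rho by apply: le_trans zr _; rewrite ler_piMl // ltW.
  apply/climP => d d0; have /climP/(_ d d0)[N _ hN] := ch z zrho.
  exists N.+1 => // -[//|n] /= Nn; have := hN n.+1 (leqW Nn).
  rewrite /psum !big_ord_recl /= expr0 mulr1 mul0r add0r c0.
  by rewrite (_ : c 0 + _ - h z = \sum_(i < n) c (lift ord0 i) * z ^+ lift ord0 i - (h z - c 0)) //; ring.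
Qed.

Lemma geometric_half (k : nat) : \sum_(i < k) (2^-1 : R) ^+ i <= 2.
Proof.
suff : \sum_(i < k) (2^-1 : R) ^+ i + 2 * 2^-1 ^+ k = 2.
  by move=> h; rewrite -[leRHS]h lerDl mulr_ge0 // exprn_ge0.
elim: k => [|k IH]; first by rewrite big_ord0 expr0 add0r mulr1.
by rewrite big_ord_recr /= exprS -[RHS]IH; field.
Qed.

Lemma half_pow_cvg : (fun n => (2^-1 : R) ^+ n) @ \oo --> (0 : R).
Proof. by apply: cvg_expr; rewrite ger0_norm //; lra. Qed.

(** Geometric series on the disc of radius 1/2; all reciprocals of germs are obtained from it by
    composition. *)
Lemma wnorm_le_inv1 : wnorm_le (2^-1) (fun z : C => (1 + z)^-1) 2.
Proof.
exists (fun i => (-1) ^+ i); split=> [n|z zr].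
  rewrite (eq_bigr (fun i : 'I_n => (2^-1 : R) ^+ i)) ?geometric_half // => i _.
  by rewrite abscX abscN absc1 expr1n mul1r.
have z1 : 2^-1 <= absc (1 + z).
  have := absc_triangle (1 + z) (- z); rewrite abscN addrK absc1; lra.
have z10 : 1 + z != 0 by rewrite -absc_gt0; apply: lt_le_trans z1; lra.
apply: (@clim_le _ _ _ (fun n => 2 * 2^-1 ^+ n)); last first.
  by rewrite -[X in _ --> X](mulr0 2); apply: cvgM; [exact: cvg_cst|exact: half_pow_cvg].
apply: nearW => n.
have -> : psum (fun i => (-1) ^+ i) z n - (1 + z)^-1 = - ((1 + z)^-1 * (- z) ^+ n).
  apply: (mulfI z10); rewrite mulrBr mulrN mulrA divff // mul1r.
  rewrite /psum; elim: n => [|n IH]; first by rewrite big_ord0 mulr0 expr0 sub0r.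
  have -> : \sum_(i < n.+1) (-1) ^+ i * z ^+ i = \sum_(i < n) (-1) ^+ i * z ^+ i + (-z) ^+ n.
    by rewrite big_ord_recr /= -exprMn mulN1r.
  by rewrite mulrDr addrAC IH exprS; ring.
rewrite abscN abscM abscV abscX abscN; apply: ler_pM.
- by rewrite invr_ge0 absc_ge0.
- by rewrite exprn_ge0 ?absc_ge0.
- by rewrite -[leRHS]invrK lef_pV2 // posrE ?invr_gt0 ?absc_gt0.
- by rewrite lerXn2r // nnegrE ?absc_ge0.
Qed.

(** Identity theorem. The coefficients vanish by strong induction: once the earlier ones do, the
    value 0 at a small real [x] bounds [c i] by a constant multiple of [x]. *)
Lemma wnorm_le_eq0 rho h M d : 0 < rho -> wnorm_le rho h M -> 0 < d ->
  (forall x : R, 0 < x -> x < d -> h x%:C%C = 0) ->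
  forall z, absc z <= rho -> h z = 0.
Proof.
move=> r0 [c [cM ch]] d0 h0; have M0 : 0 <= M by have := cM 0%N; rewrite big_ord0.
suff c0 i : c i = 0.
  move=> z zr; apply: clim_unique (ch z zr) _; apply: clim_ext (clim_cst 0) => n.
  by rewrite /psum big1 // => i _; rewrite c0 mul0r.
have [n] := ubnP i; elim: n i => // n IH i; rewrite ltnS => le_in.
have cj j : (j < i)%N -> c j = 0 by move=> ji; apply: IH; exact: leq_trans ji le_in.
(* The terms beyond [i] contribute at most [(x / rho) ^+ i.+1 * M], and must cancel
   [c i * x ^+ i]. *)
have key (x : R) : 0 < x -> x < d -> x <= rho -> absc (c i) <= x * (M / rho ^+ i.+1).
  move=> x0 xd xr; have xC : absc x%:C%C = x by rewrite absc_real gtr0_norm.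
  have : clim (fun n => psum c x%:C%C n - c i * x%:C%C ^+ i) (0 - c i * x%:C%C ^+ i).
    apply: climB (clim_cst _); rewrite -(h0 x x0 xd); apply: ch.
    by rewrite xC.
  have E : (x / rho) ^+ i.+1 * M = x * (M / rho ^+ i.+1) * x ^+ i.
    by rewrite exprMn exprVn [in LHS]exprS; ring.
  move=> /(@clim_bound _ _ _ ((x / rho) ^+ i.+1 * M)); rewrite sub0r abscN abscM abscX xC.
  move=> B; rewrite -(@ler_pM2r _ (x ^+ i)) ?exprn_gt0 // -E; apply: B.
  near=> m.
  have im : (i < m)%N by near: m; exact: nbhs_infty_gt.
  rewrite /psum (bigD1 (Ordinal im)) //= addrAC subrr add0r.
  apply: le_trans (absc_sum _ _ _) _; apply: le_trans (ler_wpM2l _ (cM m)); last first.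
    by rewrite exprn_ge0 // divr_ge0 // ltW.
  rewrite mulr_sumr big_mkcond /=; apply: ler_sum => j _; case: ifPn => [ji|_]; last first.
    by rewrite mulr_ge0 ?mulr_ge0 ?absc_ge0 ?exprn_ge0 ?divr_ge0 ?(ltW r0) ?(ltW x0).
  have [ji'|ij|ij] := ltngtP j i; last by move: ji; rewrite -val_eqE /= ij eqxx.
    by rewrite cj // mul0r absc0 mul0r mulr0.
  rewrite mulrCA abscM abscX xC ler_wpM2l ?absc_ge0 //.
  rewrite -[x in x ^+ j](divfK (lt0r_neq0 r0)) exprMn.
  rewrite ler_wpM2r ?exprn_ge0 ?(ltW r0) //.
  by rewrite ler_wiXn2l ?divr_ge0 ?(ltW r0) ?(ltW x0) // ler_pdivrMr // mul1r.
apply/absc0_eq0/eqP; rewrite eq_le absc_ge0 andbT; apply/ler_addgt0Pr => e e0.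
rewrite add0r; pose K := M / rho ^+ i.+1.
have K0 : 0 <= K by rewrite divr_ge0 // exprn_ge0 // ltW.
pose x := Num.min (d / 2) (Num.min rho (e / (K + 1))).
have K1 : 0 < K + 1 by rewrite ltr_wpDl.
have x0 : 0 < x by rewrite !lt_min r0 !divr_gt0.
have xd : x < d by apply: le_lt_trans (_ : d / 2 < d); [rewrite ge_min lexx|lra].
have xr : x <= rho by rewrite !ge_min lexx orbT.
apply: le_trans (key x x0 xd xr) _.
have xe : x <= e / (K + 1) by rewrite !ge_min lexx !orbT.
apply: (@le_trans _ _ (e / (K + 1) * (K + 1))); last by rewrite divfK // gt_eqF.
by apply: ler_pM; rewrite ?(ltW x0) // lerDl.
Unshelve. all: by end_near. Qed.
End WeightedAlgebra.

Section WeightedCalculus.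
Variable R : realType.
Local Notation C := R[i].
Implicit Types (c : nat -> C) (h g f v : C -> C) (z w : C) (rho eta M r s : R).

(** The left side is one term of the binomial expansion. Differentiating a series thus costs a loss
    [s] of radius and a factor [1 / s]. *)
Lemma natmul_pow_le r s n : 0 <= r -> 0 <= s -> n%:R * r ^+ n.-1 * s <= (r + s) ^+ n.
Proof.
move=> r0 s0; elim: n => [|n IH]; first by rewrite !mul0r expr0.
have -> : n.+1%:R * r ^+ n.+1.-1 * s = r * (n%:R * r ^+ n.-1 * s) + r ^+ n * s.
  by rewrite -natr1; case: n {IH} => [|n] /=; [ring | rewrite exprS; ring].
rewrite exprS mulrDl lerD ?ler_wpM2l // mulrC ler_wpM2l //.
by rewrite lerXn2r ?nnegrE ?addr_ge0 // lerDl.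
Qed.

Lemma absc_nat n : absc (n%:R : C) = n%:R.
Proof. by rewrite (_ : (n%:R : C) = (n%:R)%:C%C) ?absc_real ?normr_nat // rmorph_nat. Qed.

(** The factor [(r + s) ^+ n] makes the bound summable against the coefficients. In the induction
    [|w| <= s / 2] saves [s / 2] in the factor [|z + w|], which is exactly what the new term
    [n z^(n-1) w^2] uses up. *)
Lemma pow_taylor2 r s z w n : 0 <= r -> 0 < s -> absc z <= r -> absc w <= s / 2 ->
  absc ((z + w) ^+ n - z ^+ n - n%:R * z ^+ n.-1 * w)
    <= 2 / s ^+ 2 * (r + s) ^+ n * absc w ^+ 2.
Proof.
move=> r0 s0 zr ws; have rs0 : 0 <= r + s by rewrite addr_ge0 // ltW.
have B0 : 0 <= 2 / s ^+ 2 by rewrite divr_ge0 // exprn_ge0 // ltW.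
elim: n => [|n IH].
  rewrite !expr0 subrr !mul0r subr0 absc0 mulr1 mulr_ge0 //.
  by rewrite exprn_ge0 ?absc_ge0.
have -> : (z + w) ^+ n.+1 - z ^+ n.+1 - n.+1%:R * z ^+ n.+1.-1 * w =
    (z + w) * ((z + w) ^+ n - z ^+ n - n%:R * z ^+ n.-1 * w) + n%:R * z ^+ n.-1 * w ^+ 2.
  by rewrite -natr1; case: n {IH} => [|n] /=; rewrite ?exprS; ring.
apply: le_trans (absc_triangle _ _) _.
rewrite abscM (abscM _ (w ^+ 2)) (abscM n%:R) !abscX absc_nat.
have le1 : absc (z + w) <= r + s - s / 2.
  by apply: le_trans (absc_triangle _ _) _; lra.
have le2 : n%:R * absc z ^+ n.-1 <= (r + s) ^+ n / s.
  rewrite ler_pdivlMr //; apply: le_trans (natmul_pow_le n r0 (ltW s0)).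
  rewrite ler_wpM2r ?(ltW s0) // ler_wpM2l ?ler0n //.
  by rewrite lerXn2r ?nnegrE ?absc_ge0.
set P := (r + s) ^+ n in IH le2 *; set W := absc w ^+ 2 in IH *.
have P0 : 0 <= P by rewrite exprn_ge0.
have W0 : 0 <= W by rewrite exprn_ge0 ?absc_ge0.
apply: (@le_trans _ _ ((r + s - s / 2) * (2 / s ^+ 2 * P * W) + P / s * W)).
  apply: lerD; last by rewrite ler_wpM2r.
  by apply: ler_pM; rewrite ?absc_ge0.
rewrite [(r + s) ^+ n.+1]exprS -/P le_eqVlt; apply/orP; left; apply/eqP.
by field; exact: lt0r_neq0.
Qed.

Definition dcoef c : nat -> C := fun i => i.+1%:R * c i.+1.

Lemma dcoef_bound c r s M n : 0 <= r -> 0 < s ->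
  (forall n, \sum_(i < n) absc (c i) * (r + s) ^+ i <= M) ->
  \sum_(i < n) absc (dcoef c i) * r ^+ i <= M / s.
Proof.
move=> r0 s0 cM; rewrite ler_pdivlMr // mulr_suml; apply: le_trans (cM n.+1).
rewrite big_ord_recl; apply: ler_wpDl.
  by rewrite mulr_ge0 ?absc_ge0 // exprn_ge0 // addr_ge0 // ltW.
apply: ler_sum => i _; rewrite lift0 /dcoef abscM absc_nat.
rewrite (_ : _ * s = absc (c i.+1) * (i.+1%:R * r ^+ i.+1.-1 * s)) /=; last by ring.
by rewrite ler_wpM2l ?absc_ge0 //; apply: natmul_pow_le => //; exact: ltW.
Qed.

Lemma psum_taylor2 c h h' r s M z w : 0 <= r -> 0 < s ->
  (forall n, \sum_(i < n) absc (c i) * (r + s) ^+ i <= M) ->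
  (forall z, absc z <= r + s -> clim (psum c z) (h z)) ->
  (forall z, absc z <= r -> clim (psum (dcoef c) z) (h' z)) ->
  absc z <= r -> absc w <= s / 2 ->
  absc (h (z + w) - h z - w * h' z) <= 2 / s ^+ 2 * M * absc w ^+ 2.
Proof.
move=> r0 s0 cM ch ch' zr ws.
have zrs : absc z <= r + s by lra.
have zwrs : absc (z + w) <= r + s by apply: le_trans (absc_triangle _ _) _; lra.
(* A partial sum of the derivative with [n] terms goes with partial sums of the function with [n.+1]
   terms. *)
have shift (u : nat -> C) (l : C) : clim u l -> clim (fun n => u n.+1) l.
  by move=> /climP h1; apply/climP => e /h1[N _ hN]; exists N => // n /= Nn; apply: hN; exact: leqW.
have L := climB (climB (shift _ _ (ch _ zwrs)) (shift _ _ (ch _ zrs))) (climZ w (ch' _ zr)).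
apply: (clim_bound L); apply: nearW => n.
have -> : psum c (z + w) n.+1 - psum c z n.+1 - w * psum (dcoef c) z n =
    \sum_(i < n.+1) c i * ((z + w) ^+ i - z ^+ i - i%:R * z ^+ i.-1 * w).
  have -> : w * psum (dcoef c) z n = \sum_(i < n.+1) c i * (i%:R * z ^+ i.-1 * w).
    rewrite big_ord_recl !mul0r mulr0 add0r /psum mulr_sumr; apply: eq_bigr => i _.
    by rewrite lift0 /dcoef /=; ring.
  by rewrite /psum -!sumrB; apply: eq_bigr => i _; ring.
apply: le_trans (absc_sum _ _ _) _.
have B0 : 0 <= 2 / s ^+ 2 by rewrite divr_ge0 // exprn_ge0 // ltW.
apply: (@le_trans _ _ (\sum_(i < n.+1) 2 / s ^+ 2 * absc w ^+ 2 * (absc (c i) * (r + s) ^+ i))).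
  apply: ler_sum => i _; rewrite abscM [leRHS]mulrCA ler_wpM2l ?absc_ge0 //.
  by rewrite [leRHS]mulrAC; exact: pow_taylor2.
rewrite -mulr_sumr mulrAC ler_wpM2r ?exprn_ge0 ?absc_ge0 //.
by rewrite ler_wpM2l.
Qed.

Lemma psum_lim_ex c rho M : (forall n, \sum_(i < n) absc (c i) * rho ^+ i <= M) ->
  exists h, forall z, absc z <= rho -> clim (psum c z) (h z).
Proof.
move=> cM; suff /choice[h hh] z : exists l, absc z <= rho -> clim (psum c z) l by exists h.
have [zr|] := leP (absc z) rho; last by exists 0.
have [n|l hl] := @abs_series_clim _ (fun i => c i * z ^+ i) M; last by exists l.
apply: le_trans (cM n); apply: ler_sum => i _; rewrite abscM abscX.
by rewrite ler_wpM2l ?absc_ge0 // lerXn2r ?nnegrE ?absc_ge0 // (le_trans (absc_ge0 z)).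
Qed.

Lemma wnorm_le_deriv r s h M : 0 <= r -> 0 < s -> wnorm_le (r + s) h M ->
  exists h' : C -> C, forall z w, absc z <= r -> absc w <= s / 2 ->
    absc (h (z + w) - h z - w * h' z) <= 2 / s ^+ 2 * M * absc w ^+ 2.
Proof.
move=> r0 s0 [c [cM ch]].
have [h' hh'] := psum_lim_ex (fun n => dcoef_bound n r0 s0 cM).
by exists h' => z w zr ws; exact: psum_taylor2 cM ch hh' zr ws.
Qed.

(** Termwise integration keeps the radius and costs only the factor [rho]. Differentiability is
    recorded by a quadratic remainder on smaller discs, a form that restricts directly to real
    arguments. *)
Lemma wnorm_le_antideriv rho h M : 0 < rho -> wnorm_le rho h M ->
  exists H : C -> C, [/\ wnorm_le rho H (rho * M), H 0 = 0 &
    forall r s z w, 0 <= r -> 0 < s -> r + s <= rho -> absc z <= r -> absc w <= s / 2 ->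
      absc (H (z + w) - H z - w * h z) <= 2 / s ^+ 2 * (rho * M) * absc w ^+ 2].
Proof.
move=> r0 [c [cM ch]].
pose e i : C := if i is j.+1 then (j.+1%:R)^-1 * c j else 0.
have eM n : \sum_(i < n) absc (e i) * rho ^+ i <= rho * M.
  have M0 : 0 <= M by have := cM 0%N; rewrite big_ord0.
  case: n => [|n]; first by rewrite big_ord0 mulr_ge0 // ltW.
  rewrite big_ord_recl absc0 mul0r add0r.
  apply: le_trans (ler_wpM2l (ltW r0) (cM n)); rewrite mulr_sumr.
  apply: ler_sum => i _; rewrite lift0 abscM abscV absc_nat exprS mulrCA.
  apply: ler_wpM2l; first exact: ltW.
  apply: ler_wpM2r; first by rewrite exprn_ge0 // ltW.
  by rewrite ler_piMl ?absc_ge0 // invf_le1 ?ltr0n // ler1n.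
have [H hH] := psum_lim_ex eM; exists H; split; first by exists e.
  apply: clim_unique (hH 0 _) _; first by rewrite absc0 ltW.
  apply: clim_ext (clim_cst 0) => n; rewrite /psum big1 // => -[[|i] ii _] /=.
    by rewrite mul0r.
  by rewrite expr0n mulr0.
move=> r s z w rr s0 rs zr ws.
have rs0 : 0 <= r + s by rewrite addr_ge0 // ltW.
apply: (@psum_taylor2 e) zr ws => // [n|y yr|y yr].
- apply: le_trans (eM n); apply: ler_sum => i _; rewrite ler_wpM2l ?absc_ge0 //.
  by rewrite lerXn2r ?nnegrE // ltW.
- by apply: hH; lra.
- have -> : dcoef e = c.
    by apply/funext => i; rewrite /dcoef /= mulVKf // pnatr_eq0.
  by apply: ch; lra.
Qed.

(* A power series vanishing to first order exactly at 0 is locally z(1 + o(1)) up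
   to a constant, so its inverse is the fixed point of v |-> r / p1 - w(v), a
   contraction for the weighted norm. *)
Lemma local_inverse rho p M e d eta0 : 0 < rho -> wnorm_le rho p M -> p 0 = 0 ->
  0 < e -> 0 < d -> (forall x : R, 0 < x -> x < d -> e * x <= absc (p x%:C%C)) -> 0 < eta0 ->
  exists s eta v, [/\ 0 < s, 0 < eta <= eta0, wnorm_le s v eta,
    forall z, absc z <= s -> p (v z) = z &
    forall a b, absc a <= eta -> absc b <= eta -> p a = p b -> a = b].
Proof.
move=> r0 [c [cM cp]] p0 e0 d0 plow eta00.
have M0 : 0 <= M by have := cM 0%N; rewrite big_ord0.
have c00 : c 0%N = 0.
  rewrite -p0; apply: clim_unique (cp 0 _); last by rewrite absc0 ltW.
  apply/climP => t t0; exists 1%N => // -[//|n] _ /=.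
  rewrite /psum big_ord_recl expr0 mulr1 big1 ?addr0 ?subrr ?absc0 // => i _.
  by rewrite lift0 expr0n mulr0.
(* Otherwise [p] would be of second order at 0, against the linear lower bound [plow] for small real
   [x]. *)
have c1n0 : c 1%N != 0.
  apply/negP => /eqP c10.
  have key (x : R) : 0 < x -> x < d -> x <= rho -> e <= x * (M / rho ^+ 2).
    move=> x0 xd xr; have xC : absc x%:C%C = x by rewrite absc_real gtr0_norm.
    rewrite -(ler_pM2r x0); apply: le_trans (plow x x0 xd) _.
    rewrite (_ : x * _ * x = (x / rho) ^+ 2 * M); last by rewrite exprMn exprVn expr2; ring.
    apply: (clim_bound (cp x%:C%C _)); first by rewrite xC.
    apply: nearW => m; apply: le_trans (absc_sum _ _ _) _.
    apply: le_trans (ler_wpM2l _ (cM m)); last by rewrite exprn_ge0 // divr_ge0 // ltW.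
    rewrite mulr_sumr; apply: ler_sum => -[[|[|i]] ii] _ /=.
    - by rewrite c00 mul0r absc0 mul0r mulr0.
    - by rewrite c10 mul0r absc0 mul0r mulr0.
    rewrite abscM abscX xC [leRHS]mulrCA ler_wpM2l ?absc_ge0 //.
    rewrite -[x in x ^+ i.+2](divfK (lt0r_neq0 r0)) exprMn.
    apply: ler_wpM2r; first by rewrite exprn_ge0 // ltW.
    by rewrite ler_wiXn2l ?divr_ge0 ?(ltW r0) ?(ltW x0) // ler_pdivrMr // mul1r.
  pose K := M / rho ^+ 2.
  have K0 : 0 <= K by rewrite divr_ge0 // exprn_ge0 // ltW.
  have K1 : 0 < K + 1 by rewrite ltr_wpDl.
  pose x := Num.min (d / 2) (Num.min rho (e / (2 * (K + 1)))).
  have x0 : 0 < x by rewrite !lt_min r0 !divr_gt0 ?mulr_gt0.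
  have xd : x < d by apply: le_lt_trans (_ : d / 2 < d); [rewrite ge_min lexx|lra].
  have xr : x <= rho by rewrite !ge_min lexx orbT.
  have xe : x <= e / (2 * (K + 1)) by rewrite !ge_min lexx !orbT.
  have := key x x0 xd xr; rewrite -/K => le_e.
  have : x * K <= e / (2 * (K + 1)) * (K + 1).
    by apply: ler_pM; rewrite ?(ltW x0) // lerDl.
  have -> : e / (2 * (K + 1)) * (K + 1) = e / 2 by field; exact: lt0r_neq0.
  lra.
set c1 := c 1%N in c1n0.
have c1p : 0 < absc c1 by rewrite absc_gt0.
(* The part of order at least 2 of the normalized series, with coefficients [b]. *)
pose W z := c1^-1 * p z - z.
pose b i : C := if (i < 2)%N then 0 else c1^-1 * c i.
have bW z : absc z <= rho -> clim (psum b z) (W z).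
  move=> zr; apply/climP => t t0.
  have /climP/(_ t t0) := climB (climZ c1^-1 (cp z zr)) (clim_cst z).
  move=> [N _ hN]; exists (maxn N 2) => // n /=; rewrite geq_max => /andP[Nn n2].
  have -> : psum b z n = c1^-1 * psum c z n - z; last exact: hN.
  have bE i : b i = c1^-1 * c i - (i == 1%N)%:R.
    by case: i => [|[|i]]; rewrite /b /= ?c00 ?mulr0 ?subr0 // mulVf // subrr.
  rewrite /psum mulr_sumr (eq_bigr (fun i : 'I_n => c1^-1 * (c i * z ^+ i)
    - (nat_of_ord i == 1%N)%:R * z ^+ i)); last by move=> i _; rewrite bE; ring.
  rewrite sumrB (@sum_ord_eq0 _ (fun i => (i == 1%N)%:R * z ^+ i) 1) ?n2 ?mul1r //.
  by move=> i /negPf ->; rewrite mul0r.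
(* The bound [rho / 2] allows the derivative coefficients of [p] at radius [eta] to be compared with
   its coefficients at radius [rho]; the last bound makes the Lipschitz constant of [W] at most
   1/2. *)
pose eta := Num.min eta0 (Num.min (rho / 2) (rho ^+ 2 * absc c1 / (8 * (M + 1)))).
have M1 : 0 < M + 1 by rewrite ltr_wpDl.
have r20 : 0 < rho ^+ 2 by rewrite exprn_gt0.
have eta_gt0 : 0 < eta by rewrite !lt_min eta00 !divr_gt0 ?mulr_gt0.
have eta_le : eta <= eta0 by rewrite ge_min lexx.
have eta_rho : eta <= rho / 2 by rewrite !ge_min lexx orbT.
have eta_c : 4 * eta * (M + 1) <= rho ^+ 2 * absc c1 / 2.
  have : eta <= rho ^+ 2 * absc c1 / (8 * (M + 1)) by rewrite !ge_min lexx !orbT.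
  by rewrite ler_pdivlMr ?mulr_gt0 // => ?; lra.
have etar : eta <= rho by lra.
have bL n : \sum_(i < n) absc (b i) * (i%:R * eta ^+ i.-1) <= 2^-1.
  pose k := (absc c1)^-1 * (4 * eta / rho ^+ 2).
  have k0 : 0 <= k.
    rewrite mulr_ge0 ?invr_ge0 ?absc_ge0 // divr_ge0 ?(ltW r20) // mulr_ge0 // ltW //.
  apply: (@le_trans _ _ (k * M)); last first.
    rewrite /k -(@ler_pM2r _ (rho ^+ 2 * absc c1)) ?mulr_gt0 //.
    rewrite (_ : _ * M * _ = 4 * eta * M); last by field; rewrite !lt0r_neq0.
    lra.
  apply: le_trans (ler_wpM2l k0 (cM n)); rewrite mulr_sumr; apply: ler_sum => i _.
  rewrite /b; case: ifPn => [_|]; first by rewrite absc0 mul0r mulr_ge0 // mulr_ge0 ?absc_ge0 // exprn_ge0 // ltW.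
  rewrite -leqNgt => i2; rewrite abscM abscV /k.
  rewrite (_ : (absc c1)^-1 * (4 * eta / rho ^+ 2) * _ =
    (absc c1)^-1 * absc (c i) * (4 * eta / rho ^+ 2 * rho ^+ i)); last by ring.
  apply: ler_wpM2l; first by rewrite mulr_ge0 ?invr_ge0 ?absc_ge0.
  have rh0 : 0 <= rho / 2 by lra.
  have := natmul_pow_le i rh0 rh0; rewrite -splitr => h1.
  have -> : eta = rho / 2 * (2 * eta / rho) by field; exact: lt0r_neq0.
  rewrite exprMn mulrA.
  have h2 : (2 * eta / rho) ^+ i.-1 <= 2 * eta / rho.
    rewrite -[leRHS]expr1 ler_wiXn2l ?divr_ge0 ?(ltW r0) ?mulr_ge0 ?(ltW eta_gt0) //; last first.
      by case: (nat_of_ord i) i2 => [|[|j]].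
    rewrite ler_pdivrMr // mul1r; lra.
  have h3 : i%:R * (rho / 2) ^+ i.-1 <= rho ^+ i * (2 / rho).
    rewrite -ler_pdivrMr ?divr_gt0 // invf_div; exact: h1.
  apply: le_trans (_ : rho ^+ i * (2 / rho) * (2 * eta / rho) <= _).
    by apply: ler_pM => //; rewrite ?mulr_ge0 ?exprn_ge0 // divr_ge0 ?(ltW r0) ?mulr_ge0 ?(ltW eta_gt0).
  rewrite le_eqVlt; apply/orP; left; apply/eqP; field; exact: lt0r_neq0.
have W0 : W 0 = 0 by rewrite /W p0 mulr0 subrr.
have bWeta z : absc z <= eta -> clim (psum b z) (W z) by move=> ze; apply: bW; exact: le_trans etar.
(* On this disc [c1^-1 * z] has norm [eta / 2], and [W] of an iterate adds at most [eta / 2]: the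
   iterates keep norm at most [eta]. *)
pose s := absc c1 * eta / 2.
have s0 : 0 < s by rewrite divr_gt0 ?mulr_gt0.
have Wlip a a' : absc a <= eta -> absc a' <= eta -> absc (W a - W a') <= 2^-1 * absc (a - a').
  move=> ha ha'; have s0' := ltW s0.
  have cst_le x t : absc x <= t -> wnorm_le s (fun=> x) t.
    by move=> xt; apply: wnorm_leW (wnorm_le_cst x s0').
  have := wnorm_le_lip s0 bWeta bL (cst_le _ _ ha) (cst_le _ _ ha') (cst_le _ _ (lexx _)).
  by move=> /(@wnorm_le_bound _ _ _ _ 0); apply; rewrite absc0.
pose v := fix v k z := if k is k'.+1 then c1^-1 * z - W (v k' z) else 0.
have zero_le t : 0 <= t -> wnorm_le s (fun=> 0) t.
  by move=> t0; apply: wnorm_leW (wnorm_le_cst 0 (ltW s0)) => //; rewrite ?absc0 // ltW.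
have vX : wnorm_le s (fun z => c1^-1 * z) (eta / 2).
  have E : (absc c1)^-1 * s = eta / 2 by rewrite /s; field; exact: lt0r_neq0.
  by have := wnorm_leZ c1^-1 (wnorm_le_id (ltW s0)); rewrite abscV E.
have veta k : wnorm_le s (v k) eta.
  elim: k => [|k IH]; first exact: (zero_le _ (ltW eta_gt0)).
  apply: (@wnorm_leW _ s s _ (eta / 2 + 2^-1 * eta)) => //; [exact: ltW|lra|].
  apply: wnorm_leB (ltW s0) vX _.
  have IH0 : wnorm_le s (fun z => v k z - 0) eta.
    by apply: wnorm_le_ext IH => z _; rewrite subr0.
  have := wnorm_le_lip s0 bWeta bL IH (zero_le _ (ltW eta_gt0)) IH0.
  by apply: wnorm_le_ext => z _; rewrite W0 subr0.
have vdiff k : wnorm_le s (fun z => v k.+1 z - v k z) (eta / 2 * 2^-1 ^+ k).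
  elim: k => [|k IH].
    by rewrite expr0 mulr1; apply: wnorm_le_ext vX => z _; rewrite /= W0 !subr0.
  have := wnorm_le_lip s0 bWeta bL (veta k.+1) (veta k) IH; rewrite mulrCA -exprS.
  move=> /wnorm_leN; apply: wnorm_le_ext => z _; rewrite /=; ring.
have vsum n : \sum_(k < n) eta / 2 * 2^-1 ^+ k <= eta.
  rewrite -mulr_sumr; apply: le_trans (ler_wpM2l _ (geometric_half R n)) _; last lra.
  by rewrite divr_ge0 // ltW.
have vtele n z : \sum_(k < n) (v k.+1 z - v k z) = v n z.
  elim: n => [|n IH]; first by rewrite big_ord0.
  by rewrite big_ord_recr IH /=; ring.
have /choice[V hV] z : exists l, absc z <= s -> clim (v ^~ z) l.
  have [zs|] := leP (absc z) s; last by exists 0.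
  have [n|l hl] := @abs_series_clim _ (fun k => v k.+1 z - v k z) eta.
    apply: le_trans (vsum n); apply: ler_sum => k _.
    exact: wnorm_le_bound (vdiff k) zs.
  by exists l => _; apply: clim_ext hl => n; exact: vtele.
have Veta : wnorm_le s V eta.
  apply: (wnorm_le_series s0 vdiff vsum) => z zs.
  by apply: clim_ext (hV z zs) => n; rewrite vtele.
exists s, eta, V; split=> // [|z zs|a a' ha ha' paa'].
- by rewrite eta_gt0.
- have Vz := wnorm_le_bound Veta zs.
  have l1 : clim (fun n => v n.+1 z) (V z).
    have /climP h1 := hV z zs; apply/climP => t /h1[N _ hN].
    by exists N => // n /= Nn; apply: (hN n.+1); exact: leqW.
  have l2 : clim (fun n => v n.+1 z) (c1^-1 * z - W (V z)).
    apply: climB; first exact: clim_cst.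
    apply: (@clim_le _ _ _ (fun n => 2^-1 * absc (v n z - V z))).
      by apply: nearW => n; apply: Wlip => //; exact: wnorm_le_bound (veta n) zs.
    by rewrite -[X in _ --> X](mulr0 2^-1); apply: cvgM; [exact: cvg_cst|exact: hV].
  have := clim_unique l1 l2; rewrite /W opprB addrCA => /(congr1 (fun x => x - V z)).
  rewrite subrr addrAC subrr add0r => /eqP; rewrite eq_sym subr_eq0 => /eqP.
  by move/(mulfI (invr_neq0 c1n0)).
(* Equal values of [p] give [W a - W a' = a' - a], and a contraction by 1/2 cannot preserve a
   nonzero distance. *)
- have := Wlip a a' ha ha'; rewrite /W paa'.
  rewrite (_ : _ - a - _ = - (a - a')); last by ring.
  rewrite abscN => le; apply/eqP; rewrite -subr_eq0; apply/eqP/absc0_eq0.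
  by have := absc_ge0 (a - a'); lra.
Qed.
End WeightedCalculus.

(** * Germs of analytic functions in one and two variables *)

Section Germs.
Variable R : realType.
Local Notation C := R[i].
Implicit Types (h g : C -> C -> C) (z w t : C) (rho eta M r s : R).

(* Power series germs in the first variable, uniformly in the second one. *)
Definition unif_germ h := forall e : R, 0 < e -> exists2 s, 0 < s &
  forall t, absc t <= s -> wnorm_le s (fun z => h z t - h 0 0) e.

Lemma unif_germ2 h g e : unif_germ h -> unif_germ g -> 0 < e ->
  exists2 s, 0 < s & forall t, absc t <= s ->
    wnorm_le s (fun z => h z t - h 0 0) e /\ wnorm_le s (fun z => g z t - g 0 0) e.
Proof.
move=> hh hg e0; have [s s0 hs] := hh e e0; have [r r0 hr] := hg e e0.
exists (Num.min s r) => [|t]; first by rewrite lt_min s0 r0.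
rewrite le_min => /andP[ts tr].
split; [apply: wnorm_leW (hs t ts)|apply: wnorm_leW (hr t tr)];
  by rewrite ?lexx // ?le_min ?ge_min ?lexx ?orbT // ?ltW // lt_min s0 r0.
Qed.

Lemma unif_germ_cst (a : C) : unif_germ (fun _ _ => a).
Proof.
move=> e e0; exists 1 => // t _; rewrite subrr.
by apply: wnorm_leW (wnorm_le_cst 0 ler01) => //; rewrite absc0 ltW.
Qed.

Lemma unif_germ_fst : unif_germ (fun z _ => z).
Proof.
move=> e e0; exists e => // t _; apply: wnorm_le_ext (wnorm_le_id (ltW e0)) => z _.
by rewrite subr0.
Qed.

Lemma unif_germ_snd : unif_germ (fun _ t => t).
Proof.
move=> e e0; exists e => // t te; rewrite subr0.
by apply: wnorm_leW (wnorm_le_cst t (ltW e0)) => //; exact: ltW.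
Qed.

Lemma unif_germD h g : unif_germ h -> unif_germ g -> unif_germ (fun z t => h z t + g z t).
Proof.
move=> hh hg e e0; have e20 : 0 < e / 2 by rewrite divr_gt0.
have [s s0 hs] := unif_germ2 hh hg e20; exists s => // t /hs[h1 h2].
have := wnorm_leD (ltW s0) h1 h2; rewrite -splitr.
by apply: wnorm_le_ext => z _; ring.
Qed.

Lemma unif_germZ (a : C) h : unif_germ h -> unif_germ (fun z t => a * h z t).
Proof.
move=> hh e e0; have a1 : 0 < absc a + 1 by rewrite ltr_wpDl ?absc_ge0.
have [s s0 hs] := hh _ (divr_gt0 e0 a1); exists s => // t /hs/(wnorm_leZ a) h1.
apply: wnorm_leW (ltW s0) (lexx s) _ (wnorm_le_ext _ h1); last by move=> z _; ring.
rewrite mulrA ler_pdivrMr // mulrC ler_wpM2l ?lerDl //; exact: ltW.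
Qed.

(** The product of the two deviations from the values at the origin has small norm; the remaining
    terms are multiples of [h], of [g] and a constant. *)
Lemma unif_germM h g : unif_germ h -> unif_germ g -> unif_germ (fun z t => h z t * g z t).
Proof.
move=> hh hg.
have kk : unif_germ (fun z t => (h z t - h 0 0) * (g z t - g 0 0)).
  move=> e e0; have e10 : 0 < Num.min 1 e by rewrite lt_min ltr01.
  have [s s0 hs] := unif_germ2 hh hg e10; exists s => // t /hs[h1 h2].
  apply: wnorm_leW (ltW s0) (lexx s) _ (wnorm_le_ext _ (wnorm_leM s0 h1 h2)).
    apply: (@le_trans _ _ (1 * e)); last by rewrite mul1r.
    by apply: ler_pM; rewrite ?(ltW e10) // ge_min lexx ?orbT.
  by move=> z _; rewrite !subrr mulr0 subr0.
have := unif_germD kk (unif_germD (unif_germZ (h 0 0) hg)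
  (unif_germD (unif_germZ (g 0 0) hh) (unif_germ_cst (- (h 0 0 * g 0 0))))).
by congr unif_germ; apply/funext => z; apply/funext => t; ring.
Qed.

Lemma unif_germ_sum (I : Type) (r : seq I) (h : I -> C -> C -> C) :
  (forall i, unif_germ (h i)) -> unif_germ (fun z t => \sum_(i <- r) h i z t).
Proof.
move=> hh; elim: r => [|i r IH].
  have := unif_germ_cst 0; congr unif_germ; apply/funext => z; apply/funext => t.
  by rewrite big_nil.
have := unif_germD (hh i) IH; congr unif_germ; apply/funext => z; apply/funext => t.
by rewrite big_cons.
Qed.

Lemma unif_germ_comp h (f : C -> C) eta M : 0 < eta -> wnorm_le eta f M ->
  unif_germ h -> unif_germ (fun z t => f (h z t - h 0 0)).
Proof.
move=> eta0 fM hh e e0; have [r /andP[r0 _] hr] := wnorm_le_shrink eta0 fM e0.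
have [s s0 hs] := hh r r0; exists s => // t /hs h1; rewrite subrr.
exact: wnorm_le_comp s0 hr h1.
Qed.

(** Factoring out [h 0 0] leaves [1 / (1 + k)] with [k] vanishing at the origin, to which the
    geometric series applies. *)
Lemma unif_germV h : h 0 0 != 0 -> unif_germ h -> unif_germ (fun z t => (h z t)^-1).
Proof.
move=> h0 hh; have half_gt0 : 0 < (2^-1 : R) by rewrite invr_gt0.
have := unif_germZ (h 0 0)^-1 (unif_germ_comp half_gt0 (wnorm_le_inv1 R) (unif_germZ (h 0 0)^-1 hh)).
congr unif_germ; apply/funext => z; apply/funext => t.
rewrite -invfM; congr (_^-1).
by rewrite mulrDr mulr1 mulrBr !mulrA divff // !mul1r addrC subrK.
Qed.

Lemma unif_germ_bound h : unif_germ h ->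
  exists s M, 0 < s /\ forall t, absc t <= s -> wnorm_le s (h ^~ t) M.
Proof.
move=> /(_ 1 ltr01)[s s0 hs]; exists s, (1 + absc (h 0 0)); split=> // t /hs h1.
apply: wnorm_le_ext (wnorm_leD (ltW s0) h1 (wnorm_le_cst (h 0 0) (ltW s0))) => z _.
by rewrite subrK.
Qed.

Lemma unif_germ1 (f : C -> C) eta M : 0 < eta -> wnorm_le eta f M ->
  unif_germ (fun z _ => f z).
Proof.
move=> eta0 fM; have := unif_germ_comp eta0 fM unif_germ_fst.
by congr unif_germ; apply/funext => z; apply/funext => t; rewrite subr0.
Qed.

Lemma nearW0 (P : R -> Prop) : (forall x, P x) -> \forall x \near (0 : R), P x.
Proof. by move=> Px; near=> x. Unshelve. all: by end_near. Qed.

(** Real analytic germs at 0, as restrictions of complex power series: the complexification is part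
    of the data. Reality of the coefficients is not imposed. *)
Definition rgerm (f : R -> R) := exists2 h : C -> C, unif_germ (fun z _ => h z) &
  \forall x \near (0 : R), h x%:C%C = (f x)%:C%C.

Lemma rgerm_near (f g : R -> R) : (\forall x \near (0 : R), f x = g x) ->
  rgerm f -> rgerm g.
Proof.
move=> fg [h hh hf]; exists h => //; near=> x.
rewrite (near hf x) ?(near fg x) //.
Unshelve. all: by end_near. Qed.

Lemma rgerm_cst (a : R) : rgerm (fun=> a).
Proof.
exists (fun=> a%:C%C); first exact: unif_germ_cst.
by near=> x.
Unshelve. all: by end_near. Qed.

Lemma rgerm_id : rgerm id.
Proof.
exists id; first exact: unif_germ_fst.
by near=> x.
Unshelve. all: by end_near. Qed.

Lemma rgermD (f g : R -> R) : rgerm f -> rgerm g -> rgerm (fun x => f x + g x).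
Proof.
move=> [h hh hf] [k kk kg]; exists (fun z => h z + k z); first exact: unif_germD.
by near=> x; rewrite (near hf x) // (near kg x) // rmorphD.
Unshelve. all: by end_near. Qed.

Lemma rgermM (f g : R -> R) : rgerm f -> rgerm g -> rgerm (fun x => f x * g x).
Proof.
move=> [h hh hf] [k kk kg]; exists (fun z => h z * k z); first exact: unif_germM.
by near=> x; rewrite (near hf x) // (near kg x) // rmorphM.
Unshelve. all: by end_near. Qed.

Lemma rgermN (f : R -> R) : rgerm f -> rgerm (fun x => - f x).
Proof.
move=> /(rgermM (rgerm_cst (-1))); apply: rgerm_near.
by apply: nearW0 => x; rewrite mulN1r.
Qed.

Lemma rgermB (f g : R -> R) : rgerm f -> rgerm g -> rgerm (fun x => f x - g x).
Proof. by move=> hf /rgermN; exact: rgermD. Qed.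

Lemma rgermX (f : R -> R) n : rgerm f -> rgerm (fun x => f x ^+ n).
Proof.
move=> hf; elim: n => [|n IH]; first exact: rgerm_cst.
by apply: rgerm_near (rgermM hf IH); apply: nearW0 => x; rewrite exprS.
Qed.

Lemma rgermV (f : R -> R) : f 0 != 0 -> rgerm f -> rgerm (fun x => (f x)^-1).
Proof.
move=> f0 [h hh hf]; exists (fun z => (h z)^-1); last first.
  by near=> x; rewrite (near hf x) // fmorphV.
have h0 : h 0 = (f 0)%:C%C by rewrite -(nbhs_singleton hf).
by apply: (@unif_germV (fun z _ => h z)) => //; rewrite h0 fmorph_eq0.
Unshelve. all: by end_near. Qed.

Lemma rgerm_sum (I : Type) (r : seq I) (P : pred I) (f : I -> R -> R) :
  (forall i, rgerm (f i)) -> rgerm (fun x => \sum_(i <- r | P i) f i x).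
Proof.
move=> hf; elim: r => [|i r IH].
  by apply: rgerm_near (rgerm_cst 0); apply: nearW0 => x; rewrite big_nil.
case Pi : (P i); last by apply: rgerm_near IH; apply: nearW0 => x; rewrite big_cons Pi.
by apply: rgerm_near (rgermD (hf i) IH); apply: nearW0 => x; rewrite big_cons Pi.
Qed.

Lemma rgerm_prod (I : Type) (r : seq I) (P : pred I) (f : I -> R -> R) :
  (forall i, rgerm (f i)) -> rgerm (fun x => \prod_(i <- r | P i) f i x).
Proof.
move=> hf; elim: r => [|i r IH].
  by apply: rgerm_near (rgerm_cst 1); apply: nearW0 => x; rewrite big_nil.
case Pi : (P i); last by apply: rgerm_near IH; apply: nearW0 => x; rewrite big_cons Pi.
by apply: rgerm_near (rgermM (hf i) IH); apply: nearW0 => x; rewrite big_cons Pi.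
Qed.

Lemma rgerm_ex (f : R -> R) : rgerm f -> exists (h : C -> C) s M, [/\ 0 < s, wnorm_le s h M &
  forall x : R, `|x| <= s -> h x%:C%C = (f x)%:C%C].
Proof.
move=> [h /unif_germ_bound[s [M [s0 hs]]] /nbhs_ballP[d /= d0 hd]].
have h1 := hs 0; exists h, (Num.min s (d / 2)), M; split.
- by rewrite lt_min s0 divr_gt0.
- apply: wnorm_leW (h1 _); rewrite ?ge_min ?lexx //.
    by rewrite le_min !ltW // divr_gt0.
  by rewrite absc0 ltW.
- move=> x; rewrite le_min => /andP[_ xd]; apply: hd.
  by rewrite /ball /= sub0r normrN (le_lt_trans xd) // ltr_pdivrMr // ltr_pMr // ltr1n.
Qed.

Lemma rgerm_of (f : R -> R) (h : C -> C) s M : 0 < s -> wnorm_le s h M ->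
  (forall x : R, `|x| <= s -> h x%:C%C = (f x)%:C%C) -> rgerm f.
Proof.
move=> s0 hM hf; exists h; first exact: unif_germ1 s0 hM.
apply/nbhs_ballP; exists s => // x; rewrite /ball /= sub0r normrN => xs.
by apply: hf; exact: ltW.
Qed.
End Germs.

(** * Analytic linear differential equations and inverse functions *)

Section LinearODE.
Variable R : realType.
Local Notation C := R[i].
Implicit Types (rho eta M r s : R).

Lemma is_derive_sq (f : R -> R) (x d K s : R) : 0 < s ->
  (forall w, `|w| <= s -> `|f (x + w) - f x - w * d| <= K * w ^+ 2) -> is_derive x 1 f d.
Proof.
move=> s0 le; suff h : (fun w => w^-1 *: (f (w *: 1 + x) - f x)) @ 0^' --> d.
  by apply: DeriveDef; [apply/cvg_ex; exists d|exact: cvg_lim].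
apply/cvgrPdist_le => e e0.
have K1 : 0 < `|K| + 1 by rewrite ltr_wpDl.
near=> w; have w0 : w != 0 by near: w; exact: nbhs_dnbhs_neq.
have ws : `|w| <= s by near: w; apply: dnbhs0_le.
have we : `|w| <= e / (`|K| + 1) by near: w; apply: dnbhs0_le; rewrite divr_gt0.
have := le w ws; rewrite /GRing.scale /= mulr1 [w + x]addrC => le_w.
have -> : d - w^-1 * (f (x + w) - f x) = - (w^-1 * (f (x + w) - f x - w * d)) by field.
rewrite normrN normrM normfV ler_pdivrMl ?normr_gt0 //.
apply: le_trans le_w _; rewrite -real_normK ?num_real // expr2 mulrCA ler_wpM2l //.
apply: (@le_trans _ _ ((`|K| + 1) * (e / (`|K| + 1)))); last by rewrite mulrC divfK // gt_eqF.
apply: (@le_trans _ _ (`|K| * `|w|)); first by rewrite ler_wpM2r // ler_norm.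
by apply: ler_pM => //; rewrite lerDl.
Unshelve. all: by end_near. Qed.

Lemma is_derive_Re (H h : C -> C) (r s K x : R) : 0 <= r -> 0 < s -> `|x| <= r ->
  (forall z w, absc z <= r -> absc w <= s -> absc (H (z + w) - H z - w * h z) <= K * absc w ^+ 2) ->
  is_derive x 1 (fun y : R => complex.Re (H y%:C%C)) (complex.Re (h x%:C%C)).
Proof.
move=> r0 s0 xr le; apply: (@is_derive_sq _ _ _ K s s0) => w ws.
have xC : absc x%:C%C <= r by rewrite absc_real.
have wC : absc w%:C%C <= s by rewrite absc_real.
have := le _ _ xC wC; rewrite absc_real real_normK ?num_real //; apply: le_trans.
apply: le_trans (Re_le_absc _); rewrite -rmorphD /=.
case: (H _) => a a'; case: (H _) => b b'; case: (h _) => c c'.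
by rewrite /= mul0r subr0.
Qed.

Lemma derive_bound (e e' : R -> R) (s B : R) : e 0 = 0 ->
  (forall x : R, `|x| < s -> is_derive x 1 e (e' x)) ->
  (forall x : R, `|x| < s -> `|e' x| <= B) ->
  forall x : R, `|x| < s -> `|e x| <= B * `|x|.
Proof.
move=> e00 de eB x xs.
have cont (a b : R) : `|a| < s -> `|b| < s -> {within `[a, b], continuous e}.
  move=> as_ bs; apply: derivable_within_continuous => y; rewrite in_itv /= => /andP[ay yb].
  suff ys : `|y| < s by have [] := de y ys.
  by move: as_ bs; rewrite !ltr_norml => /andP[? ?] /andP[? ?]; apply/andP; split; lra.
have s0 : `|0 : R| < s by rewrite normr0; apply: le_lt_trans xs.
have inside y (a b : R) : `|a| < s -> `|b| < s -> y \in `]a, b[ -> `|y| < s.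
  move=> as_ bs; rewrite in_itv /= => /andP[ay yb].
  by move: as_ bs; rewrite !ltr_norml => /andP[? ?] /andP[? ?]; apply/andP; split; lra.
have [x0|x0|->] := ltgtP x 0; last by rewrite e00 !normr0 mulr0.
  have [y yI] := MVT x0 (fun y hy => de y (inside y _ _ xs s0 hy)) (cont _ _ xs s0).
  rewrite e00 sub0r => E; rewrite -normrN E normrM sub0r normrN ler_wpM2r //.
  exact/eB/(inside _ _ _ xs s0 yI).
have [y yI] := MVT x0 (fun y hy => de y (inside y _ _ s0 xs hy)) (cont _ _ s0 xs).
rewrite e00 !subr0 => ->; rewrite normrM ler_wpM2r //.
exact/eB/(inside _ _ _ s0 xs yI).
Qed.

Lemma ReD (z w : C) : complex.Re (z + w) = complex.Re z + complex.Re w.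
Proof. by case: z; case: w. Qed.

Lemma ReB (z w : C) : complex.Re (z - w) = complex.Re z - complex.Re w.
Proof. by case: z; case: w. Qed.

Lemma ReMl (x : R) (z : C) : complex.Re (x%:C%C * z) = x * complex.Re z.
Proof. by case: z => a b /=; rewrite mul0r subr0. Qed.

Lemma Re_sum (J : Type) (l : seq J) (f : J -> C) :
  complex.Re (\sum_(j <- l) f j) = \sum_(j <- l) complex.Re (f j).
Proof. by elim/big_rec2: _ => // j y z _ <-; rewrite ReD. Qed.

Lemma clim_Re (u : nat -> C) (l : C) : clim u l ->
  (fun n => complex.Re (u n)) @ \oo --> complex.Re l.
Proof.
move=> /climP h; apply/cvgrPdist_lt => e /h; apply: filterS => n.
apply: le_lt_trans; rewrite distrC -ReB; exact: Re_le_absc.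
Qed.

(** Complex limits are later compared with real functions through their real parts only; taking real
    parts of the coefficients turns such a real part into a power series again. *)
Lemma wnorm_le_Re (h : C -> C) s M : 0 <= s -> wnorm_le s h M ->
  exists2 g, wnorm_le s g M & forall x : R, `|x| <= s -> g x%:C%C = (complex.Re (h x%:C%C))%:C%C.
Proof.
move=> s0 [c [cM ch]].
have rM n : \sum_(i < n) absc (complex.Re (c i))%:C%C * s ^+ i <= M.
  apply: le_trans (cM n); apply: ler_sum => i _.
  by rewrite ler_wpM2r ?exprn_ge0 // absc_real Re_le_absc.
have [g hg] := @psum_lim_ex _ (fun i => (complex.Re (c i))%:C%C) _ _ rM.
exists g => [|x xs]; first by exists (fun i => (complex.Re (c i))%:C%C).
have xC : absc x%:C%C <= s by rewrite absc_real.
apply: clim_unique (hg _ xC) _; have /climP h1 := ch _ xC; apply/climP => e /h1.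
apply: filterS => n; apply: le_lt_trans; apply: le_trans (Re_le_absc _).
have -> : psum (fun i => (complex.Re (c i))%:C%C) x%:C%C n = (complex.Re (psum c x%:C%C n))%:C%C.
  rewrite /psum Re_sum rmorph_sum; apply: eq_bigr => i _ /=.
  by rewrite -rmorphXn [in RHS]mulrC ReMl rmorphM /= mulrC.
by rewrite -rmorphB absc_real ReB.
Qed.

(** The Picard iteration is run twice: on complex power series, where its increments are summable in
    norm, and in real parts, where its iterates converge to the given solution [g]. Comparing the
    two limits shows that [g] is analytic. *)
Lemma analytic_linear_ode (I : finType) (A : I -> I -> R -> R) (g : I -> R -> R) (d : R) :
  0 < d -> (forall i j, rgerm (A i j)) ->
  (forall i (x : R), `|x| < d -> is_derive x 1 (g i) (\sum_j A i j x * g j x)) ->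
  forall i, rgerm (g i).
Proof.
move=> d0 rA dg.
have /choice[H0 hH0] (p : I * I) : exists t : (C -> C) * R * R,
    [/\ 0 < t.1.2, wnorm_le t.1.2 t.1.1 t.2 &
    forall x : R, `|x| <= t.1.2 -> t.1.1 x%:C%C = (A p.1 p.2 x)%:C%C].
  by have [h [s [M hh]]] := rgerm_ex (rA p.1 p.2); exists (h, s, M).
pose Ah i j := (H0 (i, j)).1.1; pose m i j := (H0 (i, j)).2.
pose B := \sum_i \sum_j m i j.
have m0 i j : 0 <= m i j by have [_ /wnorm_le_ge0] := hH0 (i, j).
have mB i : \sum_j m i j <= B.
  by rewrite /B [leRHS](bigD1 i) //= lerDl; do 2 (apply: sumr_ge0 => ? _).
have B0 : 0 <= B by apply: sumr_ge0 => i _; apply: sumr_ge0.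
pose r0 := \big[Num.min/d / 2]_(p : I * I) (H0 p).1.2.
have r00 : 0 < r0.
  rewrite /r0; elim/big_ind: _ => [|x y x0 y0|p _]; rewrite ?divr_gt0 //.
    by rewrite lt_min x0.
  by have [] := hH0 p.
(* Chosen so that [sg * B <= 1/2]: multiplication by the matrix followed by integration halves the
   norm. *)
pose sg := Num.min r0 (2 * (B + 1))^-1.
have B1 : 0 < 2 * (B + 1) by rewrite mulr_gt0 // ltr_wpDl.
have sg0 : 0 < sg by rewrite lt_min r00 invr_gt0.
have sgd : sg < d.
  apply: le_lt_trans (_ : d / 2 < d); last lra.
  apply: (@le_trans _ _ r0); first by rewrite ge_min lexx.
  exact: bigmin_le_id.
have sgB : sg * B <= 2^-1.
  apply: (@le_trans _ _ ((2 * (B + 1))^-1 * (B + 1))).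
    by apply: ler_pM; rewrite ?(ltW sg0) ?lerDl // ge_min lexx orbT.
  by rewrite invfM mulfVK // gt_eqF // ltr_wpDl.
have sgle i j : sg <= (H0 (i, j)).1.2.
  by apply: (@le_trans _ _ r0); [rewrite ge_min lexx|exact: bigmin_le_cond].
have Am i j : wnorm_le sg (Ah i j) (m i j).
  by have [_ hM _] := hH0 (i, j); exact: wnorm_leW (ltW sg0) (sgle i j) (lexx _) hM.
have AhE i j (x : R) : `|x| <= sg -> Ah i j x%:C%C = (A i j x)%:C%C.
  by move=> xs; have [_ _] := hH0 (i, j); apply; exact: le_trans (sgle i j).
pose T (D : I -> C -> C) i z := \sum_j Ah i j z * D j z.
have Tm D t : (forall i, wnorm_le sg (D i) t) -> 0 <= t ->
    forall i, wnorm_le sg (T D i) (B * t).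
  move=> Dt t0 i.
  apply: wnorm_leW (ltW sg0) (lexx _) _
    (wnorm_le_sum _ (ltW sg0) (fun j => wnorm_leM sg0 (Am i j) (Dt j))).
  by rewrite -mulr_suml ler_wpM2r.
pose G := \sum_i `|g i 0|.
have G0 : 0 <= G by exact: sumr_ge0.
pose Q (t : R) (h H : C -> C) := [/\ wnorm_le sg H t, H 0 = 0 &
  forall r s, 0 <= r -> 0 < s -> r + s <= sg -> exists K, forall z w, absc z <= r ->
    absc w <= s / 2 -> absc (H (z + w) - H z - w * h z) <= K * absc w ^+ 2].
have Qex (t : R) h : 0 <= t -> wnorm_le sg h (B * t) -> exists H, Q (t / 2) h H.
  move=> t0 hB; have [H [Hn H00 HK]] := wnorm_le_antideriv sg0 hB; exists H; split=> //.
    apply: wnorm_leW (ltW sg0) (lexx _) _ Hn.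
    by rewrite mulrA mulrC ler_wpM2l.
  by move=> r s hr hs hrs; eexists => z w; exact: HK.
(* Increments of the iteration: [D k.+1] is the antiderivative, zero at 0, of the matrix applied to
   [D k]. It comes from an existence statement, hence the choice by [xget], justified in [Dn]. *)
pose D := fix D k : I -> C -> C := if k is k'.+1 then
  (fun i => xget (fun=> 0) [set H | Q (G * 2^-1 ^+ k) (T (D k') i) H]) else (fun i _ => (g i 0)%:C%C).
have pow0 k : 0 <= G * 2^-1 ^+ k by rewrite mulr_ge0 // exprn_ge0.
have Dn k : (forall i, wnorm_le sg (D k i) (G * 2^-1 ^+ k)) /\
    forall i, Q (G * 2^-1 ^+ k.+1) (T (D k) i) (D k.+1 i).
  elim: k => [|k [IHn IHQ]].
    have n0 i : wnorm_le sg (D 0%N i) (G * 2^-1 ^+ 0).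
      rewrite expr0 mulr1; apply: wnorm_leW (wnorm_le_cst _ (ltW sg0)) => //; first exact: ltW.
      by rewrite absc_real /G (bigD1 i) //= lerDl sumr_ge0.
    split=> // i; apply: (@xgetPex _ (fun=> 0) [set H | Q (G * 2^-1 ^+ 1) (T (D 0%N) i) H]).
    have := Qex _ _ (pow0 0%N) (Tm _ _ n0 (pow0 0%N) i).
    by rewrite expr0 expr1 mulr1.
  have n1 i : wnorm_le sg (D k.+1 i) (G * 2^-1 ^+ k.+1) by have [] := IHQ i.
  split=> // i; apply: (@xgetPex _ (fun=> 0) [set H | Q (G * 2^-1 ^+ k.+2) (T (D k.+1) i) H]).
  have := Qex _ _ (pow0 k.+1) (Tm _ _ n1 (pow0 k.+1) i).
  by rewrite -mulrA -exprSr.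
pose q k i (x : R) := \sum_(l < k) complex.Re (D l i x%:C%C).
have dq k i (x : R) : `|x| < sg -> is_derive x 1 (q k.+1 i) (\sum_j A i j x * q k j x).
  move=> xs; elim: k => [|k IH].
    rewrite (_ : q 1%N i = fun=> g i 0); last first.
      by apply/funext => y; rewrite /q big_ord_recr big_ord0 /= add0r.
    rewrite big1 => [|j _]; first exact: is_derive_cst.
    by rewrite /q big_ord0 mulr0.
  rewrite (_ : q k.+2 i = q k.+1 i \+ (fun y : R => complex.Re (D k.+1 i y%:C%C))); last first.
    by apply/funext => y; rewrite /q big_ord_recr.
  have -> : \sum_j A i j x * q k.+1 j x =
      \sum_j A i j x * q k j x + complex.Re (T (D k) i x%:C%C).
    rewrite Re_sum -big_split; apply: eq_bigr => j _ /=.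
    by rewrite AhE ?(ltW xs) // ReMl /q big_ord_recr mulrDr.
  apply: is_deriveD; have [_ _ Qk] := (Dn k).2 i.
  have r1 : 0 <= (`|x| + sg) / 2 by rewrite divr_ge0 // addr_ge0 // ltW.
  have s1 : 0 < (sg - `|x|) / 2 by rewrite divr_gt0 // subr_gt0.
  have rs1 : (`|x| + sg) / 2 + (sg - `|x|) / 2 <= sg by lra.
  have [K HK] := Qk _ _ r1 s1 rs1.
  apply: (is_derive_Re r1 _ _ HK); first by rewrite divr_gt0.
  by lra.
have Eex i : exists E, forall x : R, `|x| < sg -> `|g i x| <= E.
  have cg : {within `[- sg, sg], continuous g i}.
    apply: derivable_within_continuous => y; rewrite in_itv /= => /andP[y1 y2].
    suff yd : `|y| < d by have [] := dg i y yd.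
    by rewrite ltr_norml; apply/andP; split; lra.
  have sgN : - sg <= sg by lra.
  have [c1 _ h1] := EVT_max sgN cg; have [c2 _ h2] := EVT_min sgN cg.
  exists (Num.max `|g i c1| `|g i c2|) => x; rewrite ltr_norml => /andP[x1 x2].
  have xI : x \in `[- sg, sg] by rewrite in_itv /= !ltW.
  have := h1 x xI; have := h2 x xI; rewrite le_max => ha hb.
  have := ler_norm (g i c1); have := ler_norm (- g i c2); rewrite normrN => hc hd.
  have [g0|g0] := leP 0 (g i x).
    by rewrite ger0_norm // (le_trans hb hd).
  by rewrite ltr0_norm // orbC (le_trans _ hc) // lerN2.
have /choice[E0 hE0] := Eex.
have E00 i : 0 <= E0 i by apply: le_trans (hE0 i 0 _) => //; rewrite normr0.
pose E := \sum_i E0 i.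
have E_ge0 : 0 <= E by exact: sumr_ge0.
have hE i (x : R) : `|x| < sg -> `|g i x| <= E.
  move=> xs; apply: le_trans (hE0 i x xs) _.
  by rewrite /E (bigD1 i) //= lerDl sumr_ge0.
(* [g] and [q k.+1] agree at 0 and their derivatives differ by the matrix applied to [g - q k], so
   the mean value inequality over radius [sg] halves the distance. *)
have err k i (x : R) : `|x| < sg -> `|g i x - q k i x| <= E * 2^-1 ^+ k.
  elim: k i x => [|k IH] i x xs; first by rewrite /q big_ord0 subr0 expr0 mulr1; exact: hE.
  have q0 : g i 0 - q k.+1 i 0 = 0.
    rewrite /q big_ord_recl big1 ?addr0 ?subrr // => l _.
    by rewrite lift0; have [_ -> _] := (Dn l).2 i.
  apply: le_trans (@derive_bound (fun y => g i y - q k.+1 i y)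
    (fun y => \sum_j A i j y * g j y - \sum_j A i j y * q k j y) sg (B * (E * 2^-1 ^+ k))
    q0 _ _ x xs) _.
  - move=> y ys; apply: is_deriveB; last exact: dq.
    by apply: dg; exact: lt_trans sgd.
  - move=> y ys; rewrite -sumrB; apply: le_trans (ler_norm_sum _ _ _) _.
    apply: (@le_trans _ _ (\sum_j m i j * (E * 2^-1 ^+ k))); last first.
      by rewrite -mulr_suml ler_wpM2r // mulr_ge0 // exprn_ge0.
    apply: ler_sum => j _; rewrite -mulrBr normrM; apply: ler_pM => //; last exact: IH.
    rewrite -absc_real -AhE ?(ltW ys) //; apply: wnorm_le_bound (Am i j) _.
    by rewrite absc_real ltW.
  have P0 : 0 <= E * 2^-1 ^+ k by rewrite mulr_ge0 // exprn_ge0.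
  rewrite (_ : B * _ * _ = E * 2^-1 ^+ k * (B * `|x|)); last by ring.
  rewrite exprSr [leRHS]mulrA; apply: ler_wpM2l => //.
  by apply: le_trans sgB; rewrite mulrC; apply: ler_wpM2r => //; exact: ltW.
move=> i.
have Gsum n : \sum_(k < n) G * 2^-1 ^+ k <= G * 2.
  by rewrite -mulr_sumr ler_wpM2l // geometric_half.
have /choice[S hS] : forall z, exists l, absc z <= sg -> clim (fun n => \sum_(k < n) D k i z) l.
  move=> z; have [zs|] := leP (absc z) sg; last by exists 0.
  have [n|l hl] := @abs_series_clim _ (fun k => D k i z) (G * 2); last by exists l.
  apply: le_trans (Gsum n); apply: ler_sum => k _.
  exact: wnorm_le_bound ((Dn k).1 i) zs.
have Sn : wnorm_le sg S (G * 2).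
  exact: (wnorm_le_series sg0 (fun k => (Dn k).1 i) Gsum hS).
have [S' S'n hS'] := wnorm_le_Re (ltW sg0) Sn.
have sg20 : 0 < sg / 2 by rewrite divr_gt0.
apply: (@rgerm_of _ _ S' (sg / 2) (G * 2)) => // [|x xs].
  by apply: wnorm_leW S'n => //; rewrite ?ltW //; lra.
have xsg : `|x| < sg by lra.
rewrite hS' ?ltW //; congr (_%:C)%C.
have l1 : (fun n => q n i x) @ \oo --> complex.Re (S x%:C%C).
  have := clim_Re (hS x%:C%C (_ : absc x%:C%C <= sg)); rewrite absc_real => /(_ (ltW xsg)).
  by apply: eq_cvgn => n; rewrite Re_sum.
have l2 : (fun n => q n i x) @ \oo --> g i x.
  apply/subr_cvg0/norm_cvg0P.
  apply: (@squeeze_cvgr _ _ _ _ (fun=> 0) (fun k => E * 2^-1 ^+ k)); last 2 first.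
  - exact: cvg_cst.
  - by rewrite -[X in _ --> X](mulr0 E); apply: cvgM; [exact: cvg_cst|exact: half_pow_cvg].
  by apply: nearW => k /=; rewrite normr_ge0 /= distrC err.
exact: cvg_unique l1 l2.
Qed.
End LinearODE.

(** * Inverse functions and the identity theorem in two variables *)

Section Inverse.
Variable R : realType.
Local Notation C := R[i].

(** [F (u 0 + r)] is [f] at the local inverse of [u]. That inverse is a complex power series; at
    real [r] it is identified, by injectivity of [u] on a small disc, with the real solution found
    by the intermediate value theorem. *)
Lemma rgerm_inverse (u f F : R -> R) (c : R) : rgerm u -> rgerm f ->
  is_derive (0 : R) 1 u c -> c != 0 ->
  (\forall x \near (0 : R), {for x, continuous u}) ->
  (\forall x \near (0 : R), F (u x) = f x) ->
  rgerm (fun r => F (u 0 + r)).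
Proof.
move=> /rgerm_ex[uh [s1 [M1 [s10 uM uE]]]] /rgerm_ex[fh [s2 [M2 [s20 fM fE]]]].
move=> uc c0 ucont Fu; have c_gt0 : 0 < `|c| by rewrite normr_gt0.
have du : \forall x \near (0 : R), `|u x - u 0 - c * x| <= `|c| / 2 * `|x|.
  have [dvu uE'] := uc.
  have : (fun h => h^-1 *: ((u \o shift 0) (h *: 1) - u 0)) @ 0^' --> c by rewrite -uE'; exact: dvu.
  move=> /cvgrPdist_le/(_ (`|c| / 2)).
  rewrite divr_gt0 // => /(_ isT); rewrite near_withinE; apply: filterS => x hx.
  have [->|x0] := eqVneq x 0; first by rewrite mulr0 subrr subr0 !normr0 mulr0.
  have := hx x0; rewrite /GRing.scale /= mulr1 addr0 => h1.
  have -> : u x - u 0 - c * x = - (c - x^-1 * (u x - u 0)) * x by field.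
  by rewrite normrM normrN ler_wpM2r.
have [d /= d0 hd] : exists2 d, 0 < d & forall x : R, `|x| < d ->
   [/\ `|u x - u 0 - c * x| <= `|c| / 2 * `|x|, {for x, continuous u} & F (u x) = f x].
  have /nbhs_ballP[d /= d0 hd] : \forall x \near (0 : R), [/\ `|u x - u 0 - c * x| <= `|c| / 2 * `|x|,
     {for x, continuous u} & F (u x) = f x].
    by near=> x; split; near: x.
  by exists d => // x xd; apply: hd; rewrite /ball /= sub0r normrN.
have u0E : uh 0 = (u 0)%:C%C by rewrite -uE // normr0 ltW.
pose p z := uh z - uh 0.
have pM : wnorm_le s1 p (M1 + absc (uh 0)).
  by apply: wnorm_leB; rewrite ?(ltW s10) //; apply: wnorm_le_cst; exact: ltW.
pose d1 := Num.min d s1; have d10 : 0 < d1 by rewrite lt_min d0.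
have c20 : 0 < `|c| / 2 by rewrite divr_gt0.
have plow (x : R) : 0 < x -> x < d1 -> `|c| / 2 * x <= absc (p x%:C%C).
  move=> x0; rewrite lt_min => /andP[xd xs].
  have xa : `|x| <= s1 by rewrite gtr0_norm // ltW.
  rewrite /p (uE x xa) u0E -rmorphB absc_real.
  have xd' : `|x| < d by rewrite gtr0_norm.
  have [+ _ _] := hd x xd'.
  move=> h1; have := ler_normD (u x - u 0) (- (u x - u 0 - c * x)).
  rewrite normrN (_ : u x - u 0 - (u x - u 0 - c * x) = c * x); last by ring.
  by move: h1; rewrite normrM (gtr0_norm x0) => ? ?; lra.
have p00 : p 0 = 0 by rewrite /p subrr.
have eta00 : 0 < Num.min (d / 2) s2 by rewrite lt_min divr_gt0.
have s1' := s10.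
have [s [eta [v [s0 /andP[eta0 etale] vM pv pinj]]]] :=
  @local_inverse _ s1 p _ _ _ _ s1' pM p00 c20 d10 plow eta00.
pose eta1 := Num.min eta s1.
have eta10 : 0 < eta1 by rewrite lt_min eta0.
have eta1d : eta1 < d.
  apply: (@le_lt_trans _ _ (d / 2)); last lra.
  apply: (@le_trans _ _ eta); first by rewrite ge_min lexx.
  by apply: le_trans etale _; rewrite ge_min lexx.
have etas2 : eta <= s2 by apply: le_trans etale _; rewrite ge_min lexx orbT.
(* The error in [hd] is at most half of the linear term, so [u eta1] and [u (- eta1)] lie on
   opposite sides of [u 0], at distance at least [|c| / 2 * eta1]. *)
have inv (r : R) : `|r| <= `|c| / 2 * eta1 -> exists2 x, `|x| <= eta1 & u x = u 0 + r.
  move=> rs.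
  have cu : {within `[- eta1, eta1], continuous u}.
    apply: continuous_in_subspaceT => y; rewrite inE /= in_itv /= => /andP[y1 y2].
    have yd : `|y| < d by rewrite (le_lt_trans _ eta1d) // ler_norml y1.
    by have [] := hd y yd.
  have e1 : - eta1 <= eta1 by lra.
  have n1 : `|eta1| < d by rewrite gtr0_norm.
  have n2 : `|- eta1| < d by rewrite normrN gtr0_norm.
  have [h1 _ _] := hd _ n1; have [h2 _ _] := hd _ n2.
  move: h1 h2; rewrite normrN (gtr0_norm eta10) !ler_norml => /andP[h1 h1'] /andP[h2 h2'].
  move: rs; rewrite ler_norml => /andP[r1 r2].
  have vI : Num.min (u (- eta1)) (u eta1) <= u 0 + r <= Num.max (u (- eta1)) (u eta1).
    rewrite ge_min le_max; case: (ltgtP c 0) c0 => // cs _; move: h1 h1' h2 h2' r1 r2.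
      rewrite ltr0_norm // => ? ? ? ? ? ?.
      by apply/andP; split; apply/orP; [right|left]; nra.
    rewrite gtr0_norm // => ? ? ? ? ? ?.
    by apply/andP; split; apply/orP; [left|right]; nra.
  have [x] := @IVT _ u _ _ (u 0 + r) e1 cu vI.
  by rewrite in_itv /= -ler_norml => ? ?; exists x.
pose s3 := Num.min s (`|c| / 2 * eta1).
have s30 : 0 < s3 by rewrite lt_min s0 mulr_gt0.
apply: (@rgerm_of _ _ (fun z => fh (v z)) s3 M2) => // [|r].
  apply: (@wnorm_le_comp _ _ eta) => //.
    exact: wnorm_leW (ltW eta0) etas2 (lexx _) fM.
  by apply: wnorm_leW (ltW s30) _ (lexx _) vM; rewrite ge_min lexx.
rewrite le_min => /andP[rs /inv[x xe ux]].
have xs1 : `|x| <= s1 by apply: le_trans xe _; rewrite ge_min lexx orbT.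
have xeta : `|x| <= eta by apply: le_trans xe _; rewrite ge_min lexx.
have -> : v r%:C%C = x%:C%C.
  apply: pinj; rewrite ?absc_real //.
    by apply: wnorm_le_bound vM _; rewrite absc_real.
  rewrite pv ?absc_real // /p (uE x) // u0E -rmorphB ux; congr (_%:C)%C; ring.
rewrite fE; last exact: le_trans etas2.
have [_ _ <-] := hd x (le_lt_trans xe eta1d); by rewrite ux.
Unshelve. all: by end_near. Qed.

(** The one-variable identity theorem is applied twice: first in [z] for real [y], then in [t] for
    each fixed complex [z]. *)
Lemma unif_germ_eq0 (h : C -> C -> C) (d : R) :
  unif_germ h -> unif_germ (fun t z => h z t) -> 0 < d ->
  (forall x y : R, `|x| < d -> `|y| < d -> h x%:C%C y%:C%C = 0) ->
  exists2 s, 0 < s & forall z t, absc z <= s -> absc t <= s -> h z t = 0.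
Proof.
move=> /unif_germ_bound[s1 [M1 [s10 h1]]] /unif_germ_bound[s2 [M2 [s20 h2]]] d0 h0.
pose d1 := Num.min d (Num.min s1 s2).
have d10 : 0 < d1 by rewrite !lt_min d0 s10.
have step (y : R) z : `|y| < d1 -> absc z <= s1 -> h z y%:C%C = 0.
  rewrite !lt_min => /and3P[yd ys1 ys2] zs.
  have yC : absc y%:C%C <= s1 by rewrite absc_real ltW.
  apply: (wnorm_le_eq0 s10 (h1 _ yC) d0 _ zs) => x x0 xd.
  by apply: h0 => //; rewrite gtr0_norm.
exists (Num.min s1 s2) => [|z t]; first by rewrite lt_min s10.
rewrite !le_min => /andP[zs1 zs2] /andP[ts1 ts2].
apply: (wnorm_le_eq0 s20 (h2 _ zs2) d10 _ ts2) => x x0 xd.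
by apply: step => //; rewrite gtr0_norm.
Qed.
End Inverse.

(** * Common zeros of coprime polynomials *)

Section PolynomialIdeal.
Variable K : fieldType.
Implicit Types (P Q D A B M : {poly {poly K}}) (c p q : {poly K}).

Lemma irreducible_factor c : (1 < size c)%N -> exists2 p, irreducible_poly p & p %| c.
Proof.
have [n] := ubnP (size c); elim: n => // n IH in c *; rewrite ltnS => cn c1.
have [irr|] := pselect (irreducible_poly c); first by exists c => //; exact: dvdpp.
move=> /not_andP[//|] /existsNP[q] /not_implyP[q1] /not_implyP[qc] /negP nqc.
have c0 : c != 0 by rewrite -size_poly_gt0; exact: ltnW.
have sqc : (size q < size c)%N by rewrite ltn_neqAle dvdp_size_eqp // nqc dvdp_leq.
have q0 : q != 0 by apply: contraNneq c0 => q0; rewrite -dvd0p -q0.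
have [|p irr pq] := IH q (leq_trans sqc cn).
  by rewrite ltn_neqAle eq_sym q1 size_poly_gt0.
by exists p => //; exact: dvdp_trans qc.
Qed.

Lemma irreducible_dvdpM p (a b : {poly K}) : irreducible_poly p -> p %| a * b ->
  p %| a \/ p %| b.
Proof.
move=> irr pab; have [pa|pa] := boolP (p %| a); [by left|right].
rewrite -(@Gauss_dvdpr _ b a p) //; rewrite coprimep_def; apply: contraT => g1.
have := irr.2 _ g1 (dvdp_gcdl p a) => /eqp_dvdl e.
by rewrite -e dvdp_gcdr in pa.
Qed.

(* Gauss's lemma. *)
Lemma irreducible_dvd_polyC p D A P : irreducible_poly p -> D * A = p%:P * P ->
  (exists D', D = p%:P * D') \/ (exists A', A = p%:P * A').
Proof.
move=> irr; have [n] := ubnP (size D + size A)%N.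
elim: n => // n IH in D A P *; rewrite ltnS => DAn e.
have [->|D0] := eqVneq D 0; first by left; exists 0; rewrite mulr0.
have [->|A0] := eqVneq A 0; first by right; exists 0; rewrite mulr0.
(* A leading term divisible by [p] can be removed from a factor without affecting the claim, which
   drives the induction on the sizes. *)
have trunc (B : {poly {poly K}}) q : B != 0 -> lead_coef B = p * q ->
    (size (B - p%:P * (q%:P * 'X^((size B).-1)))%R < size B)%N.
  move=> B0 eB; set B' := B - _.
  have : (size B' <= size B)%N.
    rewrite (leq_trans (size_polyD _ _)) // geq_max leqnn size_polyN mulrA -polyCM -eB.
    by rewrite size_Cmul ?lead_coef_eq0 // size_polyXn prednK ?size_poly_gt0 ?leqnn.
  rewrite leq_eqVlt => /orP[/eqP sB|//].
  have : B'`_(size B).-1 = 0.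
    rewrite /B' coefB mulrA -polyCM -eB coefCM coefXn eqxx mulr1.
    by rewrite -lead_coefE subrr.
  have B'0 : B' != 0 by rewrite -size_poly_gt0 sB size_poly_gt0.
  by rewrite -sB -lead_coefE => /eqP; rewrite lead_coef_eq0 (negPf B'0).
have : p %| lead_coef D * lead_coef A.
  by rewrite -lead_coefM e lead_coefM lead_coefC dvdp_mulIl.
move=> /(irreducible_dvdpM irr)[|] /dvdpP[q]; rewrite mulrC => eq.
- have [||[D' eD']|hA] := IH (D - p%:P * (q%:P * 'X^((size D).-1))) A (P - q%:P * 'X^((size D).-1) * A).
  + by apply: leq_trans DAn; rewrite -addSn leq_add2r; exact: trunc.
  + by rewrite mulrBl mulrBr e !mulrA.
  + left; exists (D' + q%:P * 'X^((size D).-1)).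
    by rewrite mulrDr -eD' subrK.
  + by right.
- have [||hD|[A' eA']] := IH D (A - p%:P * (q%:P * 'X^((size A).-1))) (P - q%:P * 'X^((size A).-1) * D).
  + by apply: leq_trans DAn; rewrite -addnS leq_add2l; exact: trunc.
  + by rewrite !mulrBr e; congr (_ - _); rewrite mulrC !mulrA.
  + by left.
  + right; exists (A' + q%:P * 'X^((size A).-1)).
    by rewrite mulrDr -eA' subrK.
Qed.

(** The factor [c] is cleared one irreducible factor at a time. By Gauss's lemma such a factor
    divides [D], or else both cofactors; in either case [D] keeps its degree in the outer
    variable. *)
Lemma gauss_common_divisor c P Q D A B : c != 0 -> (1 < size D)%N ->
  c%:P * P = D * A -> c%:P * Q = D * B ->
  exists D' A' B', [/\ (1 < size D')%N, P = D' * A' & Q = D' * B'].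
Proof.
have [n] := ubnP (size c); elim: n => // n IH in c D A B *; rewrite ltnS => cn c0 D1 eP eQ.
have [c1|c1] := leqP (size c) 1.
  have /size_poly1P[k k0 ek] : size c == 1 by rewrite eqn_leq c1 size_poly_gt0.
  have kk : (k^-1)%:P%:P * c%:P = 1 :> {poly {poly K}}.
    by rewrite ek -!polyCM mulVf.
  exists D, ((k^-1)%:P%:P * A), ((k^-1)%:P%:P * B); split=> //.
    by rewrite mulrCA -eP mulrA kk mul1r.
  by rewrite mulrCA -eQ mulrA kk mul1r.
have [p irr /dvdpP[c'] ec] := irreducible_factor c1.
have p0 := irredp_neq0 irr.
have c'0 : c' != 0 by apply: contraNneq c0 => c'0; rewrite ec c'0 mul0r.
have c'n : (size c' < n)%N.
  apply: leq_trans cn; rewrite ec size_mul //.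
  by move: (irr.1); move: (size p) (size c') => a b; lia.
have pI : injective ( *%R p%:P : {poly {poly K}} -> _) by apply: mulfI; rewrite polyC_eq0.
have ecP (X : {poly {poly K}}) : c%:P * X = p%:P * (c'%:P * X).
  by rewrite mulrA ec polyCM [c'%:P * _]mulrC.
have [[D' eD]|[A' eA]] := irreducible_dvd_polyC irr (etrans (esym eP) (ecP P)).
  apply: (IH c' D' A B) => //.
  - by rewrite eD size_Cmul // in D1.
  - by apply: pI; rewrite -ecP eP eD mulrA.
  - by apply: pI; rewrite -ecP eQ eD mulrA.
have [[D' eD]|[B' eB]] := irreducible_dvd_polyC irr (etrans (esym eQ) (ecP Q)).
  apply: (IH c' D' A B) => //.
  - by rewrite eD size_Cmul // in D1.
  - by apply: pI; rewrite -ecP eP eD mulrA.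
  - by apply: pI; rewrite -ecP eQ eD mulrA.
apply: (IH c' D A' B') => //.
- by apply: pI; rewrite -ecP eP eA mulrCA.
- by apply: pI; rewrite -ecP eQ eB mulrCA.
Qed.

Lemma unit_size_poly D : D \is a GRing.unit -> size D = 1%N.
Proof. by rewrite poly_unitE => /andP[/eqP]. Qed.

(** [c] is the resultant in the outer variable. If it vanished, the pseudo-gcd would have positive
    degree and, denominators cleared, give a common divisor in [K[x, y]] that is no unit. Entries of
    degree 0 are treated apart. *)
Lemma coprimeXY_bezout P Q : coprimeXY P Q ->
  exists a b c, c != 0 /\ a * P + b * Q = c%:P.
Proof.
move=> cPQ.
have [P1|P1] := leqP (size P) 1.
  have [P0|P0] := eqVneq P 0.
    have Q1 : size Q = 1%N.
      apply/unit_size_poly/(cPQ Q 0 1); first by rewrite mulr0.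
      by rewrite mulr1.
    have /size_poly1P[c c0 eQ] : size Q == 1 by rewrite Q1.
    by exists 0, 1, c; split=> //; rewrite mul0r add0r mul1r.
  have /size_poly1P[c c0 eP] : size P == 1 by rewrite eqn_leq P1 size_poly_gt0.
  by exists 1, 0, c; split=> //; rewrite mul0r addr0 mul1r.
have [Q1|Q1] := leqP (size Q) 1.
  have [Q0|Q0] := eqVneq Q 0.
    have PS : size P = 1%N.
      apply/unit_size_poly/(cPQ P 1 0); last by rewrite mulr0.
      by rewrite mulr1.
    by rewrite PS in P1.
  have /size_poly1P[c c0 eQ] : size Q == 1 by rewrite eqn_leq Q1 size_poly_gt0.
  by exists 0, 1, c; split=> //; rewrite mul0r add0r mul1r.
have [[a b] /= [_ _] e] := resultant_in_ideal P1 Q1.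
exists a, b, (resultant P Q); split; last exact/esym.
apply/negP; rewrite resultant_eq0 => g1.
have /Pdiv.Idomain.dvdpP[[c A] /= c0 eA] := dvdp_gcdl P Q.
have /Pdiv.Idomain.dvdpP[[c' B] /= c'0 eB] := dvdp_gcdr P Q.
have [||||D [A' [B' [D1 eP eQ]]]] := @gauss_common_divisor (c' * c) P Q (gcdp P Q) (c'%:P * A) (c%:P * B).
- by rewrite mulf_neq0.
- by [].
- by rewrite polyCM -mulrA [c%:P * P]mul_polyC eA [RHS]mulrC mulrA.
- by rewrite [c' * c]mulrC polyCM -mulrA [c'%:P * Q]mul_polyC eB [RHS]mulrC mulrA.
by have := unit_size_poly (cPQ _ _ _ eP eQ) => D1'; rewrite D1' in D1.
Qed.

Lemma coprimeXY_swap P Q : coprimeXY P Q -> coprimeXY (swapXY P) (swapXY Q).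
Proof.
move=> cPQ D A B eP eQ.
have eP' : P = swapXY D * swapXY A by rewrite -rmorphM -eP /= swapXYK.
have eQ' : Q = swapXY D * swapXY B by rewrite -rmorphM -eQ /= swapXYK.
have /unitrP[E [_ DE]] := cPQ _ _ _ eP' eQ'.
have DE1 : D * swapXY E = 1 by rewrite -[D]swapXYK -rmorphM DE rmorph1.
by apply/unitrP; exists (swapXY E); rewrite [X in X = _]mulrC.
Qed.

(** For [(0, 0)], excluded from [coprime_partP], the pair [(1, 1)] with [G = 0] qualifies. *)
Lemma is_coprime_part_coprime_part P Q : is_coprime_part P Q (coprime_part P Q).
Proof.
have [|] := boolP ((P != 0) || (Q != 0)); first exact: coprime_partP.
rewrite negb_or !negbK => /andP[/eqP -> /eqP ->].
apply: (xgetPex _ (ex_intro _ (1, 1) _)); split; last by exists 0; rewrite !mul0r.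
by move=> D A B /= h _; apply/unitrP; exists A; split; [rewrite mulrC|]; exact/esym.
Qed.
End PolynomialIdeal.

(** * Indeterminacy points are singular points of the foliation *)

Section Derivations.
Variable K : numFieldType.
Implicit Types P Q A B M : {poly {poly K}}.

Lemma map_derivE P : map_poly deriv P = swapXY (swapXY P)^`().
Proof.
apply/polyP => i; apply/polyP => j.
by rewrite coef_swapXY coef_deriv coefMn coef_swapXY coef_map_id0 ?deriv0 // coef_deriv.
Qed.

Lemma map_derivM P Q :
  map_poly deriv (P * Q) = map_poly deriv P * Q + P * map_poly deriv Q.
Proof. by rewrite !map_derivE rmorphM derivM rmorphD !rmorphM /= !swapXYK. Qed.

Lemma map_derivD P Q : map_poly deriv (P + Q) = map_poly deriv P + map_poly deriv Q.
Proof. by apply/polyP => i; rewrite coefD !coef_map_id0 ?deriv0 // coefD derivD. Qed.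

Lemma map_derivB P Q : map_poly deriv (P - Q) = map_poly deriv P - map_poly deriv Q.
Proof. by apply/polyP => i; rewrite coefB !coef_map_id0 ?deriv0 // coefB derivB. Qed.

(* The field [v = B d/dx - A d/dy] kills P / Q, so that after multiplication by
   a suitable element of [K[x]] it preserves the ideal (P, Q), which contains some
   [(x - x0)^m g] with [g(x0, y0) <> 0].  If [B(x0, y0) <> 0], each application of v
   lowers m by one, until the ideal contains a function not vanishing at (x0, y0). *)
Lemma first_integral_zero P Q A B a b d a' b' c x0 y0 :
  Q * (B * P^`() - A * map_poly deriv P) = P * (B * Q^`() - A * map_poly deriv Q) ->
  d != 0 -> a * P + b * Q = map_poly polyC d ->
  c != 0 -> a' * P + b' * Q = c%:P ->
  P.[x0, y0] = 0 -> Q.[x0, y0] = 0 -> B.[x0, y0] = 0.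
Proof.
move=> ePQ d0 ed c0 ec P0 Q0; apply/eqP; apply: contraT => B0.
pose v f := B * f^`() - A * map_poly deriv f.
have vM f g : v (f * g) = v f * g + f * v g.
  by rewrite /v derivM map_derivM; ring.
have vD f g : v (f + g) = v f + v g by rewrite /v derivD map_derivD; ring.
pose xi : {poly {poly K}} := 'X - x0%:P%:P.
have vxi : v xi = B.
  rewrite /v /xi derivB derivX derivC subr0 mulr1 (_ : map_poly _ _ = 0) ?mulr0 ?subr0 //.
  apply/polyP => i; rewrite coef_map_id0 ?deriv0 // coefB coefX coefC coef0.
  by case: (i == 1%N); case: (i == 0%N); rewrite derivB ?derivC ?deriv0 subrr.
have {}ePQ : Q * v P = P * v Q by exact: ePQ.
clearbody v.
have vxiX n : v (xi ^+ n.+1) = n.+1%:R * B * xi ^+ n.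
  elim: n => [|n IH]; first by rewrite expr1 expr0 mulr1 mul1r.
  by rewrite exprS vM IH vxi -[in RHS]natr1 exprS; ring.
have xiI : injective ( *%R xi) by apply: mulfI; rewrite polyXsubC_eq0.
pose I f := exists al be, f = al * P + be * Q.
have IP : I P by exists 1, 0; rewrite mul1r mul0r addr0.
have IQ : I Q by exists 0, 1; rewrite mul1r mul0r add0r.
have ID f g : I f -> I g -> I (f + g).
  by move=> [al [be ->]] [al' [be' ->]]; exists (al + al'), (be + be'); ring.
have IM f g : I g -> I (f * g).
  by move=> [al [be ->]]; exists (f * al), (f * be); ring.
have I0 f : I f -> f.[x0, y0] = 0.
  by move=> [al [be ->]]; rewrite !hornerE /= P0 Q0 !mulr0 addr0.
(* The full power of [x - x0] is split off [d]; the cofactor [E] does not vanish at the point, so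
   multiplying by it is harmless. *)
have [m [e' + ed']] := multiplicity_XsubC d x0; rewrite d0 /= => e'0.
pose E : {poly {poly K}} := map_poly polyC e'.
have E0 : E.[x0, y0] != 0 by rewrite /E horner_map /= hornerC; exact: e'0.
have eE : a * P + b * Q = xi ^+ m * E.
  by rewrite ed ed' rmorphM rmorphXn /= rmorphB /= map_polyX map_polyC mulrC.
pose M0 := a * v P + b * v Q.
(* [Q * v P = P * v Q] and [a * P + b * Q = xi ^+ m * E] give [xi ^+ m * E * v P = P * M0], and
   likewise for [Q]. The powers of [xi] are then cancelled one by one: [M0] must vanish on the line
   [x = x0], because [P] and [Q] do not both vanish there by [ec]. *)
have [M [MP MQ]] : exists M, E * v P = P * M /\ E * v Q = Q * M.
  have : xi ^+ m * E * v P = P * M0 /\ xi ^+ m * E * v Q = Q * M0.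
    rewrite -eE /M0; split.
      rewrite (_ : _ * v P = a * P * v P + b * (Q * v P)); last by ring.
      by rewrite ePQ; ring.
    rewrite (_ : Q * _ = a * (Q * v P) + b * Q * v Q); last by ring.
    by rewrite ePQ; ring.
  move: M0; elim: m {ed' eE} => [|m IH] M0 [hP hQ].
    by exists M0; rewrite -hP -hQ expr0 !mul1r.
  have : P * M0 = xi * (xi ^+ m * E * v P) by rewrite -hP exprS !mulrA.
  have : Q * M0 = xi * (xi ^+ m * E * v Q) by rewrite -hQ exprS !mulrA.
  move=> hQ' hP'; have rM : root M0 x0%:P.
    have := congr1 (fun p => p.[x0%:P]) hP'; have := congr1 (fun p => p.[x0%:P]) hQ'.
    have := congr1 (fun p => p.[x0%:P]) ec.
    rewrite !hornerE /= !subrr !mul0r => hc /eqP + /eqP; rewrite !mulf_eq0.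
    move=> /orP[/eqP hQ0|//] /orP[/eqP hP0|//].
    by rewrite hQ0 hP0 !mulr0 addr0 in hc; rewrite -hc eqxx in c0.
  have /factor_theorem[M eM] := rM.
  apply: (IH M); split; apply: xiI.
    by rewrite -hP' eM -/xi; ring.
  by rewrite -hQ' eM -/xi; ring.
have IvE f : I f -> I (E * v f).
  move=> [al [be ->]]; rewrite vD !vM.
  rewrite (_ : E * _ = (E * v al) * P + al * (E * v P) + ((E * v be) * Q + be * (E * v Q))); last by ring.
  rewrite MP MQ; apply: (ID); apply: (ID); apply: (IM) => //.
    by rewrite mulrC; exact: IM.
  by rewrite mulrC; exact: IM.
(* Applying [E * v] to [xi ^+ m.+1 * g] yields [xi ^+ m] times [m.+1 * E * B * g + xi * E * v g],
   nonzero at the point in characteristic 0. *)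
have : exists2 g, I (xi ^+ m * g) & g.[x0, y0] != 0.
  by exists E => //; rewrite -eE; apply: (ID); exact: IM.
elim: m {ed' eE} => [|m IH] [g Ig g0].
  by rewrite expr0 mul1r in Ig; rewrite (I0 _ Ig) eqxx in g0.
apply: IH; exists (m.+1%:R * (E * B * g) + xi * (E * v g)).
  have := IvE _ Ig; rewrite vM vxiX; congr I; rewrite exprS; ring.
rewrite /xi !hornerE /= subrr !mul0r addr0; apply: mulf_neq0 => //.
apply: mulf_neq0 => //; apply: mulf_neq0 => //.
rewrite (_ : m.+1%:R = m.+1%:R%:P%:P :> {poly {poly K}}); last by rewrite !polyC_natr.
by rewrite !hornerC pnatr_eq0.
Qed.

(** [B * (G * A) - A * (G * B) = 0] says that the field kills [P / Q], without dividing by [G]. The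
    claim for [A] is the one for [B] with the variables exchanged. *)
Lemma indeterminacy_foliation_zero P Q A B G a b d a' b' c x0 y0 :
  Q * P^`() - P * Q^`() = G * A ->
  Q * map_poly deriv P - P * map_poly deriv Q = G * B ->
  d != 0 -> a * P + b * Q = map_poly polyC d ->
  c != 0 -> a' * P + b' * Q = c%:P ->
  P.[x0, y0] = 0 -> Q.[x0, y0] = 0 -> A.[x0, y0] = 0 /\ B.[x0, y0] = 0.
Proof.
move=> eA eB d0 ed c0 ec P0 Q0.
have e : Q * (B * P^`() - A * map_poly deriv P) = P * (B * Q^`() - A * map_poly deriv Q).
  apply/eqP; rewrite -subr_eq0; apply/eqP.
  transitivity (B * (Q * P^`() - P * Q^`()) - A * (Q * map_poly deriv P - P * map_poly deriv Q)); first by ring.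
  by rewrite eA eB; ring.
split; last exact: (first_integral_zero e d0 ed c0 ec P0 Q0).
rewrite -[A](swapXYK A) horner2_swapXY.
apply: (@first_integral_zero (swapXY P) (swapXY Q) (swapXY B) (swapXY A)
  (swapXY a') (swapXY b') c (swapXY a) (swapXY b) d).
- have dE (f : {poly {poly K}}) : (swapXY f)^`() = swapXY (map_poly deriv f).
    by rewrite map_derivE swapXYK.
  have dE' (f : {poly {poly K}}) : map_poly deriv (swapXY f) = swapXY (f^`()) by rewrite map_derivE swapXYK.
  rewrite !dE !dE' -!rmorphM -!rmorphB -!rmorphM /=; congr swapXY.
  by rewrite -[LHS]opprK -mulrN opprB e -mulrN opprB.
- by [].
- by rewrite -!rmorphM -rmorphD /= ec swapXY_polyC.
- by [].
- by rewrite -!rmorphM -rmorphD /= ed swapXY_map_polyC.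
- by rewrite horner2_swapXY.
- by rewrite horner2_swapXY.
Qed.
End Derivations.

Section RealPoints.
Variable R : realType.
Notation C := (R[i] : numFieldType).
Notation toCP := (map_poly (map_poly (@toC R))).

Lemma horner2_toC (P : {poly {poly R}}) (x y : R) :
  (toCP P).[toC x, toC y] = toC P.[x, y].
Proof.
rewrite -(map_polyC (real_complex R)) /= horner_map /= horner_map /=. by [].
Qed.

(** The Bezout identities are obtained over the reals and mapped to the complex numbers, so
    coprimality need not be transferred. *)
Lemma indeterminacy_sing_foliation (f : {poly {poly R}} * {poly {poly R}}) (w : R * R) :
  coprimeXY f.1 f.2 -> indeterminacy f w -> sing_foliation (ratC f) (toC2 w).
Proof.
move=> cop [f1 f2].
have [a [b [d [d0 ed]]]] := coprimeXY_bezout (coprimeXY_swap cop).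
have [a' [b' [c [c0 ec]]]] := coprimeXY_bezout cop.
have {}ed : swapXY a * f.1 + swapXY b * f.2 = map_poly polyC d.
  by rewrite -swapXY_polyC -ed rmorphD !rmorphM /= !swapXYK.
have [_ [G [eA eB]]] := is_coprime_part_coprime_part (level_form (ratC f)).1 (level_form (ratC f)).2.
have inj : injective (toC (R := R)) by exact: complexI.
apply: (indeterminacy_foliation_zero (G := G) (a := toCP (swapXY a)) (b := toCP (swapXY b))
  (d := map_poly (@toC R) d) (a' := toCP a') (b' := toCP b') (c := map_poly (@toC R) c)
  (P := (ratC f).1) (Q := (ratC f).2)) => //.
- by rewrite map_poly_eq0.
- rewrite /ratC /= -!rmorphM -rmorphD /= ed.
  by rewrite -!map_poly_comp; apply: eq_map_poly => x /=; rewrite map_polyC.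
- by rewrite map_poly_eq0.
- by rewrite /ratC /= -!rmorphM -rmorphD /= ec map_polyC.
- by rewrite /ratC /= horner2_toC f1.
- by rewrite /ratC /= horner2_toC f2.
Qed.
End RealPoints.

(** * Rational functions on a square *)

Section RationalFunctions.
Variable R : realType.
Implicit Types (P D : {poly {poly R}}) (h g : R -> R -> R) (d x y : R).

Lemma horner2D P D x y : (P + D).[x, y] = P.[x, y] + D.[x, y].
Proof. by rewrite !hornerD. Qed.

Lemma horner2M P D x y : (P * D).[x, y] = P.[x, y] * D.[x, y].
Proof. by rewrite !hornerM. Qed.

Lemma horner2N P x y : (- P).[x, y] = - P.[x, y].
Proof. by rewrite !hornerN. Qed.

Lemma is_derive_horner_comp (c : {poly R}) (k : R -> R) (t k' : R) : is_derive t 1 k k' ->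
  is_derive t 1 (fun t => c.[k t]) (c^`().[k t] * k').
Proof.
move=> dk; elim/poly_ind: c => [|c a IH].
  rewrite (_ : (fun t => _) = fun=> 0); last by apply/funext => s; rewrite horner0.
  by rewrite deriv0 horner0 mul0r; exact: is_derive_cst.
rewrite (_ : (fun t => _) = fun t => c.[k t] * k t + a); last first.
  by apply/funext => s; rewrite hornerMXaddC.
apply: is_derive_eq (is_deriveD (is_deriveM IH dk) (is_derive_cst a t 1)) _.
by rewrite /GRing.scale /= derivD derivM derivX derivC !hornerE /=; ring.
Qed.

Lemma is_derive_horner2_comp (P : {poly {poly R}}) (g k : R -> R) (t g' k' : R) :
  is_derive t 1 g g' -> is_derive t 1 k k' ->
  is_derive t 1 (fun t => P.[g t, k t])
    (P^`().[g t, k t] * g' + (map_poly deriv P).[g t, k t] * k').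
Proof.
move=> dg dk; elim/poly_ind: P => [|P c IH].
  rewrite (_ : (fun t => _) = fun=> 0); last by apply/funext => s; rewrite horner0 horner0.
  rewrite deriv0 (_ : map_poly _ 0 = 0) ?horner0 ?horner0 ?mul0r ?addr0; first exact: is_derive_cst.
  by apply/polyP => i; rewrite coef_map_id0 ?deriv0 // !coef0 deriv0.
rewrite (_ : (fun t => _) = fun t => P.[g t, k t] * g t + c.[k t]); last first.
  by apply/funext => s; rewrite hornerMXaddC hornerD hornerM hornerC.
apply: is_derive_eq (is_deriveD (is_deriveM IH dg) (is_derive_horner_comp c dk)) _.
rewrite map_derivD map_derivM map_polyC /= derivD derivM derivX derivC.
rewrite (_ : map_poly _ 'X = 0); last first.
  by apply/polyP => i; rewrite coef_map_id0 ?deriv0 // coefX coef0 derivMn -polyC1 derivC mul0rn.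
by rewrite /GRing.scale /= !hornerE /=; ring.
Qed.

Lemma is_derive_horner2x P x y : is_derive x 1 (fun t => P.[t, y]) P^`().[x, y].
Proof.
have := is_derive_horner2_comp P (is_derive_id x 1) (is_derive_cst y x 1).
by rewrite mulr1 mulr0 addr0.
Qed.

Lemma is_derive_horner2y P x y :
  is_derive y 1 (fun t => P.[x, t]) (map_poly deriv P).[x, y].
Proof.
have := is_derive_horner2_comp P (is_derive_cst x y 1) (is_derive_id y 1).
by rewrite mulr1 mulr0 add0r.
Qed.

Lemma deriv_mapC P : (map_poly deriv P)^`() = map_poly deriv P^`().
Proof.
apply/polyP => i.
by rewrite coef_deriv !coef_map_id0 ?deriv0 // coef_deriv derivMn.
Qed.

Lemma continuous_horner2 P (z : R * R) : {for z, continuous (fun z : R * R => P.[z.1, z.2])}.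
Proof.
elim/poly_ind: P => [|P c IH].
  rewrite (_ : (fun z : R * R => _) = fun=> 0); first exact: cst_continuous.
  by apply/funext => t; rewrite !horner0.
rewrite (_ : (fun z : R * R => _) = (fun z : R * R => P.[z.1, z.2] * z.1 + c.[z.2])).
  apply: (@continuousD _ _ _ (fun z : R * R => P.[z.1, z.2] * z.1) (fun z => c.[z.2])).
    by apply: cvgM; [exact: IH|exact: cvg_fst].
  apply: (@continuous_comp _ _ _ snd (horner c)); first exact: cvg_snd.
  exact: continuous_horner.
by apply/funext => t; rewrite hornerMXaddC hornerD hornerM hornerC.
Qed.

(** Total functions that agree with a fraction on an open square: derivatives are taken of
    functions, and the fraction provides their existence. *)
Definition ratfun d h := exists P D, forall x y, `|x| < d -> `|y| < d ->
  D.[x, y] != 0 /\ h x y = P.[x, y] / D.[x, y].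

Definition eq_on d h g := forall x y, `|x| < d -> `|y| < d -> h x y = g x y.

Definition dx h x y := derive1 (h^~ y) x.
Definition dy h x y := derive1 (h x) y.

Lemma rat_ext d h g : eq_on d h g -> ratfun d h -> ratfun d g.
Proof.
move=> hg [P [D hPD]]; exists P, D => x y xd yd.
by rewrite -hg //; exact: hPD.
Qed.

Lemma ratW d d' h : d' <= d -> ratfun d h -> ratfun d' h.
Proof.
move=> dd [P [D hPD]]; exists P, D => x y xd yd.
by apply: hPD; exact: lt_le_trans dd.
Qed.

Lemma rat_poly d P : ratfun d (fun x y => P.[x, y]).
Proof. by exists P, 1 => x y _ _; rewrite !hornerC oner_neq0 divr1. Qed.

Lemma rat_cst d (c : R) : ratfun d (fun _ _ => c).
Proof. by apply: rat_ext (rat_poly d c%:P%:P) => x y _ _; rewrite !hornerC. Qed.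

Lemma rat_x d : ratfun d (fun x _ => x).
Proof. by apply: rat_ext (rat_poly d 'X) => x y _ _; rewrite hornerX hornerC. Qed.

Lemma rat_y d : ratfun d (fun _ y => y).
Proof. by apply: rat_ext (rat_poly d 'X%:P) => x y _ _; rewrite hornerC hornerX. Qed.

Lemma ratD d h g : ratfun d h -> ratfun d g -> ratfun d (fun x y => h x y + g x y).
Proof.
move=> [P [D hh]] [Q [E hg]]; exists (P * E + Q * D), (D * E) => x y xd yd.
have [D0 ->] := hh x y xd yd; have [E0 ->] := hg x y xd yd.
rewrite horner2D !horner2M mulf_neq0 //; split=> //.
by rewrite addf_div.
Qed.

Lemma ratM d h g : ratfun d h -> ratfun d g -> ratfun d (fun x y => h x y * g x y).
Proof.
move=> [P [D hh]] [Q [E hg]]; exists (P * Q), (D * E) => x y xd yd.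
have [D0 ->] := hh x y xd yd; have [E0 ->] := hg x y xd yd.
by rewrite !horner2M mulf_neq0 //; split=> //; rewrite mulf_div.
Qed.

Lemma ratV d h : (forall x y, `|x| < d -> `|y| < d -> h x y != 0) -> ratfun d h ->
  ratfun d (fun x y => (h x y)^-1).
Proof.
move=> h0 [P [D hh]]; exists D, P => x y xd yd.
have := h0 x y xd yd; have [D0 ->] := hh x y xd yd.
by rewrite mulf_eq0 negb_or => /andP[P0 _]; split=> //; rewrite invf_div.
Qed.

Lemma ratN d h : ratfun d h -> ratfun d (fun x y => - h x y).
Proof. by move=> /(ratM (rat_cst d (-1))); apply: rat_ext => x y _ _; rewrite mulN1r. Qed.

Lemma ratB d h g : ratfun d h -> ratfun d g -> ratfun d (fun x y => h x y - g x y).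
Proof. by move=> hh /ratN; exact: ratD. Qed.

Lemma rat_div d h g : (forall x y, `|x| < d -> `|y| < d -> g x y != 0) ->
  ratfun d h -> ratfun d g -> ratfun d (fun x y => h x y / g x y).
Proof. by move=> g0 hh hg; apply: ratM => //; exact: ratV. Qed.

Lemma ratX d h n : ratfun d h -> ratfun d (fun x y => h x y ^+ n).
Proof.
move=> hh; elim: n => [|n IH]; first exact: rat_cst.
by apply: rat_ext (ratM hh IH) => x y _ _; rewrite exprS.
Qed.

Lemma ratfun_horner2 d P (g k : R -> R -> R) :
  ratfun d g -> ratfun d k -> ratfun d (fun x y => P.[g x y, k x y]).
Proof.
move=> rg rk; elim/poly_ind: P => [|P c IH].
  by apply: rat_ext (rat_cst d 0) => x y _ _; rewrite horner0 horner0.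
have rc : ratfun d (fun x y => c.[k x y]).
  elim/poly_ind: c => [|c a IHc].
    by apply: rat_ext (rat_cst d 0) => x y _ _; rewrite horner0.
  apply: rat_ext (ratD (ratM IHc rk) (rat_cst d a)) => x y _ _.
  by rewrite hornerMXaddC.
apply: rat_ext (ratD (ratM IH rg) rc) => x y _ _.
by rewrite hornerMXaddC hornerD hornerM hornerC.
Qed.

Lemma near_lt_norm (x d : R) : `|x| < d -> \forall t \near x, `|t| < d.
Proof.
move=> xd; near=> t; have : `|x - t| < d - `|x|.
  by near: t; apply: cvgr_dist_lt => //; rewrite subr_gt0.
have := ler_normD x (t - x); rewrite addrC subrK [`|t - x|]distrC => ? ?; lra.
Unshelve. all: by end_near. Qed.

Lemma is_derive_val (f : R -> R) x (c : R) : is_derive x 1 f c -> derive1 f x = c.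
Proof. by move=> [_ <-]; rewrite derive1E. Qed.

Lemma rat_derx d h P D : (forall x y, `|x| < d -> `|y| < d ->
    D.[x, y] != 0 /\ h x y = P.[x, y] / D.[x, y]) -> forall x y, `|x| < d -> `|y| < d ->
  is_derive x 1 (h^~ y) ((P^`() * D - P * D^`()).[x, y] / (D * D).[x, y]).
Proof.
move=> hh x y xd yd; have [D0 _] := hh x y xd yd.
apply: (@near_eq_is_derive R R R (fun t => P.[t, y] * (D.[t, y])^-1) (h^~ y)).
  by near=> t; have [] := hh t y _ yd => //; near: t; exact: near_lt_norm.
have dP := is_derive_horner2x P x y.
have dD := @is_deriveV R (fun t => D.[t, y]) x _ _ D0 (is_derive_horner2x D x y).
apply: is_derive_eq (is_deriveM dP dD) _.
rewrite /GRing.scale /= horner2D horner2N !horner2M; field; exact: D0.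
Unshelve. all: by end_near. Qed.

Lemma rat_dery d h P D : (forall x y, `|x| < d -> `|y| < d ->
    D.[x, y] != 0 /\ h x y = P.[x, y] / D.[x, y]) -> forall x y, `|x| < d -> `|y| < d ->
  is_derive y 1 (h x) ((map_poly deriv P * D - P * map_poly deriv D).[x, y] / (D * D).[x, y]).
Proof.
move=> hh x y xd yd; have [D0 _] := hh x y xd yd.
apply: (@near_eq_is_derive R R R (fun t => P.[x, t] * (D.[x, t])^-1) (h x)).
  by near=> t; have [] := hh x t xd _ => //; near: t; exact: near_lt_norm.
have dP := is_derive_horner2y P x y.
have dD := @is_deriveV R (fun t => D.[x, t]) y _ _ D0 (is_derive_horner2y D x y).
apply: is_derive_eq (is_deriveM dP dD) _.
rewrite /GRing.scale /= horner2D horner2N !horner2M; field; exact: D0.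
Unshelve. all: by end_near. Qed.

Lemma rat_is_dx d h x y : ratfun d h -> `|x| < d -> `|y| < d ->
  is_derive x 1 (h^~ y) (dx h x y).
Proof.
by move=> [P [D hh]] xd yd; have H := rat_derx hh xd yd; rewrite /dx (is_derive_val H).
Qed.

Lemma rat_is_dy d h x y : ratfun d h -> `|x| < d -> `|y| < d ->
  is_derive y 1 (h x) (dy h x y).
Proof.
by move=> [P [D hh]] xd yd; have H := rat_dery hh xd yd; rewrite /dy (is_derive_val H).
Qed.

Lemma rat_dx d h : ratfun d h -> ratfun d (dx h).
Proof.
move=> [P [D hh]]; exists (P^`() * D - P * D^`()), (D * D) => x y xd yd.
rewrite /dx (is_derive_val (rat_derx hh xd yd)); split=> //.
by have [D0 _] := hh x y xd yd; rewrite horner2M mulf_neq0.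
Qed.

Lemma rat_dy d h : ratfun d h -> ratfun d (dy h).
Proof.
move=> [P [D hh]]; exists (map_poly deriv P * D - P * map_poly deriv D), (D * D) => x y xd yd.
rewrite /dy (is_derive_val (rat_dery hh xd yd)); split=> //.
by have [D0 _] := hh x y xd yd; rewrite horner2M mulf_neq0.
Qed.

Lemma dx_ext d h g : eq_on d h g -> eq_on d (dx h) (dx g).
Proof.
move=> hg x y xd yd; rewrite /dx !derive1E; apply: near_eq_derive.
by near=> t; apply: hg => //; near: t; exact: near_lt_norm.
Unshelve. all: by end_near. Qed.

Lemma dy_ext d h g : eq_on d h g -> eq_on d (dy h) (dy g).
Proof.
move=> hg x y xd yd; rewrite /dy !derive1E; apply: near_eq_derive.
by near=> t; apply: hg => //; near: t; exact: near_lt_norm.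
Unshelve. all: by end_near. Qed.

Lemma dxD d h g : ratfun d h -> ratfun d g ->
  eq_on d (dx (fun x y => h x y + g x y)) (fun x y => dx h x y + dx g x y).
Proof.
move=> hh hg x y xd yd; apply: is_derive_val.
exact: is_deriveD (rat_is_dx hh xd yd) (rat_is_dx hg xd yd).
Qed.

Lemma dyD d h g : ratfun d h -> ratfun d g ->
  eq_on d (dy (fun x y => h x y + g x y)) (fun x y => dy h x y + dy g x y).
Proof.
move=> hh hg x y xd yd; apply: is_derive_val.
exact: is_deriveD (rat_is_dy hh xd yd) (rat_is_dy hg xd yd).
Qed.

Lemma dxM d h g : ratfun d h -> ratfun d g ->
  eq_on d (dx (fun x y => h x y * g x y)) (fun x y => dx h x y * g x y + h x y * dx g x y).
Proof.
move=> hh hg x y xd yd; apply: is_derive_val.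
apply: is_derive_eq (is_deriveM (rat_is_dx hh xd yd) (rat_is_dx hg xd yd)) _.
by rewrite /GRing.scale /= addrC mulrC.
Qed.

Lemma dyM d h g : ratfun d h -> ratfun d g ->
  eq_on d (dy (fun x y => h x y * g x y)) (fun x y => dy h x y * g x y + h x y * dy g x y).
Proof.
move=> hh hg x y xd yd; apply: is_derive_val.
apply: is_derive_eq (is_deriveM (rat_is_dy hh xd yd) (rat_is_dy hg xd yd)) _.
by rewrite /GRing.scale /= addrC mulrC.
Qed.

(** Both sides are explicit fractions over the same denominator, so the symmetry is a polynomial
    identity. *)
Lemma dxdyC d h : ratfun d h -> eq_on d (dx (dy h)) (dy (dx h)).
Proof.
move=> [P [D hh]] x y xd yd.
have h1 x0 y0 : `|x0| < d -> `|y0| < d ->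
    (D * D).[x0, y0] != 0 /\ dy h x0 y0 =
    (map_poly deriv P * D - P * map_poly deriv D).[x0, y0] / (D * D).[x0, y0].
  move=> xd0 yd0; rewrite /dy (is_derive_val (rat_dery hh xd0 yd0)); split=> //.
  by have [D0 _] := hh x0 y0 xd0 yd0; rewrite horner2M mulf_neq0.
have h2 x0 y0 : `|x0| < d -> `|y0| < d ->
    (D * D).[x0, y0] != 0 /\ dx h x0 y0 =
    (P^`() * D - P * D^`()).[x0, y0] / (D * D).[x0, y0].
  move=> xd0 yd0; rewrite /dx (is_derive_val (rat_derx hh xd0 yd0)); split=> //.
  by have [D0 _] := hh x0 y0 xd0 yd0; rewrite horner2M mulf_neq0.
rewrite [LHS](is_derive_val (rat_derx h1 xd yd)).
rewrite [RHS](is_derive_val (rat_dery h2 xd yd)); congr (_ / _).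
rewrite !derivB !map_derivB !derivM !map_derivM !deriv_mapC; congr (_.[_, _]); ring.
Qed.

Definition jcont h x y := {for (x, y), continuous (fun z : R * R => h z.1 z.2)}.

Lemma rat_jcont d h x y : ratfun d h -> `|x| < d -> `|y| < d -> jcont h x y.
Proof.
move=> [P [D hh]] xd yd; have [D0 hxy] := hh x y xd yd.
rewrite /jcont /prop_for /continuous_at /= hxy.
have : (fun z : R * R => P.[z.1, z.2] / D.[z.1, z.2]) @ (x, y) --> P.[x, y] / D.[x, y].
  apply: cvgM; first exact: (@continuous_horner2 P (x, y)).
  by apply: cvgV => //; exact: (@continuous_horner2 D (x, y)).
apply: cvg_trans; apply: near_eq_cvg.
have xn : \forall z \near (x, y), `|(z : R * R).1| < d.
  have c1 : (@fst R R) @ (x, y) --> x by exact: cvg_fst.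
  exact: (c1 _ (near_lt_norm xd)).
have yn : \forall z \near (x, y), `|(z : R * R).2| < d.
  have c2 : (@snd R R) @ (x, y) --> y by exact: cvg_snd.
  exact: (c2 _ (near_lt_norm yd)).
near=> z; have [] := hh z.1 z.2 _ _ => //; by near: z.
Unshelve. all: by end_near. Qed.

Lemma jcontx h x y : jcont h x y -> {for x, continuous (h^~ y)}.
Proof.
move=> hc; have c : (fun t : R => (t, y)) @ x --> (x, y).
  apply: (@cvg_pair _ _ _ (nbhs x) (nbhs x) (nbhs y) _ _ _ id (fun=> y)); [exact: cvg_id|exact: cvg_cst].
exact: (cvg_comp _ _ c hc).
Qed.

Lemma rgerm_horner (p : {poly R}) : rgerm (horner p).
Proof.
apply: rgerm_near (rgerm_sum (index_enum _) xpredT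
  (fun i : 'I_(size p) => rgermM (rgerm_cst p`_i) (rgermX i (rgerm_id R)))).
by apply: nearW0 => x; rewrite horner_coef.
Qed.

Lemma rat_rgerm d h : 0 < d -> ratfun d h -> rgerm (h^~ 0).
Proof.
move=> d0 [P [D hh]]; have n0 : `|0 : R| < d by rewrite normr0.
have E (Q : {poly {poly R}}) t : (map_poly (horner_eval 0) Q).[t] = Q.[t, 0].
  by rewrite -[t in LHS](hornerC t 0) -[t%:P.[0] in LHS]/(horner_eval 0 t%:P) horner_map.
have [D0 _] := hh 0 0 n0 n0.
apply: rgerm_near (rgermM (rgerm_horner (map_poly (horner_eval 0) P))
  (rgermV (_ : (map_poly (horner_eval 0) D).[0] != 0) (rgerm_horner _))); last by rewrite E.
by near=> x; rewrite !E; have [] := hh x 0 _ n0 => //; near: x; exact: near_lt_norm.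
Unshelve. all: by end_near. Qed.
End RationalFunctions.

(** * Continuous solutions are analytic *)

Section SegmentIntegral.
Variable R : realType.
Notation mu := (@lebesgue_measure R).
Implicit Types (f g F : R -> R) (h : R -> R -> R) (a b x y d : R).

Definition cont_on a b f := forall x, a <= x <= b -> {for x, continuous f}.

Definition segint a b f := \int[mu]_(x in `[a, b]) f x.

Lemma cont_on_within a b f : cont_on a b f -> {within `[a, b], continuous f}.
Proof.
move=> fc; apply: continuous_in_subspaceT => x; rewrite inE /= in_itv /=.
exact: fc.
Qed.

Lemma cont_on_integrable a b f : cont_on a b f -> mu.-integrable `[a, b] (EFin \o f).
Proof.
move=> fc; apply: continuous_compact_integrable; first exact: segment_compact.
exact: cont_on_within.
Qed.

Lemma cont_onD a b f g : cont_on a b f -> cont_on a b g -> cont_on a b (fun x => f x + g x).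
Proof. by move=> fc gc x xab; apply: continuousD; [exact: fc|exact: gc]. Qed.

Lemma cont_onZ a b (c : R) f : cont_on a b f -> cont_on a b (fun x => c * f x).
Proof. by move=> fc x xab; apply: continuousM; [exact: cst_continuous|exact: fc]. Qed.

Lemma cont_on_sum a b (I : Type) (s : seq I) (f : I -> R -> R) :
  (forall i, cont_on a b (f i)) -> cont_on a b (fun x => \sum_(i <- s) f i x).
Proof.
move=> fc; elim: s => [|i s IH].
  rewrite (_ : (fun x => _) = fun=> 0); first by move=> x _; exact: cst_continuous.
  by apply/funext => x; rewrite big_nil.
rewrite (_ : (fun x => _) = fun x => f i x + \sum_(i <- s) f i x); first exact: cont_onD.
by apply/funext => x; rewrite big_cons.
Qed.

Lemma eq_segint a b f g : (forall x, a <= x <= b -> f x = g x) -> segint a b f = segint a b g.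
Proof. by move=> fg; apply: eq_Rintegral => x; rewrite inE /= in_itv /=; exact: fg. Qed.

Lemma segintD a b f g : cont_on a b f -> cont_on a b g ->
  segint a b (fun x => f x + g x) = segint a b f + segint a b g.
Proof. by move=> fc gc; apply: RintegralD => //; exact: cont_on_integrable. Qed.

Lemma segintZ a b (c : R) f : cont_on a b f ->
  segint a b (fun x => c * f x) = c * segint a b f.
Proof. by move=> fc; apply: RintegralZl => //; exact: cont_on_integrable. Qed.

Lemma segint0 a b : segint a b (fun=> 0) = 0.
Proof. by rewrite /segint Rintegral_cst // mul0r. Qed.

Lemma segint_sum a b (I : Type) (s : seq I) (f : I -> R -> R) :
  (forall i, cont_on a b (f i)) ->
  segint a b (fun x => \sum_(i <- s) f i x) = \sum_(i <- s) segint a b (f i).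
Proof.
move=> fc; elim: s => [|i s IH].
  by rewrite big_nil -[RHS](segint0 a b); apply: eq_segint => x _; rewrite big_nil.
rewrite big_cons -IH -segintD //; last exact: cont_on_sum.
by apply: eq_segint => x _; rewrite big_cons.
Qed.

Lemma segint_derive a b f F : a < b -> cont_on a b f ->
  (forall x, a <= x <= b -> is_derive x 1 F (f x)) -> segint a b f = F b - F a.
Proof.
move=> ab fc dF; rewrite /segint /Rintegral (@continuous_FTC2 _ f F) //.
- exact: cont_on_within.
- have cF x : a <= x <= b -> {for x, continuous F}.
    by move=> /dF[dFx _]; apply/differentiable_continuous/derivable1_diffP.
  split.
  + by move=> x; rewrite in_itv /= => /andP[ax xb]; have [] := dF x (_ : a <= x <= b); rewrite // !ltW.
  + by apply: cvg_at_right_filter; apply: cF; rewrite lexx ltW.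
  + by apply: cvg_at_left_filter; apply: cF; rewrite lexx ltW.
- move=> x; rewrite in_itv /= => /andP[ax xb]; apply: is_derive_val.
  by apply: dF; rewrite !ltW.
Qed.

Lemma is_derive_segint a c f b : cont_on a c f -> a < b < c ->
  is_derive b 1 (fun t => segint a t f) (f b).
Proof.
move=> fc /andP[ab bc].
have fb : {for b, continuous f} by apply: fc; rewrite !ltW.
have [dF E] := @continuous_FTC1_closed R f a b c bc (cont_on_integrable fc) ab fb.
by apply: (DeriveDef dF); rewrite -derive1E; exact: E.
Qed.

Lemma jcontM h k x y : jcont h x y -> jcont k x y -> jcont (fun x y => h x y * k x y) x y.
Proof. by move=> hc kc; apply: continuousM. Qed.

Lemma jcontD h k x y : jcont h x y -> jcont k x y -> jcont (fun x y => h x y + k x y) x y.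
Proof. by move=> hc kc; apply: continuousD. Qed.

Lemma jcont_comp h f x y : jcont h x y -> {for h x y, continuous f} ->
  jcont (fun x y => f (h x y)) x y.
Proof. by move=> hc fc; exact: (cvg_comp _ _ hc fc). Qed.

Lemma jcont_bounded h a b c d :
  (forall x y, a <= x <= b -> c <= y <= d -> jcont h x y) ->
  exists B, forall x y, a <= x <= b -> c <= y <= d -> `|h x y| <= B.
Proof.
move=> hc; pose A := (`[a, b]%classic `*` `[c, d]%classic) : set (R * R).
have cA : compact A by apply: compact_setX; exact: segment_compact.
have cI : compact [set (h z.1 z.2 : R) | z in A].
  apply: (@continuous_compact _ _ (fun z : R * R => h z.1 z.2)) => //.
  apply: continuous_in_subspaceT => -[x y]; rewrite inE => -[/= ].
  by rewrite !in_itv /=; exact: hc.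
have [M [_ hM]] := compact_bounded cI; exists (M + 1) => x y xab ycd.
apply: (hM (M + 1)); first by rewrite ltrDl.
by exists (x, y) => //; split; rewrite /= in_itv.
Qed.

(** The dominating function is the constant bound of [h'] on a compact rectangle. *)
Lemma is_derive_segint_param h h' a b u v y : u < y < v ->
  (forall x t, a <= x <= b -> u <= t <= v -> jcont h x t) ->
  (forall x t, a <= x <= b -> u <= t <= v -> jcont h' x t) ->
  (forall x t, a <= x <= b -> u < t < v -> is_derive t 1 (h x) (h' x t)) ->
  is_derive y 1 (fun t => segint a b (h^~ t)) (segint a b (h'^~ y)).
Proof.
move=> /andP[uy yv] hc h'c hd; have [B hB] := jcont_bounded h'c.
pose f t x := h x t.
have Iy : [set` `]u, v[] y by rewrite /= in_itv /= uy.
have intf t : [set` `]u, v[] t -> mu.-integrable `[a, b] (EFin \o f t).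
  rewrite /= in_itv /= => /andP[ut tv]; apply: cont_on_integrable => x xab.
  by apply: jcontx; apply: hc; rewrite ?(ltW ut) ?(ltW tv).
have derf t x : [set` `]u, v[] t -> [set` `[a, b]] x -> derivable (f ^~ x) t 1.
  by rewrite /= !in_itv /= => tI xI; have [] := hd x t xI tI.
have ub t x : [set` `]u, v[] t -> [set` `[a, b]] x -> `|partial1of2 f t x| <= `|B|.
  rewrite /= !in_itv /= => tI xI; rewrite /partial1of2 (is_derive_val (hd x t xI tI)).
  apply: le_trans (ler_norm B); apply: hB => //.
  by case/andP: tI => ? ?; rewrite !ltW.
have intB : mu.-integrable `[a, b] (EFin \o (fun=> `|B|)).
  by apply: cont_on_integrable => x _; exact: cst_continuous.
have mI : measurable [set` `[a, b]] by [].
have B0 (x : R) : 0 <= `|B| by [].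
apply: DeriveDef.
  exact: (@derivable_under_integral R _ _ mu f _ mI y u v Iy intf derf (fun=> `|B|) B0 intB ub).
rewrite -derive1E.
have -> := @differentiation_under_integral R _ _ mu f _ mI y u v Iy intf derf (fun=> `|B|) B0 intB ub.
apply: eq_segint => x xab; rewrite /partial1of2; apply: is_derive_val.
by apply: hd => //; rewrite uy.
Qed.
End SegmentIntegral.

(** * The y-derivative transposed to the test function *)

Section WeakEquation.
Variable R : realType.
Implicit Types (F : R -> R) (h psi chi u m : R -> R -> R) (a b x y d : R).

Definition slope u x y := dy u x y / dx u x y.

(* The transpose of d/dy acting on functions F(u(x, y)), for which
   d/dy = slope u * d/dx. *)
Definition transport m psi x y := dy psi x y - dx (fun x y => m x y * psi x y) x y.

Lemma rat_transport d m psi : ratfun d m -> ratfun d psi -> ratfun d (transport m psi).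
Proof. by move=> hm hp; apply: ratB; [exact: rat_dy|apply/rat_dx/ratM]. Qed.

Lemma transport_ext d m psi chi : eq_on d psi chi -> eq_on d (transport m psi) (transport m chi).
Proof.
move=> pc x y xd yd; rewrite /transport (dy_ext pc) //; congr (_ - _).
by apply: (@dx_ext _ d) => // s t sd td; rewrite pc.
Qed.

Lemma primitive_ex F p q : p < q -> (forall t, p <= t <= q -> {for t, continuous F}) ->
  exists G, forall t, p < t < q -> is_derive t 1 G (F t).
Proof. by move=> pq Fc; exists (segint p ^~ F) => t tI; exact: is_derive_segint Fc tI. Qed.

Lemma is_derive_eq0 (f : R -> R) y c d : `|y| < d -> (forall t, `|t| < d -> f t = 0) ->
  is_derive y 1 f c -> c = 0.
Proof.
move=> yd f0 fc; have h0 : is_derive y 1 f 0.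
  apply: (@near_eq_is_derive R R R (cst (0 : R))).
  by near=> t; rewrite f0 //; near: t; exact: near_lt_norm.
by rewrite -(is_derive_val fc) (is_derive_val h0).
Unshelve. all: by end_near. Qed.

Section Wave.
Variables (d : R) (u : R -> R -> R) (F : R -> R) (p q : R).
Hypothesis ru : ratfun d u.
Hypothesis ux0 : forall x y, `|x| < d -> `|y| < d -> dx u x y != 0.
Hypothesis upq : forall x y, `|x| < d -> `|y| < d -> p < u x y < q.
Hypothesis Fc : forall t, p <= t <= q -> {for t, continuous F}.

Lemma jcont_wave x y : `|x| < d -> `|y| < d -> jcont (fun x y => F (u x y)) x y.
Proof.
move=> xd yd; apply: jcont_comp; first exact: rat_jcont ru xd yd.
by apply: Fc; have /andP[h1 h2] := upq xd yd; rewrite !ltW.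
Qed.

Lemma rat_slope : ratfun d (slope u).
Proof. by apply: rat_div => //; [exact: rat_dy|exact: rat_dx]. Qed.

Lemma in_segment x a b : `|a| < d -> `|b| < d -> a <= x <= b -> `|x| < d.
Proof.
by rewrite !ltr_norml => /andP[? ?] /andP[? ?] /andP[? ?]; apply/andP; split; lra.
Qed.

Lemma wave_cont_on a b y psi : `|a| < d -> `|b| < d -> `|y| < d -> ratfun d psi ->
  cont_on a b (fun x => F (u x y) * psi x y).
Proof.
move=> ad bd yd rp x xab; have xd := in_segment ad bd xab.
by apply: (jcontx (jcontM (jcont_wave xd yd) (rat_jcont rp xd yd))).
Qed.

(* Writing F = G', both sides differ by boundary terms, which vanish with psi. *)
Lemma is_derive_wave a b psi y : a < b -> `|a| < d -> `|b| < d -> ratfun d psi ->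
  (forall t, `|t| < d -> psi a t = 0) -> (forall t, `|t| < d -> psi b t = 0) ->
  `|y| < d ->
  is_derive y 1 (fun t => segint a b (fun x => F (u x t) * psi x t))
    (segint a b (fun x => F (u x y) * transport (slope u) psi x y)).
Proof.
move=> ab ad bd rp pa pb yd.
have pq : p < q by have /andP[h1 h2] := upq ad bd; exact: lt_trans h2.
have [G dG] := primitive_ex pq Fc.
(* With [H = G(u)], [F(u) * psi] is [H_x * chi]. An integration by parts leaves [- H * chi_x], which
   is differentiable in [y] although [F(u)] need not be. *)
pose chi x y := psi x y / dx u x y; pose H x y := G (u x y).
have rux := rat_dx ru; have ruy := rat_dy ru.
have rchi : ratfun d chi by exact: rat_div.
have dHx (x t : R) : `|x| < d -> `|t| < d -> is_derive x 1 (H^~ t) (F (u x t) * dx u x t).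
  move=> xd td; have := is_derive1_comp (dG _ (upq xd td)) (rat_is_dx ru xd td).
  exact.
have dHy x (t : R) : `|x| < d -> `|t| < d -> is_derive t 1 (H x) (F (u x t) * dy u x t).
  move=> xd td; have := is_derive1_comp (dG _ (upq xd td)) (rat_is_dy ru xd td).
  exact.
have jH x t : `|x| < d -> `|t| < d -> jcont H x t.
  move=> xd td; apply: jcont_comp; first exact: rat_jcont ru xd td.
  have [dGx _] := dG _ (upq xd td).
  by apply/differentiable_continuous/derivable1_diffP.
have jR h x t : ratfun d h -> `|x| < d -> `|t| < d -> jcont h x t.
  by move=> rh xd td; exact: rat_jcont rh xd td.
have seg x : a <= x <= b -> `|x| < d by exact: in_segment.
have psiE x t : `|x| < d -> `|t| < d -> psi x t = dx u x t * chi x t.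
  by move=> xd td; rewrite /chi mulrC divfK // ux0.
(* The mixed second derivatives of [u] cancel. *)
have TE x : `|x| < d -> transport (slope u) psi x y = dx u x y * dy chi x y - dy u x y * dx chi x y.
  move=> xd; rewrite /transport.
  have -> : dy psi x y = dy (fun x y => dx u x y * chi x y) x y.
    by apply: (@dy_ext _ d) => // s t sd td; exact: psiE.
  have -> : dx (fun x y => slope u x y * psi x y) x y = dx (fun x y => dy u x y * chi x y) x y.
    apply: (@dx_ext _ d) => // s t sd td; rewrite /slope psiE // mulrA.
    by rewrite divfK // ux0.
  rewrite (dyM rux rchi) // (dxM ruy rchi) // (dxdyC ru) //; ring.
have chi_a t : `|t| < d -> chi a t = 0 by move=> td; rewrite /chi pa // mul0r.
have chi_b t : `|t| < d -> chi b t = 0 by move=> td; rewrite /chi pb // mul0r.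
have rdxchi := rat_dx rchi; have rdychi := rat_dy rchi.
have cH h t : ratfun d h -> `|t| < d -> cont_on a b (fun x => H x t * h x t).
  move=> rh td x /seg xd; exact: (jcontx (jcontM (jH x t xd td) (jR h x t rh xd td))).
have by_parts t : `|t| < d -> segint a b (fun x => F (u x t) * psi x t) =
    - segint a b (fun x => H x t * dx chi x t).
  move=> td; apply/eqP; rewrite -addr_eq0; apply/eqP.
  rewrite -segintD; [|exact: wave_cont_on|exact: cH].
  have cc : cont_on a b (fun x => F (u x t) * psi x t + H x t * dx chi x t).
    by apply: cont_onD; [exact: wave_cont_on|exact: cH].
  have dd (x : R) : a <= x <= b -> is_derive x 1 (fun x => H x t * chi x t)
      (F (u x t) * psi x t + H x t * dx chi x t).
    move=> /seg xd; apply: is_derive_eq (is_deriveM (dHx x t xd td) (rat_is_dx rchi xd td)) _.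
    by rewrite /GRing.scale /= psiE //; ring.
  by rewrite (segint_derive ab cc dd) chi_a // chi_b // !mulr0 subrr.
(* The two integrands add up to the x-derivative of [H * chi_y], whose boundary values vanish since
   [chi] is zero for all [y] at both ends. *)
have by_parts' : segint a b (fun x => F (u x y) * transport (slope u) psi x y) =
    - segint a b (fun x => F (u x y) * dy u x y * dx chi x y + H x y * dy (dx chi) x y).
  have c1 : cont_on a b (fun x => F (u x y) * dy u x y * dx chi x y + H x y * dy (dx chi) x y).
    apply: cont_onD; last by apply: cH => //; exact: rat_dy.
    move=> x /seg xd; apply: (@jcontx _ (fun x y => F (u x y) * dy u x y * dx chi x y)).
    by apply: jcontM; [apply: jcontM; [exact: jcont_wave|exact: jR]|exact: jR].
  have c2 : cont_on a b (fun x => F (u x y) * transport (slope u) psi x y).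
    by apply: wave_cont_on => //; apply: rat_transport => //; exact: rat_slope.
  apply/eqP; rewrite -addr_eq0; apply/eqP; rewrite -segintD //.
  have dd (x : R) : a <= x <= b -> is_derive x 1 (fun x => H x y * dy chi x y)
      (F (u x y) * transport (slope u) psi x y +
       (F (u x y) * dy u x y * dx chi x y + H x y * dy (dx chi) x y)).
    move=> /seg xd; apply: is_derive_eq (is_deriveM (dHx x y xd yd) (rat_is_dx rdychi xd yd)) _.
    by rewrite /GRing.scale /= TE // (dxdyC rchi) //; ring.
  rewrite (segint_derive ab (cont_onD c2 c1) dd).
  rewrite (is_derive_eq0 yd chi_a (rat_is_dy rchi ad yd)).
  by rewrite (is_derive_eq0 yd chi_b (rat_is_dy rchi bd yd)) !mulr0 subrr.
rewrite by_parts'.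
apply: (@near_eq_is_derive R R R (fun t => - segint a b (fun x => H x t * dx chi x t))).
  by near=> t; rewrite by_parts //; near: t; exact: near_lt_norm.
apply: is_deriveN.
(* A compact range of [y] inside the square, on which the integrand's derivative is bounded. *)
have [v /andP[yv vd]] : exists v, `|y| < v < d.
  by exists ((`|y| + d) / 2); apply/andP; split; lra.
have yvI : - v < y < v by rewrite -ltr_norml.
have tv t : - v <= t <= v -> `|t| < d by rewrite -ler_norml => /le_lt_trans; apply.
apply: (@is_derive_segint_param _ (fun x t => H x t * dx chi x t)
  (fun x t => F (u x t) * dy u x t * dx chi x t + H x t * dy (dx chi) x t) a b _ _ _ yvI).
- by move=> x t /seg xd /tv td; apply: jcontM; [exact: jH|exact: jR].
- move=> x t /seg xd /tv td; apply: jcontD; apply: jcontM.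
  + by apply: jcontM; [exact: jcont_wave|exact: jR].
  + exact: jR.
  + exact: jH.
  + by apply: jR => //; exact: rat_dy.
- move=> x t /seg xd /andP[vt tv']; have td : `|t| < d by apply: tv; rewrite !ltW.
  apply: is_derive_eq (is_deriveM (dHy x t xd td) (rat_is_dy rdxchi xd td)) _.
  by rewrite /GRing.scale /=; ring.
Unshelve. all: by end_near. Qed.
End Wave.
End WeakEquation.

(** * Operators on test functions and boundary values *)

Section WeakODE.
Variable R : realType.
Implicit Types (h psi chi phi m : R -> R -> R) (a b x y d : R) (w : R -> R).

Definition linop d (L : (R -> R -> R) -> R -> R -> R) := [/\
  forall h, ratfun d h -> ratfun d (L h),
  forall h g, eq_on d h g -> eq_on d (L h) (L g),
  forall h g, ratfun d h -> ratfun d g ->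
    eq_on d (L (fun x y => h x y + g x y)) (fun x y => L h x y + L g x y) &
  forall (c : R) h, ratfun d h -> eq_on d (L (fun x y => c * h x y)) (fun x y => c * L h x y)].

Lemma dx_cst d (c : R) : eq_on d (dx (fun _ _ => c)) (fun _ _ => 0).
Proof. by move=> x y _ _; exact: (is_derive_val (is_derive_cst (c : R) x 1)). Qed.

Lemma dy_cst d (c : R) : eq_on d (dy (fun _ _ => c)) (fun _ _ => 0).
Proof. by move=> x y _ _; exact: (is_derive_val (is_derive_cst (c : R) y 1)). Qed.

Lemma linop_dx d : linop d (@dx R).
Proof.
split=> [h|h g|h g|c h rh]; [exact: rat_dx|exact: dx_ext|exact: dxD|].
move=> x y xd yd; rewrite (dxM (rat_cst d c) rh) // (@dx_cst d) //.
by rewrite mul0r add0r.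
Qed.

Lemma linop_transport d m : ratfun d m -> linop d (transport m).
Proof.
move=> rm; split=> [h|h g|h g rh rg|c h rh]; [exact: rat_transport|exact: transport_ext|..].
  move=> x y xd yd; rewrite /transport (dyD rh rg) //.
  rewrite (@dx_ext _ d _ (fun x y => m x y * h x y + m x y * g x y)) //.
    by rewrite (dxD (ratM rm rh) (ratM rm rg)) //; ring.
  by move=> s t _ _; rewrite mulrDr.
move=> x y xd yd; rewrite /transport (dyM (rat_cst d c) rh) // (@dy_cst d) //.
rewrite (@dx_ext _ d _ (fun x y => c * (m x y * h x y))) //.
  by rewrite (dxM (rat_cst d c) (ratM rm rh)) // (@dx_cst d) //; ring.
by move=> s t _ _; rewrite mulrCA.
Qed.

Lemma linop_comp d L L' : linop d L -> linop d L' -> linop d (fun h => L (L' h)).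
Proof.
move=> [Lr Le LD LZ] [Lr' Le' LD' LZ']; split=> [h rh|h g hg|h g rh rg|c h rh].
- exact/Lr/Lr'.
- exact/Le/Le'.
- by move=> x y xd yd; rewrite (Le _ _ (LD' _ _ rh rg)) // LD //; exact: Lr'.
- by move=> x y xd yd; rewrite (Le _ _ (LZ' c _ rh)) // LZ //; exact: Lr'.
Qed.

Lemma linop_iter d L k : linop d L -> linop d (iter k L).
Proof.
move=> hL; elim: k => [|k IH]; first by split.
exact: (linop_comp hL IH).
Qed.

Lemma linop_sum d L (n : nat) (c : nat -> R) (h : nat -> R -> R -> R) : linop d L ->
  (forall i, ratfun d (h i)) ->
  ratfun d (fun x y => \sum_(i < n) c i * h i x y) /\
  eq_on d (L (fun x y => \sum_(i < n) c i * h i x y))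
    (fun x y => \sum_(i < n) c i * L (h i) x y).
Proof.
move=> [Lr Le LD LZ] rh; elim: n => [|n [IHr IH]].
  split.
    by apply: rat_ext (rat_cst d 0) => x y _ _; rewrite big_ord0.
  move=> x y xd yd; rewrite (Le _ (fun x y => 0 * 0)) //.
    by rewrite (LZ 0 _ (rat_cst d 0)) // mul0r big_ord0.
  by move=> s t _ _; rewrite big_ord0 mul0r.
have E : eq_on d (fun x y => \sum_(i < n.+1) c i * h i x y)
    (fun x y => \sum_(i < n) c i * h i x y + c n * h n x y).
  by move=> s t _ _; rewrite big_ord_recr.
have rn : ratfun d (fun x y => c n * h n x y) by apply: ratM => //; exact: rat_cst.
split.
  by apply: rat_ext (ratD IHr rn) => s t sd td; rewrite E.
move=> x y xd yd; rewrite (Le _ _ E) // LD // IH // LZ //.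
by rewrite big_ord_recr.
Qed.

(* psi vanishes to order e at both ends of [a, b]; the normalization of the
   leading coefficient w at b by e! makes it multiplicative under dx and transport. *)
Definition vanishes d a b e psi w := exists chi, [/\ ratfun d chi,
  eq_on d psi (fun x y => (x - a) ^+ e * (b - x) ^+ e * chi x y) &
  forall y, `|y| < d -> e`!%:R * chi b y = w y].

Definition endpoly a b e : {poly R} := ('X - a%:P) ^+ e * (b%:P - 'X) ^+ e.

Lemma endpolyE a b e x : (endpoly a b e).[x] = (x - a) ^+ e * (b - x) ^+ e.
Proof. by rewrite /endpoly !hornerE. Qed.

Lemma rat_endpoly d a b e : ratfun d (fun x _ => (x - a) ^+ e * (b - x) ^+ e).
Proof.
apply: ratM; apply: ratX; apply: ratB; solve [exact: rat_x|exact: rat_cst].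
Qed.

Lemma dx_endpoly d a b e : eq_on d (dx (fun x _ => (x - a) ^+ e.+1 * (b - x) ^+ e.+1))
  (fun x _ => (x - a) ^+ e * (b - x) ^+ e * (e.+1%:R * ((b - x) - (x - a)))).
Proof.
move=> x y xd yd; apply: is_derive_val.
have -> : (fun x _ : R => (x - a) ^+ e.+1 * (b - x) ^+ e.+1)^~ y = horner (endpoly a b e.+1).
  by apply/funext => t; rewrite endpolyE.
apply: is_derive_eq (is_derive_poly _ _) _.
rewrite /endpoly derivM !deriv_exp /= !derivB derivX !derivC sub0r subr0.
rewrite !(hornerD, hornerM, hornerN, hornerMn, horner_exp, hornerX, hornerC) !exprS.
rewrite -[X in X * _ + _]mulr_natr -[X in _ + _ * X]mulr_natr. ring.
Qed.

Lemma dy_endpoly d a b e : eq_on d (dy (fun x _ => (x - a) ^+ e * (b - x) ^+ e)) (fun _ _ => 0).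
Proof.
move=> x y _ _.
exact: (is_derive_val (is_derive_cst ((x - a) ^+ e * (b - x) ^+ e : R) y 1)).
Qed.

(** At [b] only the derivative of [(b - x) ^+ e.+1] lowers the order; its factor [e.+1] is absorbed
    by the factorial normalization. *)
Lemma vanishes_dx d a b e psi w : `|b| < d -> vanishes d a b e.+1 psi w ->
  vanishes d a b e (dx psi) (fun y => - (b - a) * w y).
Proof.
move=> bd [chi [rchi pE cw]].
exists (fun x y => e.+1%:R * ((b - x) - (x - a)) * chi x y + (x - a) * (b - x) * dx chi x y).
have rl : ratfun d (fun x _ => (b - x) - (x - a)).
  by apply: ratB; apply: ratB; solve [exact: rat_x|exact: rat_cst].
split.
- apply: ratD; apply: ratM => //.
  + by apply: ratM => //; exact: rat_cst.
  + by apply: ratM; apply: ratB; solve [exact: rat_x|exact: rat_cst].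
  + exact: rat_dx.
- move=> x y xd yd; rewrite (dx_ext pE) // (dxM (rat_endpoly d a b e.+1) rchi) //.
  by rewrite (@dx_endpoly d) // !exprS; ring.
- by move=> y yd; rewrite -cw // subrr factS natrM; ring.
Qed.

(** The y-derivative keeps the order of vanishing, so the leading coefficient comes from
    [- (m psi)_x] alone. *)
Lemma vanishes_transport d a b e m psi w : `|b| < d -> ratfun d m ->
  vanishes d a b e.+1 psi w ->
  vanishes d a b e (transport m psi) (fun y => (b - a) * m b y * w y).
Proof.
move=> bd rm [chi [rchi pE cw]].
exists (fun x y => (x - a) * (b - x) * transport m chi x y
  - e.+1%:R * ((b - x) - (x - a)) * (m x y * chi x y)).
have rl : ratfun d (fun x _ => (b - x) - (x - a)).
  by apply: ratB; apply: ratB; solve [exact: rat_x|exact: rat_cst].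
have rW := rat_endpoly d a b e.+1.
split.
- apply: ratB; apply: ratM => //.
  + by apply: ratM; apply: ratB; solve [exact: rat_x|exact: rat_cst].
  + exact: rat_transport.
  + by apply: ratM => //; exact: rat_cst.
  + exact: ratM.
- move=> x y xd yd; rewrite (transport_ext _ pE) // /transport.
  rewrite (dyM rW rchi) // (@dy_endpoly d) //.
  rewrite (@dx_ext _ d _ (fun x y => (x - a) ^+ e.+1 * (b - x) ^+ e.+1 * (m x y * chi x y))) //.
    by rewrite (dxM rW (ratM rm rchi)) // (@dx_endpoly d) // !exprS; ring.
  by move=> s t _ _; rewrite mulrCA.
- by move=> y yd; rewrite -cw // subrr factS natrM; ring.
Qed.

Lemma vanishes_iter_dx d a b e l psi w : `|b| < d -> vanishes d a b (e + l) psi w ->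
  vanishes d a b e (iter l (@dx R) psi) (fun y => (- (b - a)) ^+ l * w y).
Proof.
move=> bd; elim: l e => [|l IH] e.
  rewrite addn0 => [[chi [rc pE cw]]]; exists chi; split=> // y yd.
  by rewrite expr0 mul1r cw.
rewrite -addSnnS => /IH/(vanishes_dx bd)[chi [rc pE cw]]; exists chi; split=> // y yd.
by rewrite cw // exprS mulrA.
Qed.

Lemma vanishes_iter_transport d a b e k m psi w : `|b| < d -> ratfun d m ->
  vanishes d a b (e + k) psi w ->
  vanishes d a b e (iter k (transport m) psi) (fun y => ((b - a) * m b y) ^+ k * w y).
Proof.
move=> bd rm; elim: k e => [|k IH] e.
  rewrite addn0 => [[chi [rc pE cw]]]; exists chi; split=> // y yd.
  by rewrite expr0 mul1r cw.
rewrite -addSnnS => /IH/(vanishes_transport bd rm)[chi [rc pE cw]].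
exists chi; split=> // y yd; by rewrite cw // exprS mulrA.
Qed.

Lemma vanishes_ends d a b e psi w : `|a| < d -> `|b| < d -> vanishes d a b e.+1 psi w ->
  (forall y, `|y| < d -> psi a y = 0) /\ (forall y, `|y| < d -> psi b y = 0).
Proof.
move=> ad bd [chi [_ pE _]]; split=> y yd; rewrite pE // subrr expr0n /= ?mulr0 !mul0r //.
Qed.

Lemma vanishes_rat d a b e psi w : vanishes d a b e psi w -> ratfun d psi.
Proof.
move=> [chi [rc pE _]]; apply: rat_ext (ratM (rat_endpoly d a b e) rc) => x y xd yd.
by rewrite pE.
Qed.

Lemma vanishes_lead d a b psi w y : `|b| < d -> `|y| < d -> vanishes d a b 0 psi w ->
  psi b y = w y.
Proof. by move=> bd yd [chi [_ pE cw]]; rewrite -cw // pE // !expr0 !mul1r. Qed.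
End WeakODE.

(** * The linear differential system for the integrals *)

Section ContinuousSolutions.
Variable R : realType.

Lemma is_derive_finsum (n : nat) (f : 'I_n -> R -> R) (f' : 'I_n -> R) (y : R) :
  (forall i, is_derive y 1 (f i) (f' i)) ->
  is_derive y 1 (fun t => \sum_i f i t) (\sum_i f' i).
Proof.
move=> hf; rewrite (_ : (fun t => _) = \sum_i f i); first exact: is_derive_sum.
by apply/funext => t; rewrite fct_sumE.
Qed.

Lemma rgerm_coef_prod (I : Type) (s : seq I) (P : pred I) (f : I -> R -> {poly R}) :
  (forall i k, rgerm (fun x => (f i x)`_k)) ->
  forall k, rgerm (fun x => (\prod_(i <- s | P i) f i x)`_k).
Proof.
move=> hf; elim: s => [|i s IH] k.
  by apply: rgerm_near (rgerm_cst (1 : {poly R})`_k); apply: nearW0 => x; rewrite big_nil.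
case Pi : (P i); last by apply: rgerm_near (IH k); apply: nearW0 => x; rewrite big_cons Pi.
apply: rgerm_near (rgerm_sum (index_enum _) xpredT
  (fun l : 'I_k.+1 => rgermM (hf i l) (IH (k - l)%N))).
by apply: nearW0 => x; rewrite big_cons Pi coefM.
Qed.

Section Waves.
Variables (N : nat) (d : R) (u : 'I_N -> R -> R -> R) (F : 'I_N -> R -> R) (p q : 'I_N -> R).
Hypothesis ru : forall i, ratfun d (u i).
Hypothesis ux0 : forall i x y, `|x| < d -> `|y| < d -> dx (u i) x y != 0.
Hypothesis upq : forall i x y, `|x| < d -> `|y| < d -> p i < u i x y < q i.
Hypothesis Fc : forall i t, p i <= t <= q i -> {for t, continuous (F i)}.
Hypothesis sumF0 : forall x y, `|x| < d -> `|y| < d -> \sum_i F i (u i x y) = 0.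

(** Induction on the number of y-derivatives of the relation integrated against [psi]. Each
    [is_derive_wave] needs a test function zero at both ends and costs one order of vanishing, hence
    [k] orders for [k] derivatives. *)
Lemma waves_transport a b k psi w y : a < b -> `|a| < d -> `|b| < d ->
  vanishes d a b k psi w -> `|y| < d ->
  \sum_i segint a b (fun x => F i (u i x y) * iter k (transport (slope (u i))) psi x y) = 0.
Proof.
move=> ab ad bd vk yd.
have rs i : ratfun d (slope (u i)) by exact: (rat_slope (ru i) (@ux0 i)).
suff H l : (l <= k)%N -> forall t, `|t| < d ->
    \sum_i segint a b (fun x => F i (u i x t) * iter l (transport (slope (u i))) psi x t) = 0.
  exact: H.
have vl i j : (j <= k)%N ->
    exists w', vanishes d a b (k - j) (iter j (transport (slope (u i))) psi) w'.
  move=> lk; eexists; apply: vanishes_iter_transport => //.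
  by rewrite subnK //; exact: vk.
have seg x : a <= x <= b -> `|x| < d by exact: in_segment.
elim: l => [_|l IH lk] t td.
  rewrite -segint_sum => [|i]; last first.
    by apply: (wave_cont_on (ru i) (@upq i) (@Fc i)) => //; exact: vanishes_rat vk.
  rewrite -[RHS](segint0 a b); apply: eq_segint => x /seg xd /=.
  by rewrite -mulr_suml sumF0 // mul0r.
have lk' := ltnW lk.
apply: (is_derive_eq0 td (IH lk')); apply: is_derive_finsum => i.
have [w' v'] := vl i l lk'.
have v1 : exists e, vanishes d a b e.+1 (iter l (transport (slope (u i))) psi) w'.
  by exists (k - l).-1; rewrite prednK // subn_gt0.
have [e ve] := v1; have [va vb] := vanishes_ends ad bd ve.
by apply: (is_derive_wave (ru i) (@ux0 i) (@upq i) (@Fc i)) => //; exact: vanishes_rat ve.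
Qed.
Hypothesis d0 : 0 < d.
Hypothesis slopes : forall i j x y, i != j -> `|x| < d -> `|y| < d ->
  slope (u i) x y != slope (u j) x y.

Let n := N.-1.
Let a := - (d / 2).
(** Coefficient of [b ^+ i] in the test function [(x - a) ^+ n * (b - x) ^+ n]. *)
Let Cp (i : nat) (x : R) := 'C(n, i)%:R * (- x) ^+ (n - i) * (x - a) ^+ n.
(** In total [n] differentiations, exactly the order to which the test function vanishes: its value
    at [b] becomes nonzero up to the factor [slope ^+ k]. *)
Let op (j : 'I_N) (k : nat) (h : R -> R -> R) :=
  iter k (transport (slope (u j))) (iter (n - k) (@dx R) h).
Let theta (k : nat) (j : 'I_N) (i : nat) (x : R) := op j k (fun x _ => Cp i x) x 0.
(** The unknowns of the system. [theta] is independent of [b], so that differentiating [g] only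
    produces an endpoint value. *)
Let g (k i : nat) (b : R) := \sum_j segint a b (fun x => F j (u j x 0) * theta k j i x).

Let rs i : ratfun d (slope (u i)).
Proof. exact: (rat_slope (ru i) (@ux0 i)). Qed.

Let rC i : ratfun d (fun x _ => Cp i x).
Proof.
apply: ratM; [apply: ratM; first exact: rat_cst|]; apply: ratX.
  by apply: ratN; exact: rat_x.
by apply: ratB; solve [exact: rat_x|exact: rat_cst].
Qed.

Let lop j k : linop d (op j k).
Proof.
by apply: linop_comp; apply: linop_iter; [exact: linop_transport|exact: linop_dx].
Qed.

Let half_pos : 0 < d / 2 /\ d / 2 < d.
Proof. by move: d0 => d_gt0; split; lra. Qed.

Let cd : `|d / 2| < d.
Proof. by have [h1 h2] := half_pos; rewrite gtr0_norm. Qed.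

Let ad : `|a| < d.
Proof. by rewrite /a normrN. Qed.

Let z0 : `|0 : R| < d.
Proof. by rewrite normr0. Qed.

Let half_lt b : `|b| < d / 2 -> a < b /\ `|b| < d.
Proof.
move=> bd; split; first by move: bd; rewrite /a ltr_norml => /andP[].
by have [_] := half_pos; exact: lt_trans.
Qed.

Let psiE b : eq_on d (fun x _ => (x - a) ^+ n * (b - x) ^+ n)
  (fun x y => \sum_(i < n.+1) b ^+ i * (fun x (_ : R) => Cp i x) x y).
Proof.
move=> x y _ _; rewrite (_ : b - x = - x + b); last by rewrite addrC.
rewrite (exprDn (- x) b n) mulr_sumr; apply: eq_bigr => i _.
by rewrite /Cp -mulr_natl; ring.
Qed.

Let vpsi b : vanishes d a b n (fun x _ => (x - a) ^+ n * (b - x) ^+ n) (fun=> n`!%:R).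
Proof.
exists (fun _ _ => 1); split=> [|x y _ _|y _]; first exact: rat_cst.
  by rewrite mulr1.
by rewrite mulr1.
Qed.

Let op_sum j k b : eq_on d (op j k (fun x _ => (x - a) ^+ n * (b - x) ^+ n))
  (fun x y => \sum_(i < n.+1) b ^+ i * op j k (fun x _ => Cp i x) x y).
Proof.
move=> x y xd yd; have [_ Le _ _] := lop j k; rewrite (Le _ _ (psiE b)) //.
exact: (linop_sum n.+1 (fun i => b ^+ i) (lop j k) rC).2.
Qed.

Let rtheta j k i : ratfun d (op j k (fun x _ => Cp i x)).
Proof. by have [Lr _ _ _] := lop j k; exact/Lr/rC. Qed.

Let cont_theta c j k i : `|c| < d -> cont_on a c (fun x => F j (u j x 0) * theta k j i x).
Proof. by move=> c_d; apply: (wave_cont_on (ru j) (@upq j) (@Fc j)) => //; exact: rtheta. Qed.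

(** This is [waves_transport] at [y = 0] for the [(n - k)]-th x-derivative of the test function,
    which still vanishes to order [k], expanded in powers of [b]. *)
Let sum_g k b : (k <= n)%N -> `|b| < d / 2 -> \sum_(i < n.+1) b ^+ i * g k i b = 0.
Proof.
move=> kn /half_lt[ab bd].
have v1 : vanishes d a b (k + (n - k)) (fun x _ => (x - a) ^+ n * (b - x) ^+ n) (fun=> n`!%:R).
  by rewrite subnKC //; exact: vpsi.
rewrite -[RHS](waves_transport ab ad bd (vanishes_iter_dx bd v1) z0).
rewrite /g; under eq_bigr do rewrite mulr_sumr.
rewrite exchange_big /=; apply: eq_bigr => j _.
rewrite (eq_bigr (fun i : 'I_n.+1 => segint a b
    (fun x => b ^+ i * (F j (u j x 0) * theta k j i x)))); last first.
  by move=> i _; rewrite segintZ //; exact: cont_theta.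
rewrite -segint_sum; last by move=> i; apply: cont_onZ; exact: cont_theta.
apply: eq_segint => x xab; have xd := in_segment ad bd xab.
have := op_sum j k b xd z0; rewrite /op => ->; rewrite mulr_sumr.
by apply: eq_bigr => i _; rewrite mulrCA.
Qed.

Let dg k i (b : R) : `|b| < d / 2 ->
  is_derive b 1 (g k i) (\sum_j F j (u j b 0) * theta k j i b).
Proof.
move=> bd2; have [ab bd] := half_lt bd2.
apply: is_derive_finsum => j; apply: (@is_derive_segint _ a (d / 2)).
  exact: cont_theta.
by rewrite ab /=; move: bd2; rewrite ltr_norml => /andP[].
Qed.

Let K k b : R := (b - a) ^+ k * ((- (b - a)) ^+ (n - k) * n`!%:R).

Let theta_lead k j b : (k <= n)%N -> `|b| < d / 2 ->
  \sum_(i < n.+1) b ^+ i * theta k j i b = slope (u j) b 0 ^+ k * K k b.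
Proof.
move=> kn /half_lt[ab bd].
have v1 : vanishes d a b (k + (n - k)) (fun x _ => (x - a) ^+ n * (b - x) ^+ n) (fun=> n`!%:R).
  by rewrite subnKC //; exact: vpsi.
have v2 := vanishes_iter_dx bd v1; rewrite -[k in vanishes _ _ _ k]add0n in v2.
have := vanishes_lead bd z0 (vanishes_iter_transport bd (rs j) v2).
have := op_sum j k b bd z0; rewrite /op => -> -> /=.
by rewrite exprMn /K; ring.
Qed.

(** Derivative in [b] of [sum_g]: where it falls on [g], the endpoint values add up by [theta_lead]
    to a moment of order [k] of the waves; where it falls on [b ^+ i], the integrals [g] remain. *)
Let moment k b : (k <= n)%N -> `|b| < d / 2 ->
  \sum_j F j (u j b 0) * slope (u j) b 0 ^+ k =
  - (K k b)^-1 * \sum_(i < n.+1) (i%:R * b ^+ i.-1) * g k i b.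
Proof.
move=> kn bd2; have [ab bd] := half_lt bd2.
have ba0 : b - a != 0 by rewrite subr_eq0 gt_eqF.
have K0 : K k b != 0.
  by rewrite !mulf_neq0 ?expf_neq0 ?oppr_eq0 // pnatr_eq0 -lt0n fact_gt0.
have D : is_derive b 1 (fun t => \sum_(i < n.+1) t ^+ i * g k i t)
   (\sum_(i < n.+1) ((i%:R * b ^+ i.-1) * g k i b
      + b ^+ i * \sum_j F j (u j b 0) * theta k j i b)).
  apply: is_derive_finsum => i.
  have dX : is_derive b 1 (fun t : R => t ^+ i) (i%:R * b ^+ i.-1).
    have := is_derive_poly ('X^i : {poly R}) b.
    rewrite derivXn hornerMn hornerXn -mulr_natl (_ : horner _ = fun t : R => t ^+ i) //.
    by apply/funext => t; rewrite hornerXn.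
  apply: is_derive_eq (is_deriveM dX (dg k i bd2)) _.
  by rewrite /GRing.scale /= addrC [g k i b * _]mulrC.
have := is_derive_eq0 bd2 (fun t td => sum_g kn td) D.
rewrite big_split /=.
have -> : \sum_(i < n.+1) b ^+ i * \sum_j F j (u j b 0) * theta k j i b =
    K k b * \sum_j F j (u j b 0) * slope (u j) b 0 ^+ k.
  under eq_bigr do rewrite mulr_sumr.
  rewrite exchange_big mulr_sumr /=; apply: eq_bigr => j _.
  rewrite mulrCA [K k b * _]mulrC -(theta_lead j kn bd2) mulr_sumr.
  by apply: eq_bigr => i _; rewrite mulrCA.
by move=> /eqP; rewrite addrC addr_eq0 => /eqP E; rewrite mulNr -mulrN -E mulKf.
Qed.

(** Up to the factor [gap], its coefficients are entries of the inverse Vandermonde matrix of the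
    slopes: they combine the moments so as to isolate wave [j]. *)
Let lagrange j b : {poly R} := \prod_(l | l != j) ('X - (slope (u l) b 0)%:P).

Let size_lagrange j b : (size (lagrange j b) <= n.+1)%N.
Proof.
rewrite /lagrange -big_filter size_prod_XsubC; have [e _ _ [_ ->]] := big_enumP.
by rewrite cardC1 card_ord.
Qed.

Let gap j b : R := \prod_(l | l != j) (slope (u j) b 0 - slope (u l) b 0).

Let gap_neq0 j b : `|b| < d -> gap j b != 0.
Proof.
move=> bd; rewrite /gap; apply/prodf_neq0 => l lj.
by rewrite subr_eq0 eq_sym slopes.
Qed.

Let lagrange_sum j b : \sum_i F i (u i b 0) * (lagrange j b).[slope (u i) b 0] =
  F j (u j b 0) * gap j b.
Proof.
rewrite (bigD1 j) //= big1 ?addr0 => [|i ij].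
  by rewrite /lagrange horner_prod; congr (_ * _); apply: eq_bigr => l _; rewrite hornerXsubC.
by rewrite /lagrange horner_prod (bigD1 i) //= hornerXsubC subrr mul0r mulr0.
Qed.

Let E j k i b : R := - ((gap j b)^-1 * (lagrange j b)`_k * (K k b)^-1 * (i%:R * b ^+ i.-1)).

Let wave_expansion j b : `|b| < d / 2 -> F j (u j b 0) =
  \sum_(ki : 'I_n.+1 * 'I_n.+1) E j ki.1 ki.2 b * g ki.1 ki.2 b.
Proof.
move=> bd2; have [ab bd] := half_lt bd2.
rewrite -[LHS](mulfK (gap_neq0 j bd)) -lagrange_sum.
under eq_bigr do rewrite (horner_coef_wide _ (size_lagrange j b)) mulr_sumr.
rewrite exchange_big /= -(pair_bigA _ (fun k i : 'I_n.+1 => E j k i b * g k i b)) /= mulr_suml.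
apply: eq_bigr => k _.
under eq_bigr do rewrite mulrCA.
rewrite -mulr_sumr (moment _ bd2); last by rewrite -ltnS.
rewrite mulr_sumr mulr_sumr mulr_suml; apply: eq_bigr => i _.
by rewrite /E; ring.
Qed.

Let rg_slope j : rgerm (fun b => slope (u j) b 0).
Proof. exact: rat_rgerm d0 (rs j). Qed.

Let rg_E j k i : rgerm (E j k i).
Proof.
have lin (c : R) : rgerm (fun b => b - c) by apply: rgermB; [exact: rgerm_id|exact: rgerm_cst].
apply: rgermN; apply: rgermM; last first.
  by apply: rgermM; [exact: rgerm_cst|apply: rgermX; exact: rgerm_id].
apply: rgermM; last first.
  apply: rgermV.
    have a0 : 0 - a != 0 by rewrite sub0r oppr_eq0 lt_eqF // oppr_lt0; have [] := half_pos.
    by rewrite !mulf_neq0 ?expf_neq0 ?oppr_eq0 // pnatr_eq0 -lt0n fact_gt0.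
  apply: rgermM; first by apply: rgermX; exact: lin.
  by apply: rgermM; [apply: rgermX; apply: rgermN; exact: lin|exact: rgerm_cst].
apply: rgermM.
  apply: rgermV; first exact: gap_neq0.
  by apply: rgerm_prod => l; apply: rgermB.
apply: rgerm_coef_prod => l m.
apply: rgerm_near (rgermB (rgerm_cst ('X : {poly R})`_m)
  (rgermM (rg_slope l) (rgerm_cst (m == 0%N)%:R))).
by apply: nearW0 => x; rewrite coefB coefC; case: (m == 0%N); rewrite ?mulr1 ?mulr0.
Qed.

(** [dg] gives [g'] in terms of the waves and [wave_expansion] gives the waves in terms of the [g]:
    a closed linear system of size [n.+1 ^ 2] whose coefficients are analytic at 0. *)
Let rg_g k i : (k < n.+1)%N -> (i < n.+1)%N -> rgerm (g k i).
Proof.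
move=> kn in_; have [d2 _] := half_pos.
apply: (@analytic_linear_ode R ('I_n.+1 * 'I_n.+1)%type
  (fun p q b => \sum_j theta p.1 j p.2 b * E j q.1 q.2 b)
  (fun p => g p.1 p.2) (d / 2) d2 _ _ (Ordinal kn, Ordinal in_)).
- move=> p' q'; apply: rgerm_sum => j; apply: rgermM; last exact: rg_E.
  exact: rat_rgerm d0 (rtheta _ _ _).
- move=> p' b bd2; apply: is_derive_eq (dg _ _ bd2) _.
  under [RHS]eq_bigr do rewrite mulr_suml.
  rewrite [RHS]exchange_big /=; apply: eq_bigr => j _.
  rewrite (wave_expansion j bd2) mulr_suml; apply: eq_bigr => q' _; ring.
Qed.

Lemma continuous_waves_analytic j : rgerm (fun r => F j (u j 0 0 + r)).
Proof.
have [d2 _] := half_pos.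
apply: (@rgerm_inverse _ (fun x => u j x 0) (fun x => F j (u j x 0)) (F j) (dx (u j) 0 0)).
- exact: rat_rgerm d0 (ru j).
- apply: rgerm_near (rgerm_sum (index_enum _) xpredT
    (fun ki : 'I_n.+1 * 'I_n.+1 => rgermM (rg_E j ki.1 ki.2) (rg_g (ltn_ord ki.1) (ltn_ord ki.2)))).
  have n0 : `|0 : R| < d / 2 by rewrite normr0.
  near=> b.
  have bd : `|b| < d / 2 by near: b; exact: near_lt_norm n0.
  by rewrite -(wave_expansion j bd).
- exact: rat_is_dx.
- exact: ux0.
- near=> x; apply: (@jcontx _ (u j)); apply: rat_jcont (ru j) _ z0.
  by near: x; exact: near_lt_norm.
- exact: nearW0.
Unshelve. all: by end_near. Qed.
End Waves.
End ContinuousSolutions.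

(** * Measurable solutions are continuous *)

Section Lusin.
Variable R : realType.
Notation mu := (@lebesgue_measure R).
Implicit Types (F : R -> R) (K E : set R).

(** Heine's theorem for the topology induced on [K], by the near-covering form of compactness with
    the modulus [t] as parameter. *)
Lemma compact_unif_continuous K F e : compact K -> {within K, continuous F} -> 0 < e ->
  exists2 t, 0 < t & forall x y, K x -> K y -> `|x - y| < t -> `|F x - F y| < e.
Proof.
move=> /compact_near_coveringP cK cF e0.
have e20 : 0 < e / 2 by rewrite divr_gt0.
have unif : \forall t \near (0 : R)^'+,
    K `<=` [set x | K x -> forall y, K y -> `|x - y| < t -> `|F x - F y| < e].
  apply: cK => x Kx.
  have /cvgrPdist_lt/(_ _ e20) : F z @[z --> within K (nbhs x)] --> F x.
    by move/subspace_continuousP: cF; exact.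
  rewrite near_withinE => /nbhs_ballP[r /= r0 hr].
  have r20 : 0 < r / 2 by rewrite divr_gt0.
  exists (ball x (r / 2), [set t | t < r / 2]).
    split; first exact: nbhsx_ballx.
    exact: nbhs_right_lt.
  move=> [z t] [/= xz tr] Kz y Ky zy.
  have xzr : `|x - z| < r by apply: lt_trans xz _; lra.
  have xyr : `|x - y| < r.
    have := ler_normD (x - z) (z - y); rewrite addrA subrK => h.
    by move: xz; rewrite /ball /= => xz; lra.
  have h1 := hr _ xzr Kz; have h2 := hr _ xyr Ky.
  have := ler_normD (F z - F x) (F x - F y); rewrite addrA subrK [`|F z - F x|]distrC.
  by lra.
near (0 : R)^'+ => t; exists t => // x y Kx Ky.
by have : K `<=` [set x | K x -> forall y, K y -> `|x - y| < t -> `|F x - F y| < e];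
  [near: t|move=> /(_ x Kx Kx y Ky)].
Unshelve. all: by end_near. Qed.

(** [E] is covered by intervals of small total length, and each is pulled back separately. Neither
    measurability nor continuity of [phi] is assumed, which matters because [phi] will come from a
    choice of points. *)
Lemma lebesgue_preimage_expanding (phi : R -> R) (Y E : set R) (c e : R) : 0 < c ->
  (forall y y', Y y -> Y y' -> c * `|y - y'| <= `|phi y - phi y'|) ->
  (mu E < e%:E)%E -> exists B, [/\ measurable B,
    forall y, Y y -> E (phi y) -> B y & (mu B <= (2 / c * e)%:E)%E].
Proof.
move=> c0 expand; rewrite {1}/lebesgue_measure /lebesgue_stieltjes_measure /measure_extension /mu_ext.
move=> /ereal_inf_lt[_ [F [mF EF] <-] sumF].
have ex k : exists J : set R, [/\ measurable J, forall y, Y y -> F k (phi y) -> J y &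
    (mu J <= (2 / c)%:E * wlength idfun (F k))%E].
  have := mF k; rewrite /measurable /= => -[[a b] _ Fk].
  have [[y0 [Yy0 Fy0]]|nex] := pselect (exists y, Y y /\ F k (phi y)); last first.
    exists set0; split; [exact: measurable0|by move=> y Yy Fy; apply: nex; exists y|].
    by rewrite measure0 mule_ge0 ?wlength_ge0 // lee_fin divr_ge0 // ltW.
  have ab : a < b.
    by move: Fy0; rewrite -Fk /= in_itv /= => /andP[]; exact: lt_le_trans.
  (* Any preimage point [y0] can serve as centre: the expansion keeps the others within
     [(b - a) / c] of it. *)
  exists `[y0 - (b - a) / c, y0 + (b - a) / c]%classic; split; [exact: measurable_itv|move=> y Yy|].
    rewrite -Fk /= !in_itv /= => /andP[h1 h2].
    move: Fy0; rewrite -Fk /= in_itv /= => /andP[h3 h4].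
    rewrite -ler_distl ler_pdivlMr // mulrC; apply: le_trans (expand y y0 Yy Yy0) _.
    by rewrite ler_norml; apply/andP; split; lra.
  rewrite -Fk lebesgue_measure_itv wlength_itv /= !lte_fin ab.
  case: ifP => _; last first.
    by rewrite -EFinM lee_fin mulr_ge0 ?divr_ge0 ?subr_ge0 // ltW.
  rewrite -EFinM lee_fin le_eqVlt; apply/orP; left; apply/eqP; field; exact: lt0r_neq0.
have /choice[J hJ] := ex.
have mJ k : measurable (J k) by have [] := hJ k.
have mB : measurable (\bigcup_k J k) by exact: bigcupT_measurable.
exists (\bigcup_k J k); split=> // [y Yy /EF[k _ Fk]|].
  by exists k => //; have [_ h _] := hJ k; exact: h.
apply: (@le_trans _ _ (\sum_(k <oo) mu (J k))%E).
  exact: measure_sigma_subadditive.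
apply: (@le_trans _ _ (\sum_(k <oo) ((2 / c)%:E * wlength idfun (F k)))%E).
  by apply: lee_nneseries => // k _; have [] := hJ k.
rewrite nneseriesZl; last by move=> k _; exact: wlength_ge0.
rewrite [leRHS]EFinM; apply: lee_wpmul2l; last exact: ltW.
by rewrite lee_fin divr_ge0 // ltW.
Qed.

(* A function measurable for the completed algebra is Borel off a null set. *)
Lemma lusin_completed (F : R -> R) (V : set R) (p q e : R) : 0 < e ->
  `[p, q] `<=` V -> measurable V ->
  measurable_fun (V : set (g_sigma_algebraType (completed_algebra_gen mu))) F ->
  exists K, [/\ compact K, K `<=` `[p, q], (mu (`[p, q] `\` K) < e%:E)%E &
    {within K, continuous F}].
Proof.
move=> e0 IV mV mF.
have mVc : (completed_algebra_gen mu).-sigma.-measurable V.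
  by apply: sub_sigma_algebra; exists V => //; exists set0; [exact: negligible_set0|rewrite setU0].
(* Each rational sublevel set is the Borel set [AN.1] outside the Borel null set [AN.2]. Removing
   the countable union [Z] of these null sets makes [F] Borel measurable on the rest. *)
have /choice[AN hAN] (r : rat) : exists AN : set R * set R, [/\ measurable AN.1,
    measurable AN.2, mu AN.2 = 0%E & forall x, ~ AN.2 x -> (AN.1 x <-> V x /\ F x < ratr r)].
  have := mF mVc `]-oo, ratr r[%classic (measurable_itv _).
  rewrite g_sigma_completed_algebra_genE => -[A mA [N [Z [mZ Z0 NZ]] E]].
  exists (A, Z); split=> // x /= nZ.
  have -> : (V x /\ F x < ratr r) <-> (A `|` N) x.
    by rewrite E; split=> [[Vx Fx]|[Vx]]; [split=> //; rewrite /= in_itv|rewrite /= in_itv].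
  by split=> [|[//|/NZ]]; [left|].
pose en (n : nat) : rat := odflt 0 (unpickle n).
have enK r : en (pickle r) = r by rewrite /en pickleK.
pose Z := \bigcup_n (AN (en n)).2.
have mZ : measurable Z by apply: bigcupT_measurable => n; have [] := hAN (en n).
have muZ : mu Z = 0%E.
  apply/negligibleP => //; apply: negligible_bigcup => n.
  by have [_ mn n0 _] := hAN (en n); exact/negligibleP.
have ZP r x : ~ Z x -> ~ (AN r).2 x.
  by move=> nZ Ax; apply: nZ; exists (pickle r) => //; rewrite enK.
pose D := `[p, q] `\` Z.
have mD : measurable D by exact: measurableD.
have mFD : measurable_fun D F.
  move=> _; apply: (@measurability _ _ _ _ D F _ (RGenInftyO.measurableE R)); last exact: mD.
  move=> _ [_ [x ->] <-].
  have -> : D `&` F @^-1` `]-oo, x[ = \bigcup_(r in [set r : rat | ratr r < x]) (D `&` (AN r).1).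
    apply/seteqP; split=> y.
      move=> [Dy]; rewrite /= in_itv /= => /rat_in_itvoo[r]; rewrite in_itv /= => /andP[Fr rx].
      exists r => //; split=> //; have [_ _ _ hr] := hAN r.
      by apply/hr; [exact/ZP/Dy.2|split=> //; exact/IV/Dy.1].
    move=> [r /= rx [Dy Ay]]; split=> //; rewrite /= in_itv /=.
    have [_ _ _ hr] := hAN r; have /hr[+ _] := ZP r _ Dy.2.
    by move=> /(_ Ay)[_ Fr]; exact: lt_trans rx.
  rewrite bigcup_mkcond; apply: bigcupT_measurable_rat => r; case: ifP => // _.
  by apply: measurableI => //; have [] := hAN r.
have finD : (mu D < +oo)%E.
  apply: (@le_lt_trans _ _ (mu `[p, q])).
    by apply: le_measure; rewrite ?inE //; exact: subDsetl.
  by rewrite lebesgue_measure_itv /=; case: ifP => _; rewrite ?ltry // -EFinB ltry.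
have [K [cK KD muK cF]] := measurable_almost_continuous mD finD e0 mFD.
exists K; split=> //; first by apply: subset_trans KD _; exact: subDsetl.
have mK : measurable K by exact: compact_measurable.
apply: le_lt_trans muK.
apply: (@le_trans _ _ (mu ((D `\` K) `|` Z))).
  apply: le_measure; rewrite ?inE; [exact: measurableD|apply: measurableU => //; exact: measurableD|].
  by move=> x [Ix nK]; have [Zx|nZ] := pselect (Z x); [right|left].
have mDK : measurable (D `\` K) by exact: measurableD.
have : (mu ((D `\` K) `|` Z) <= mu (D `\` K) + mu Z)%E by apply: measureU2.
by rewrite muZ adde0.
Qed.
End Lusin.

(** * Metric estimates for the waves near the origin *)

Section MeasurableWaves.
Variable R : realType.
Notation mu := (@lebesgue_measure R).

Lemma finite_radius (I : finType) (P : I -> R -> Prop) :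
  (forall i, exists2 e, 0 < e & P i e) ->
  (forall i e e', 0 < e' -> e' <= e -> P i e -> P i e') ->
  exists2 e, 0 < e & forall i, P i e.
Proof.
move=> ex mono.
have /choice[f hf] i : exists e, 0 < e /\ P i e by have [e e0 Pe] := ex i; exists e.
pose e := \big[Num.min/1]_i f i.
have e0 : 0 < e.
  rewrite /e; elim/big_ind: _ => [|x y x0 y0|i _]; rewrite ?ltr01 //.
    by rewrite lt_min x0.
  by have [] := hf i.
exists e => // i; have [fi0 Pf] := hf i; apply: mono Pf => //.
exact: bigmin_le_cond.
Qed.

Lemma derive_lipschitz (f f' : R -> R) (s B : R) :
  (forall x : R, `|x| < s -> is_derive x 1 f (f' x)) ->
  (forall x : R, `|x| < s -> `|f' x| <= B) ->
  forall x x' : R, `|x| < s -> `|x'| < s -> `|f x - f x'| <= B * `|x - x'|.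
Proof.
move=> df f'B x x' xs xs'.
wlog le_x : x x' xs xs' / x' <= x.
  move=> W; have [h|h] := leP x' x; first exact: W.
  by rewrite distrC [`|x - x'|]distrC; apply: W => //; exact: ltW.
have seg y : y \in `[x', x] -> `|y| < s.
  move: xs xs'; rewrite in_itv /= !ltr_norml => /andP[? ?] /andP[? ?] /andP[? ?].
  by apply/andP; split; lra.
have [y yI ->] := @MVT_segment R f f' x' x le_x
  (fun y yI => df y (seg y (subset_itv_oo_cc yI)))
  (derivable_within_continuous (fun y yI => @ex_derive _ _ _ _ _ _ _ (df y (seg y yI)))).
by rewrite normrM ler_wpM2r // f'B // seg.
Qed.

Lemma jcont0_bound (h : R -> R -> R) (e : R) : jcont h 0 0 -> 0 < e ->
  exists2 s, 0 < s & forall x y : R, `|x| < s -> `|y| < s -> `|h x y - h 0 0| <= e.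
Proof.
move=> /cvgrPdist_le h0 e0; have /nbhs_ballP[s /= s0 hs] := h0 e e0.
exists s => // x y xs ys; rewrite distrC; apply: (hs (x, y)).
by split; rewrite /ball /= sub0r normrN.
Qed.

(** Strict differentiability at the origin: the mean value inequality along a horizontal and then a
    vertical step, with partial derivatives within [e] of those at 0. *)
Lemma ratfun_strict_diff (d : R) u (e : R) : 0 < d -> ratfun d u -> 0 < e ->
  exists2 s, 0 < s & forall x y x' y' : R, `|x| < s -> `|y| < s -> `|x'| < s -> `|y'| < s ->
    `|u x y - u x' y' - (dx u 0 0 * (x - x') + dy u 0 0 * (y - y'))|
      <= e * (`|x - x'| + `|y - y'|).
Proof.
move=> d0 ru e0; have n0 : `|0 : R| < d by rewrite normr0.
have [s1 s10 h1] := jcont0_bound (rat_jcont (rat_dx ru) n0 n0) e0.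
have [s2 s20 h2] := jcont0_bound (rat_jcont (rat_dy ru) n0 n0) e0.
pose s := Num.min d (Num.min s1 s2).
have sd (x : R) : `|x| < s -> [/\ `|x| < d, `|x| < s1 & `|x| < s2] by rewrite !lt_min => /and3P.
exists s => [|x y x' y' xs ys xs' ys']; first by rewrite !lt_min d0 s10.
have [yd ys1 _] := sd _ ys; have [xd' _ xs2'] := sd _ xs'.
pose f t := u t y - dx u 0 0 * t; pose g t := u x' t - dy u 0 0 * t.
have df (t : R) : `|t| < s -> is_derive t 1 f (dx u t y - dx u 0 0).
  move=> /sd[td _ _]; apply: is_deriveB; first exact: rat_is_dx ru td yd.
  apply: is_derive_eq; by rewrite /GRing.scale /= mulr1.
have dg (t : R) : `|t| < s -> is_derive t 1 g (dy u x' t - dy u 0 0).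
  move=> /sd[td _ _]; apply: is_deriveB; first exact: rat_is_dy ru xd' td.
  apply: is_derive_eq; by rewrite /GRing.scale /= mulr1.
have bf (t : R) : `|t| < s -> `|dx u t y - dx u 0 0| <= e.
  by move=> /sd[_ t1 _]; exact: h1.
have bg (t : R) : `|t| < s -> `|dy u x' t - dy u 0 0| <= e.
  by move=> /sd[_ _ t2]; exact: h2.
have := derive_lipschitz df bf xs xs'; have := derive_lipschitz dg bg ys ys'.
rewrite /f /g [e * (_ + _)]mulrDr => hg hf.
rewrite (_ : u x y - u x' y' - _ = (u x y - dx u 0 0 * x - (u x' y - dx u 0 0 * x'))
  + (u x' y - dy u 0 0 * y - (u x' y' - dy u 0 0 * y'))); last by ring.
by apply: le_trans (ler_normD _ _) _; exact: lerD.
Qed.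

Section Waves.
Variables (N : nat) (d : R) (u : 'I_N -> R -> R -> R).
Hypothesis d0 : 0 < d.
Hypothesis ru : forall i, ratfun d (u i).
Hypothesis ux0 : forall i, dx (u i) 0 0 != 0.
Hypothesis slopes : forall i j, i != j -> slope (u i) 0 0 != slope (u j) 0 0.

(** Each [u i] differs from its linear part by at most [c] times the displacement, while the linear
    parts satisfy the two lower bounds with [4 * c]; this leaves room for the errors. *)
Lemma wave_estimates : exists c L s, [/\ 0 < c, 0 < L, 0 < s, s <= d &
  [/\ forall i (x y x' y' : R), `|x| < s -> `|y| < s -> `|x'| < s -> `|y'| < s ->
        `|u i x y - u i x' y'| <= L * (`|x - x'| + `|y - y'|),
      forall i (x x' y : R), `|x| < s -> `|x'| < s -> `|y| < s ->
        c * `|x - x'| <= `|u i x y - u i x' y|,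
      forall i j (x y x' y' : R), i != j ->
        `|x| < s -> `|y| < s -> `|x'| < s -> `|y'| < s ->
        c * (`|x - x'| + `|y - y'|) <= `|u i x y - u i x' y'| + `|u j x y - u j x' y'| &
      exists2 h, 0 < h & forall i (y r : R), `|y| <= h -> `|r - u i 0 0| <= h ->
        exists2 x, `|x| < s & u i x y = r]].
Proof.
pose al i := dx (u i) 0 0; pose be i := dy (u i) 0 0.
have [e1 e10 he1] : exists2 e, 0 < e & forall i, 4 * e <= `|al i|.
  apply: finite_radius => [i|i e e' e0 ee]; last by move=> h; lra.
  by exists (`|al i| / 4); [rewrite divr_gt0 // normr_gt0; exact: ux0|lra].
have [e2 e20 he2] : exists2 e, 0 < e & forall p : 'I_N * 'I_N, p.1 != p.2 ->
    forall X Y : R, 4 * e * (`|X| + `|Y|) <=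
      `|al p.1 * X + be p.1 * Y| + `|al p.2 * X + be p.2 * Y|.
  apply: finite_radius => [[i j] /=|[i j] /= e e' e0 ee h ij X Y]; last first.
    apply: le_trans (h ij X Y); rewrite ler_wpM2r ?addr_ge0 //; lra.
  have [->|ij] := eqVneq i j; first by exists 1.
  (* Cramer's rule: [D * X] and [D * Y] are combinations of the two linear forms with coefficients
     controlled by [S], and [D] is nonzero since the slopes differ. *)
  pose D := al i * be j - al j * be i.
  have D0 : D != 0.
    rewrite subr_eq0; apply: contra (slopes ij) => /eqP E.
    by rewrite /slope eqr_div ?ux0 // -/(al _) -/(be _) [be j * _]mulrC E mulrC.
  pose S := `|al i| + `|al j| + `|be i| + `|be j|.
  have S0 : 0 < S.
    by rewrite /S -!addrA ltr_pwDl ?normr_gt0 ?addr_ge0 //; exact: ux0.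
  exists (`|D| / S / 4); first by rewrite !divr_gt0 // normr_gt0.
  move=> _ X Y; set A := `|al i * X + be i * Y|; set B := `|al j * X + be j * Y|.
  have -> : 4 * (`|D| / S / 4) * (`|X| + `|Y|) = (`|D * X| + `|D * Y|) / S.
    by rewrite !normrM; field; exact: lt0r_neq0.
  rewrite ler_pdivrMr //.
  have -> : D * X = be j * (al i * X + be i * Y) - be i * (al j * X + be j * Y).
    by rewrite /D; ring.
  have -> : D * Y = al i * (al j * X + be j * Y) - al j * (al i * X + be i * Y).
    by rewrite /D; ring.
  have A0 : 0 <= A by exact: normr_ge0.
  have B0 : 0 <= B by exact: normr_ge0.
  have h1 := ler_normB (be j * (al i * X + be i * Y)) (be i * (al j * X + be j * Y)).
  have h2 := ler_normB (al i * (al j * X + be j * Y)) (al j * (al i * X + be i * Y)).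
  apply: le_trans (lerD h1 h2) _; rewrite !normrM -/A -/B /S.
  have := mulr_ge0 A0 (normr_ge0 (al i)); have := mulr_ge0 B0 (normr_ge0 (al j)).
  have := mulr_ge0 A0 (normr_ge0 (be i)); have := mulr_ge0 B0 (normr_ge0 (be j)).
  by move=> *; lra.
pose c := Num.min e1 e2.
have c0 : 0 < c by rewrite lt_min e10.
have c1 i : 4 * c <= `|al i|.
  by apply: le_trans (he1 i); rewrite ler_pM2l // ge_min lexx.
have c2 i j X Y : i != j -> 4 * c * (`|X| + `|Y|) <=
    `|al i * X + be i * Y| + `|al j * X + be j * Y|.
  move=> ij; apply: le_trans (he2 (i, j) ij X Y); rewrite ler_wpM2r ?addr_ge0 //.
  by rewrite ler_pM2l // ge_min lexx orbT.
have [s0 s00 hs0] : exists2 s, 0 < s & forall i, forall x y x' y' : R,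
    `|x| < s -> `|y| < s -> `|x'| < s -> `|y'| < s ->
    `|u i x y - u i x' y' - (al i * (x - x') + be i * (y - y'))| <= c * (`|x - x'| + `|y - y'|).
  apply: finite_radius => [i|i e e' e0 ee h x y x' y' hx hy hx' hy'].
    exact: (ratfun_strict_diff d0 (ru i) c0).
  by apply: h; exact: lt_le_trans ee.
pose s := Num.min d s0.
have sp : 0 < s by rewrite lt_min d0.
have sd : s <= d by rewrite ge_min lexx.
have hs i (x y x' y' : R) : `|x| < s -> `|y| < s -> `|x'| < s -> `|y'| < s ->
    `|u i x y - u i x' y' - (al i * (x - x') + be i * (y - y'))| <= c * (`|x - x'| + `|y - y'|).
  by rewrite !lt_min => /andP[_ ?] /andP[_ ?] /andP[_ ?] /andP[_ ?]; exact: hs0.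
pose L := \sum_i (`|al i| + `|be i|) + c.
have Lab i : `|al i| + `|be i| + c <= L.
  by rewrite lerD2r (bigD1 i) //= lerDl sumr_ge0 // => j _; rewrite addr_ge0.
have L0 : 0 < L by rewrite ltr_wpDl // sumr_ge0 // => i _; rewrite addr_ge0.
exists c, L, s; split=> //; split.
- move=> i x y x' y' xs ys xs' ys'; have h := hs i x y x' y' xs ys xs' ys'.
  set X := x - x' in h *; set Y := y - y' in h *.
  have h1 := ler_normD (u i x y - u i x' y' - (al i * X + be i * Y)) (al i * X + be i * Y).
  rewrite subrK in h1; apply: le_trans h1 _.
  have h2 := ler_normD (al i * X) (be i * Y); rewrite !normrM in h2.
  have l1 : (`|al i| + `|be i| + c) * (`|X| + `|Y|) <= L * (`|X| + `|Y|).
    by rewrite ler_wpM2r ?addr_ge0.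
  have := mulr_ge0 (normr_ge0 (al i)) (normr_ge0 Y).
  have := mulr_ge0 (normr_ge0 (be i)) (normr_ge0 X).
  by move=> *; lra.
- move=> i x x' y xs xs' ys; have := hs i x y x' y xs ys xs' ys.
  rewrite subrr mulr0 normr0 !addr0; set X := x - x' => h.
  have h1 := ler_normD (u i x y - u i x' y) (- (u i x y - u i x' y - al i * X)).
  rewrite normrN (_ : _ - (_ - al i * X) = al i * X) ?normrM in h1; last by ring.
  have l1 : 4 * c * `|X| <= `|al i| * `|X| by rewrite ler_wpM2r.
  have := mulr_ge0 (ltW c0) (normr_ge0 X).
  by move=> *; lra.
- move=> i j x y x' y' ij xs ys xs' ys'.
  have hi := hs i x y x' y' xs ys xs' ys'; have hj := hs j x y x' y' xs ys xs' ys'.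
  set X := x - x' in hi hj *; set Y := y - y' in hi hj *.
  have h1 := ler_normD (u i x y - u i x' y') (- (u i x y - u i x' y' - (al i * X + be i * Y))).
  rewrite normrN (_ : _ - (_ - (al i * X + be i * Y)) = al i * X + be i * Y) in h1; last by ring.
  have h2 := ler_normD (u j x y - u j x' y') (- (u j x y - u j x' y' - (al j * X + be j * Y))).
  rewrite normrN (_ : _ - (_ - (al j * X + be j * Y)) = al j * X + be j * Y) in h2; last by ring.
  have h3 := c2 i j X Y ij; set Z := `|X| + `|Y| in hi hj h3 *.
  have Z0 : 0 <= c * Z by rewrite mulr_ge0 ?addr_ge0 // ltW.
  by lra.
- pose s' := s / 2.
  have s'0 : 0 < s' by rewrite divr_gt0.
  have s's : s' < s by rewrite /s'; lra.
  (* For [|y| <= h] the y-term and the error add up to at most [2 * c * s'], and [r] is within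
     [c * s'] of the central value; the x-term is at least [4 * c * s'] in size, so [r] lies between
     the values at both ends. *)
  pose h := Num.min s' (c * s' / L).
  have hp : 0 < h by rewrite lt_min s'0 divr_gt0 ?mulr_gt0.
  have hL : h <= c * s' / L by rewrite ge_min lexx orbT.
  have hLs : L * h <= c * s' by rewrite mulrC -ler_pdivlMr.
  have h_s' : h <= s' by rewrite ge_min lexx.
  clearbody h.
  exists (Num.min h (c * s')) => [|i y r]; first by rewrite lt_min hp mulr_gt0.
  rewrite !le_min => /andP[yh _] /andP[_ rh].
  have ys : `|y| < s by exact: le_lt_trans yh (le_lt_trans h_s' s's).
  have n0 : `|0 : R| < s by rewrite normr0.
  have n1 : `|s'| < s by rewrite gtr0_norm.
  have n2 : `|- s'| < s by rewrite normrN gtr0_norm.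
  have k1 := hs i s' y 0 0 n1 ys n0 n0; have k2 := hs i (- s') y 0 0 n2 ys n0 n0.
  rewrite !subr0 ?normrN (gtr0_norm s'0) in k1 k2.
  have e1' : - s' <= s' by lra.
  have cu : {within `[- s', s'], continuous (fun x => u i x y)}.
    apply: continuous_in_subspaceT => x; rewrite inE /= in_itv /= => /andP[x1 x2].
    have xd : `|x| < d.
      have h1 : `|x| <= s' by rewrite ler_norml x1.
      exact: le_lt_trans h1 (lt_le_trans s's sd).
    by apply: (@jcontx _ (u i)); apply: rat_jcont (ru i) xd (lt_le_trans ys sd).
  have yb : `|be i * y| <= L * h - c * h.
    have l1 : (`|al i| + `|be i| + c) * h <= L * h by rewrite ler_wpM2r // ltW.
    have l2 : `|be i| * `|y| <= `|be i| * h by rewrite ler_wpM2l.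
    have := mulr_ge0 (normr_ge0 (al i)) (ltW hp).
    by rewrite normrM => ?; lra.
  have vI : Num.min (u i (- s') y) (u i s' y) <= r <= Num.max (u i (- s') y) (u i s' y).
    rewrite ge_min le_max; have ali := c1 i.
    move: k1 k2 rh yb; rewrite !ler_norml => /andP[? ?] /andP[? ?] /andP[? ?] /andP[? ?].
    have cyh : c * `|y| <= c * h by rewrite ler_pM2l.
    have cs0 : 0 < c * s' by rewrite mulr_gt0.
    have als : 4 * c * s' <= `|al i| * s' by rewrite ler_wpM2r // ltW.
    case: (ltgtP (al i) 0) (ux0 i) als => // a0 _.
      by rewrite ltr0_norm // => ?; apply/andP; split; apply/orP; [right|left]; lra.
    by rewrite gtr0_norm // => ?; apply/andP; split; apply/orP; [left|right]; lra.
  have [x] := @IVT _ (fun x => u i x y) _ _ r e1' cu vI.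
  rewrite in_itv /= -ler_norml => xs' <-; exists x => //.
  exact: le_lt_trans xs' s's.
Qed.
End Waves.
End MeasurableWaves.

(** * Continuity from large compact sets *)

Section MeasurableContinuous.
Variable R : realType.
Notation mu := (@lebesgue_measure R).

Lemma measure_bigsetU_le (I : Type) (s : seq I) (B : I -> set R) (e : R) : 0 <= e ->
  (forall i, measurable (B i)) -> (forall i, (mu (B i) <= e%:E)%E) ->
  measurable (\big[setU/set0]_(i <- s) B i) /\
  (mu (\big[setU/set0]_(i <- s) B i) <= ((size s)%:R * e)%:E)%E.
Proof.
move=> e0 mB Be; elim: s => [|i s [mIH IH]].
  by rewrite big_nil measure0 mul0r; split => //; exact: measurable0.
rewrite big_cons; split; first exact: measurableU.
have : (mu (B i `|` \big[setU/set0]_(j <- s) B j) <=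
  mu (B i) + mu (\big[setU/set0]_(j <- s) B j))%E by exact: (measureU2 mu (mB i) mIH).
move=> /le_trans; apply; rewrite /= -add1n natrD mulrDl mul1r EFinD.
exact: leeD.
Qed.

Section Waves.
Variables (N : nat) (d : R) (u : 'I_N -> R -> R -> R) (F : 'I_N -> R -> R) (V : 'I_N -> set R).
Hypothesis d0 : 0 < d.
Hypothesis ru : forall i, ratfun d (u i).
Hypothesis ux0 : forall i, dx (u i) 0 0 != 0.
Hypothesis slopes : forall i j, i != j -> slope (u i) 0 0 != slope (u j) 0 0.
Hypothesis oV : forall i, open_nbhs (u i 0 0) (V i).
Hypothesis mF : forall i, measurable_fun
  (V i : set (g_sigma_algebraType (completed_algebra_gen mu))) (F i).
Hypothesis sumF0 : forall x y, `|x| < d -> `|y| < d -> \sum_i F i (u i x y) = 0.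

(* Two nearby levels of u i0 meet a common horizontal line y at points where every
   other u j takes values in a compact set on which F j is continuous: the y for
   which this fails are covered by a set of small measure. *)
Lemma measurable_waves_continuous :
  exists2 eta, 0 < eta & forall i (t : R), `|t - u i 0 0| <= eta -> {for t, continuous (F i)}.
Proof.
apply: finite_radius => [i0|i e e' _ ee h t te]; last by apply: h; exact: le_trans te ee.
have n0 : `|0 : R| < d by rewrite normr0.
have [rho rho0 rhoV] : exists2 rho, 0 < rho & forall i,
    `[u i 0 0 - rho, u i 0 0 + rho] `<=` V i.
  apply: finite_radius => [i|i e e' _ ee h t]; last first.
    rewrite /= in_itv /= => /andP[t1 t2]; apply: h; rewrite /= in_itv /=.
    by apply/andP; split; lra.
  have [Vo Vi] := oV i; have /nbhs_ballP[e /= e0 eV] := open_nbhs_nbhs (conj Vo Vi).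
  exists (e / 2); first by rewrite divr_gt0.
  move=> t; rewrite /= in_itv /= => /andP[t1 t2]; apply: eV.
  by rewrite /ball /= ltr_norml; apply/andP; split; lra.
have [d1 d10 ud1] : exists2 d1, 0 < d1 & forall i, forall x y : R, `|x| < d1 -> `|y| < d1 ->
    `|u i x y - u i 0 0| <= rho.
  apply: finite_radius => [i|i e e' _ ee h x y xe ye]; last by apply: h; exact: lt_le_trans ee.
  exact: jcont0_bound (rat_jcont (ru i) n0 n0) rho0.
pose d' := Num.min d d1.
have d'0 : 0 < d' by rewrite lt_min d0.
have d'd : d' <= d by rewrite ge_min lexx.
have d'd1 : d' <= d1 by rewrite ge_min lexx orbT.
have [c [L [s [c0 L0 s0 sd' [eL ec esep [h h0 eh]]]]]] :=
  wave_estimates d'0 (fun i => ratW d'd (ru i)) ux0 slopes.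
pose h' := Num.min h (s / 2).
have h'0 : 0 < h' by rewrite lt_min h0 divr_gt0.
have h'h : h' <= h by rewrite ge_min lexx.
have h's : h' < s.
  have : h' <= s / 2 by rewrite ge_min lexx orbT.
  by move=> ?; lra.
(* A point of level [r] of [u i0] on the horizontal line at height [y], chosen with no regularity in
   [y]. *)
have /choice[X0 hX0] (ry : R * R) : exists x, `|ry.2| <= h -> `|ry.1 - u i0 0 0| <= h ->
    `|x| < s /\ u i0 x ry.2 = ry.1.
  have [yh|/negP nyh] := boolP (`|ry.2| <= h); last by exists 0.
  have [rh|/negP nrh] := boolP (`|ry.1 - u i0 0 0| <= h); last by exists 0.
  by have [x xs ux] := eh i0 ry.2 ry.1 yh rh; exists x.
pose X r y := X0 (r, y).
have XP r y : `|y| <= h' -> `|r - u i0 0 0| <= h -> `|X r y| < s /\ u i0 (X r y) y = r.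
  by move=> yh' rh; apply: (hX0 (r, y)) => //; exact: le_trans h'h.
(* A bad set has measure at most [2 / c * e1 = h' / (2 * (N + 1))], so the [2 * N] of them that
   arise from two levels cannot cover the interval of length [2 * h']. *)
pose e1 := c * h' / (4 * (N%:R + 1)).
have N1 : 0 < (N%:R + 1 : R) by rewrite ltr_wpDl.
have e10 : 0 < e1 by rewrite divr_gt0 ?mulr_gt0.
have /choice[K hK] j : exists K : set R, [/\ compact K, K `<=` `[u j 0 0 - rho, u j 0 0 + rho],
    (mu (`[(u j 0 0 - rho)%R, (u j 0 0 + rho)%R]%classic `\` K) < e1%:E)%E & {within K, continuous (F j)}].
  have [Vo _] := oV j.
  exact: (lusin_completed e10 (rhoV j) (open_measurable Vo) (@mF j)).
(* On the level [u i0 = r] the joint lower bound [esep] falls entirely on [u j], so [y] is mapped to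
   [u j (X r y) y] by an expanding map and few [y] lead outside [K j]. *)
have bad r : `|r - u i0 0 0| <= h -> exists B : 'I_N -> set R, forall j,
    [/\ measurable (B j), (mu (B j) <= (2 / c * e1)%:E)%E &
     j != i0 -> forall y, `|y| <= h' -> ~ B j y -> K j (u j (X r y) y)].
  move=> rh; suff /choice[B hB] j : exists B, [/\ measurable B, (mu B <= (2 / c * e1)%:E)%E &
     j != i0 -> forall y, `|y| <= h' -> ~ B y -> K j (u j (X r y) y)] by exists B.
  have [->|ji] := eqVneq j i0.
    exists set0; split; [exact: measurable0| |by move=> /=; rewrite ?eqxx].
    by rewrite measure0 lee_fin ltW // mulr_gt0 // divr_gt0.
  have [_ _ muK _] := hK j.
  have [|B [mB hB muB]] := @lebesgue_preimage_expanding R (fun y => u j (X r y) y)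
      [set y | `|y| <= h'] _ c e1 c0 _ muK.
    move=> y y' /= yh yh'; have [xs xr] := XP r y yh rh; have [xs' xr'] := XP r y' yh' rh.
    have i0j : i0 != j by rewrite eq_sym.
    have := esep i0 j _ _ _ _ i0j xs (le_lt_trans yh h's) xs' (le_lt_trans yh' h's).
    rewrite xr xr' subrr normr0 add0r; apply: le_trans.
    by rewrite ler_pM2l // lerDr.
  exists B; split=> // _ y yh nBy; have [//|nK] := pselect (K j (u j (X r y) y)).
  exfalso; apply: nBy; apply: hB => //; split=> //=.
  have [xs _] := XP r y yh rh; rewrite in_itv /= -ler_distl.
  by apply: ud1; apply: lt_le_trans d'd1; apply: lt_le_trans sd' => //; exact: le_lt_trans h's.
have good r r' : `|r - u i0 0 0| <= h -> `|r' - u i0 0 0| <= h ->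
    exists2 y, `|y| <= h' & forall j, j != i0 -> K j (u j (X r y) y) /\ K j (u j (X r' y) y).
  move=> rh rh'; have [B hB] := bad r rh; have [B' hB'] := bad r' rh'.
  have e20 : 0 <= 2 / c * e1 by rewrite ltW // mulr_gt0 // divr_gt0.
  have mB j : measurable (B j) by have [] := hB j.
  have mB' j : measurable (B' j) by have [] := hB' j.
  have muB j : (mu (B j) <= (2 / c * e1)%:E)%E by have [] := hB j.
  have muB' j : (mu (B' j) <= (2 / c * e1)%:E)%E by have [] := hB' j.
  have [m1 le1] := measure_bigsetU_le (index_enum 'I_N) e20 mB muB.
  have [m2 le2] := measure_bigsetU_le (index_enum 'I_N) e20 mB' muB'.
  set U1 := \big[setU/set0]_(i <- _) _ in m1 le1; set U2 := \big[setU/set0]_(i <- _) _ in m2 le2.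
  have [[y [yh nU1 nU2]]|nex] := pselect (exists y, [/\ `|y| <= h', ~ U1 y & ~ U2 y]).
    exists y => // j ji; have [_ _ hj] := hB j; have [_ _ hj'] := hB' j.
    split; [apply: hj => // By; apply: nU1|apply: hj' => // By; apply: nU2].
      by rewrite /U1 (bigD1 j) //; left.
    by rewrite /U2 (bigD1 j) //; left.
  exfalso.
  have sub : `[- h', h'] `<=` U1 `|` U2.
    move=> y; rewrite /= in_itv /= -ler_norml => yh.
    have [|n1] := pselect (U1 y); first by left.
    have [|n2] := pselect (U2 y); first by right.
    by exfalso; apply: nex; exists y.
  have mI : measurable (`[- h', h']%classic : set R) by exact: measurable_itv.
  have mU : measurable (U1 `|` U2) by exact: measurableU.
  have l1 : (mu (`[- h', h']%classic : set R)%R <= mu (U1 `|` U2))%E by apply: le_measure; rewrite ?inE.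
  have l2 : (mu (U1 `|` U2) <= mu U1 + mu U2)%E by exact: (measureU2 mu m1 m2).
  have := le_trans l1 (le_trans l2 (leeD le1 le2)).
  rewrite lebesgue_measure_itv /= lte_fin (_ : - h' < h' = true); last by apply/idP; lra.
  rewrite -EFinB -EFinD lee_fin.
  have -> : size (index_enum 'I_N) = N by rewrite -[RHS]card_ord cardT enumT; unlock index_enum.
  have -> : 2 / c * e1 = h' / (2 * (N%:R + 1)).
    by rewrite /e1; field; rewrite !lt0r_neq0.
  have : N%:R * (h' / (2 * (N%:R + 1))) <= h' / 2.
    by rewrite mulrA ler_pdivrMr ?mulr_gt0 //; have : 0 <= N%:R :> R by []; lra.
  by move=> ? ?; lra.
exists (h / 2) => [|r0 r0h]; first by rewrite divr_gt0.
apply/cvgrPdist_lt => e e0.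
have e20 : 0 < e / (N%:R + 1) by rewrite divr_gt0.
have [t t0 ht] : exists2 t, 0 < t & forall j, forall x y : R, K j x -> K j y -> `|x - y| < t ->
    `|F j x - F j y| < e / (N%:R + 1).
  apply: finite_radius => [j|j e' e'' _ ee hh x y Kx Ky xy]; last first.
    by apply: hh => //; exact: lt_le_trans ee.
  by have [cK _ _ cF] := hK j; exact: compact_unif_continuous.
(* For levels closer than this, the two points on the common line are closer than [t / L], hence
   their [u j] values are closer than [t]. *)
have ctL : 0 < c * t / L by rewrite divr_gt0 // mulr_gt0.
near=> r.
have rr0 : `|r0 - r| < c * t / L by near: r; exact: cvgr_dist_lt.
have rh : `|r - u i0 0 0| <= h.
  have : `|r0 - r| < h / 2 by near: r; apply: cvgr_dist_lt => //; rewrite divr_gt0.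
  have := ler_normD (r - r0) (r0 - u i0 0 0); rewrite addrA subrK [`|r - r0|]distrC.
  by lra.
have r0h' : `|r0 - u i0 0 0| <= h by lra.
have [y yh hy] := good r0 r r0h' rh.
have [xs0 ur0] := XP r0 y yh r0h'; have [xs ur] := XP r y yh rh.
have ys : `|y| < s := le_lt_trans yh h's.
have inD (z : R) : `|z| < s -> `|z| < d by move=> /lt_le_trans; apply; exact: le_trans d'd.
have Fexp (x r1 : R) : `|x| < s -> u i0 x y = r1 -> F i0 r1 = - \sum_(j | j != i0) F j (u j x y).
  move=> xs1 <-; apply/eqP; rewrite -addr_eq0; apply/eqP.
  by rewrite -[RHS](sumF0 (inD _ xs1) (inD _ ys)) [RHS](bigD1 i0).
rewrite (Fexp _ _ xs0 ur0) (Fexp _ _ xs ur) opprK addrC -sumrB.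
apply: le_lt_trans (ler_norm_sum _ _ _) _.
apply: (@le_lt_trans _ _ (\sum_(j | j != i0) e / (N%:R + 1))).
  apply: ler_sum => j ji; apply: ltW; have [K0 K1] := hy j ji; apply: ht => //.
  apply: le_lt_trans (eL j _ _ _ _ xs ys xs0 ys) _.
  rewrite subrr normr0 addr0 mulrC -ltr_pdivlMr //.
  have := ec i0 _ _ _ xs xs0 ys; rewrite ur ur0 distrC -ler_pdivlMl // distrC => hc.
  apply: le_lt_trans hc _; rewrite distrC mulrC ltr_pdivrMr //.
  by rewrite (_ : t / L * c = c * t / L) //; ring.
rewrite sumr_const -[ltLHS]mulr_natr; apply: (@le_lt_trans _ _ (e / (N%:R + 1) * N%:R)).
  rewrite ler_pM2l // ler_nat; apply: leq_trans (max_card _) _.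
  by rewrite card_ord.
by rewrite mulrAC ltr_pdivrMr // ltr_pM2l // ltrDl.
Unshelve. all: by end_near. Qed.
End Waves.
End MeasurableContinuous.

(** * Local coordinates *)

Section MeasurableWaves.
Variable R : realType.
Notation mu := (@lebesgue_measure R).

Lemma ratfun_neq0 (d : R) (v : R -> R -> R) : 0 < d -> ratfun d v -> v 0 0 != 0 ->
  exists2 e, 0 < e & forall x y, `|x| < e -> `|y| < e -> v x y != 0.
Proof.
move=> d0 rv v0; have n0 : `|0 : R| < d by rewrite normr0.
have e0 : 0 < `|v 0 0| / 2 by rewrite divr_gt0 // normr_gt0.
have [e e0' he] := jcont0_bound (rat_jcont rv n0 n0) e0.
exists e => // x y xe ye; apply: contraTneq v0 => vxy; have := he x y xe ye.
rewrite vxy sub0r normrN -normr_eq0 => h.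
by rewrite negbK; have := normr_ge0 (v 0 0); move=> ?; apply/eqP; lra.
Qed.

Lemma measurable_waves_analytic (N : nat) (d : R) (u : 'I_N -> R -> R -> R)
    (F : 'I_N -> R -> R) (V : 'I_N -> set R) :
  0 < d -> (forall i, ratfun d (u i)) -> (forall i, dx (u i) 0 0 != 0) ->
  (forall i j, i != j -> slope (u i) 0 0 != slope (u j) 0 0) ->
  (forall i, open_nbhs (u i 0 0) (V i)) ->
  (forall i, measurable_fun
    (V i : set (g_sigma_algebraType (completed_algebra_gen mu))) (F i)) ->
  (forall x y, `|x| < d -> `|y| < d -> \sum_i F i (u i x y) = 0) ->
  forall j, rgerm (fun r => F j (u j 0 0 + r)).
Proof.
move=> d0 ru ux0 slopes oV mF sumF0.
have [eta eta0 cF] := measurable_waves_continuous d0 ru ux0 slopes oV mF sumF0.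
have n0 : `|0 : R| < d by rewrite normr0.
have [d1 d10 h1] : exists2 e, 0 < e & forall i, forall x y, `|x| < e -> `|y| < e ->
    `|u i x y - u i 0 0| <= eta / 2.
  apply: finite_radius => [i|i e e' _ ee h x y xe ye]; last by apply: h; exact: lt_le_trans ee.
  by apply: jcont0_bound (rat_jcont (ru i) n0 n0) _; rewrite divr_gt0.
have [d2 d20 h2] : exists2 e, 0 < e & forall i, forall x y, `|x| < e -> `|y| < e ->
    dx (u i) x y != 0.
  apply: finite_radius => [i|i e e' _ ee h x y xe ye]; last by apply: h; exact: lt_le_trans ee.
  exact: ratfun_neq0 d0 (rat_dx (ru i)) (ux0 i).
pose d3 := Num.min d d2.
have d30 : 0 < d3 by rewrite lt_min d0.
have d3d : d3 <= d by rewrite ge_min lexx.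
have d3d2 : d3 <= d2 by rewrite ge_min lexx orbT.
have rs i : ratfun d3 (slope (u i)).
  apply: rat_div (ratW d3d (rat_dy (ru i))) (ratW d3d (rat_dx (ru i))) => x y xd yd.
  by apply: h2; exact: lt_le_trans d3d2.
have [d4 d40 h4] : exists2 e, 0 < e & forall ij : 'I_N * 'I_N, forall x y, `|x| < e -> `|y| < e ->
    ij.1 != ij.2 -> slope (u ij.1) x y != slope (u ij.2) x y.
  apply: finite_radius => [[i j] /=|ij e e' _ ee h x y xe ye]; last by apply: h; exact: lt_le_trans ee.
  have [->|ij] := eqVneq i j; first by exists 1.
  have s0 : slope (u i) 0 0 - slope (u j) 0 0 != 0 by rewrite subr_eq0; exact: slopes.
  have [e e0 he] := ratfun_neq0 d30 (ratB (rs i) (rs j)) s0.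
  by exists e => // x y xe ye _; rewrite -subr_eq0; exact: he.
pose d5 := Num.min d3 (Num.min d1 d4).
have d50 : 0 < d5 by rewrite lt_min d30 lt_min d10.
have d53 : d5 <= d3 by rewrite ge_min lexx.
have d51 : d5 <= d1 by rewrite !ge_min lexx orbT.
have d54 : d5 <= d4 by rewrite !ge_min lexx !orbT.
apply: (@continuous_waves_analytic R N d5 u F (fun i => u i 0 0 - eta) (fun i => u i 0 0 + eta)) => //.
- by move=> i; apply: ratW (ru i); exact: le_trans d3d.
- by move=> i x y xd yd; apply: h2; apply: lt_le_trans d3d2; exact: lt_le_trans d53.
- move=> i x y xd yd.
  have : `|u i x y - u i 0 0| <= eta / 2 by apply: h1; exact: lt_le_trans d51.
  by rewrite ler_norml => /andP[? ?]; apply/andP; split; lra.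
- by move=> i t /andP[t1 t2]; apply: cF; rewrite ler_norml; apply/andP; split; lra.
- by move=> x y xd yd; apply: sumF0; apply: lt_le_trans d3d; exact: lt_le_trans d53.
- move=> i j x y ij xd yd.
  by apply: (h4 (i, j)) => //; exact: lt_le_trans d54.
Qed.
End MeasurableWaves.

(** * Shears and generic directions *)

Section Shear.
Variable R : realType.

(** Centred at [w], with x-derivative along [(1, tau)] and unchanged y-derivative: a generic [tau]
    makes the x-derivative nonzero. *)
Definition sheared (f : {poly {poly R}} * {poly {poly R}}) (w : R * R) (tau x y : R) :=
  f.1.[w.1 + x, w.2 + (tau * x + y)] / f.2.[w.1 + x, w.2 + (tau * x + y)].

Lemma ratfun_sheared f w tau : f.2.[w.1, w.2] != 0 ->
  exists2 d, 0 < d & ratfun d (sheared f w tau) /\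
    forall x y, `|x| < d -> `|y| < d -> f.2.[w.1 + x, w.2 + (tau * x + y)] != 0.
Proof.
move=> f20.
have rP (P : {poly {poly R}}) d : ratfun d (fun x y => P.[w.1 + x, w.2 + (tau * x + y)]).
  apply: ratfun_horner2; first exact: ratD (rat_cst d _) (rat_x d).
  exact: ratD (rat_cst d _) (ratD (ratM (rat_cst d _) (rat_x d)) (rat_y d)).
have [|d d0 hd] := ratfun_neq0 ltr01 (rP f.2 1); first by rewrite mulr0 !addr0.
by exists d => //; split=> //; exact: rat_div.
Qed.

Lemma is_derive_quotient (P Q : {poly {poly R}}) (g k : R -> R) (t g' k' : R) (w : R * R) :
  is_derive t 1 g g' -> is_derive t 1 k k' -> g t = w.1 -> k t = w.2 -> Q.[w.1, w.2] != 0 ->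
  is_derive t 1 (fun t => P.[g t, k t] / Q.[g t, k t])
    ((quotient_d P Q w).1 * g' + (quotient_d P Q w).2 * k').
Proof.
move=> dg dk gt kt Q0; have Qt0 : Q.[g t, k t] != 0 by rewrite gt kt.
have dQ := @is_deriveV R (fun t => Q.[g t, k t]) t _ _ Qt0 (is_derive_horner2_comp Q dg dk).
apply: is_derive_eq (is_deriveM (is_derive_horner2_comp P dg dk) dQ) _.
rewrite /quotient_d /GRing.scale /= /dX /dY gt kt; field; exact: Q0.
Qed.

Lemma dx_sheared f w tau : f.2.[w.1, w.2] != 0 ->
  dx (sheared f w tau) 0 0 = (quotient_d f.1 f.2 w).1 + (quotient_d f.1 f.2 w).2 * tau.
Proof.
move=> f20; apply: is_derive_val; rewrite -[X in X + _]mulr1.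
apply: (@is_derive_quotient f.1 f.2 (fun x => w.1 + x) (fun x => w.2 + (tau * x + 0))) => //;
  rewrite ?mulr0 ?addr0 //.
- have h := is_deriveD (is_derive_cst w.1 (0 : R) 1) (is_derive_id (0 : R) 1).
  by rewrite add0r in h; exact: h.
- have h := is_deriveD (is_derive_cst w.2 (0 : R) 1) (is_deriveD
    (is_deriveM (is_derive_cst tau (0 : R) 1) (is_derive_id (0 : R) 1)) (is_derive_cst (0 : R) (0 : R) 1)).
  rewrite (_ : 0 + _ = tau) in h; first exact: h.
  by rewrite /GRing.scale /=; ring.
Qed.

Lemma dy_sheared f w tau : f.2.[w.1, w.2] != 0 ->
  dy (sheared f w tau) 0 0 = (quotient_d f.1 f.2 w).2.
Proof.
move=> f20; apply: is_derive_val; rewrite (_ : _.2 = (quotient_d f.1 f.2 w).1 * 0 + (quotient_d f.1 f.2 w).2 * 1); last first.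
  by rewrite mulr0 add0r mulr1.
apply: (@is_derive_quotient f.1 f.2 (fun y => w.1 + 0) (fun y => w.2 + (tau * 0 + y))) => //;
  rewrite ?mulr0 ?addr0 //.
have h := is_deriveD (is_derive_cst w.2 (0 : R) 1) (is_deriveD
  (is_derive_cst (0 : R) (0 : R) 1) (is_derive_id (0 : R) 1)).
by rewrite (_ : 0 + (0 + 1) = 1) in h; [exact: h|rewrite !add0r].
Qed.

(** A product of nonzero polynomials of degree at most 1 in [tau]; the natural numbers below its
    size cannot all be roots. *)
Lemma generic_direction (I : finType) (v : I -> R * R) : (forall i, v i != 0) ->
  exists tau, forall i, (v i).1 + (v i).2 * tau != 0.
Proof.
move=> v0; pose p := \prod_i ((v i).1%:P + (v i).2 *: 'X).
have p0 : p != 0.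
  apply/prodf_neq0 => i _; apply: contraNneq (v0 i) => e.
  have e0 := congr1 (fun q => q.[0]) e; have e1 := congr1 (fun q => q.[1]) e.
  rewrite !hornerE in e0 e1; rewrite e0 add0r in e1.
  by apply/eqP; case: (v i) e0 e1 => a b /= -> ->.
have [tau taup] : exists tau, ~~ root p tau.
  apply/not_existsP => h.
  have := max_poly_roots p0 (rs := [seq n%:R | n <- iota 0 (size p)]).
  rewrite size_map size_iota ltnn => H; suff : false by [].
  apply: H; first by apply/allP => t _; have /negP := h t; rewrite negbK.
  by rewrite map_inj_uniq ?iota_uniq //; apply: mulrIn; exact: oner_neq0.
exists tau => i; apply: contraNneq taup => e; rewrite /root /p horner_prod.
by apply/prodf_eq0; exists i => //; rewrite !hornerE e.
Qed.
End Shear.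

Section Charts.
Variable K : numFieldType.
Implicit Types (f : {poly {poly K}} * {poly {poly K}}) (w z : K * K).

(** The coordinate on the projective line is fixed by the base point [w], while the fraction is
    evaluated at nearby points [z]. *)
Definition chart f w := if f.2.[w.1, w.2] == 0 then (f.2, f.1) else f.

Definition chart_val f w z := (chart f w).1.[z.1, z.2] / (chart f w).2.[z.1, z.2].

Lemma chart_neq0 f w : ~ indeterminacy f w -> (chart f w).2.[w.1, w.2] != 0.
Proof.
rewrite /chart /indeterminacy /=; case: ifPn => [/eqP f2 ind|//]; apply/eqP => f1.
exact: ind.
Qed.

Lemma ratval_chart f w z : (chart f w).2.[z.1, z.2] != 0 ->
  ratval f z = param (ratval f w) (chart_val f w z).
Proof.
rewrite /ratval /chart_val /chart; case: (f.2.[w.1, w.2] =P 0) => _ /= f0.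
  by rewrite mulf_eq0 invr_eq0 (negPf f0) orbF invf_div.
by rewrite (negPf f0).
Qed.

Lemma coord_ratval f w : Defs.coord (ratval f w) = chart_val f w w.
Proof.
by rewrite /ratval /chart_val /chart; case: (f.2.[w.1, w.2] =P 0) => //= ->; rewrite mul0r.
Qed.

Lemma local_d_chart f w : local_d f w = quotient_d (chart f w).1 (chart f w).2 w.
Proof. by rewrite /local_d /chart; case: eqP. Qed.

Lemma derivable_epsilon (f : K -> K) (x d : K) :
  (forall e, 0 < e -> exists2 r, 0 < r & forall v, v != 0 -> `|v| <= r ->
    `|d - v^-1 * (f (v + x) - f x)| < e) ->
  derivable f x 1.
Proof.
move=> h; apply/cvg_ex; exists d; apply/cvgrPdist_lt => /= e /h[r r0 hr].
near=> v; rewrite /GRing.scale /= mulr1; apply: hr.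
  by near: v; exact: nbhs_dnbhs_neq.
by near: v; exact: dnbhs0_le.
Unshelve. all: by end_near. Qed.
End Charts.

Section Complexification.
Variable R : realType.
Notation C := (R[i] : numFieldType).
Notation toCP := (map_poly (map_poly (@toC R))).
Implicit Types (f : {poly {poly R}} * {poly {poly R}}) (w : R * R) (P Q : {poly {poly R}}).

Lemma toC_eq0 (x : R) : (toC x == 0) = (x == 0).
Proof. exact: fmorph_eq0. Qed.

Lemma indeterminacy_toC f w : indeterminacy (ratC f) (toC2 w) -> indeterminacy f w.
Proof.
by move=> [/eqP + /eqP]; rewrite /ratC /toC2 /= !horner2_toC !toC_eq0 => /eqP ? /eqP.
Qed.

Lemma chart_ratC f w : chart (ratC f) (toC2 w) = ratC (chart f w).
Proof. by rewrite /chart /= horner2_toC toC_eq0; case: ifP. Qed.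

Lemma ratval_ratC f w : ratval (ratC f) (toC2 w) = omap (@toC R) (ratval f w).
Proof.
rewrite /ratval /= !horner2_toC toC_eq0; case: ifP => //= _.
by rewrite /toC fmorph_div.
Qed.

Lemma quotient_d_toC P Q w :
  quotient_d (toCP P) (toCP Q) (toC2 w) = toC2 (quotient_d P Q w).
Proof.
have eX (T : {poly {poly R}}) : dX (toCP T) = toCP (dX T) by rewrite /dX deriv_map.
have eY (T : {poly {poly R}}) : dY (toCP T) = toCP (dY T).
  by rewrite /dY -!map_poly_comp; apply: eq_map_poly => p /=; rewrite deriv_map.
rewrite /quotient_d /toC2 /= !eX !eY !horner2_toC.
by rewrite /toC; congr pair; rewrite fmorph_div rmorphXn rmorphB !rmorphM.
Qed.

Lemma tangency_ratC f g w : ~ indeterminacy f w -> ~ indeterminacy g w ->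
  (local_d f w).1 * (local_d g w).2 - (local_d f w).2 * (local_d g w).1 = 0 ->
  tangency (ratC f) (ratC g) (toC2 w).
Proof.
move=> indf indg e; split; [by move/indeterminacy_toC|by move/indeterminacy_toC|].
by rewrite !local_d_chart !chart_ratC !quotient_d_toC -!local_d_chart /= /toC -!rmorphM -rmorphB e rmorph0.
Qed.

(** The series has real sums at real points, so passing to the real parts of its coefficients does
    not change these sums. *)
Lemma analytic_germ_of (F : option R -> R) p (h : R[i] -> R[i]) (s M : R) : 0 < s ->
  wnorm_le s h M ->
  (forall x : R, `|x| <= s -> h x%:C%C = (F (param p (Defs.coord p + x)))%:C%C) ->
  analytic_germ F p.
Proof.
move=> s0 [c [_ ch]] hF; exists (fun n => complex.Re (c n)).
apply/nbhs_ballP; exists s => // t; rewrite /ball /= distrC => ts.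
have tx : absc (t - Defs.coord p)%:C%C <= s by rewrite absc_real ltW.
have := clim_Re (ch _ tx); rewrite hF ?ltW //= [Defs.coord p + _]addrC subrK; apply: eq_cvgn => n.
rewrite /pseries /psum /series /= big_mkord Re_sum; apply: eq_bigr => i _.
have e (x : R) : complex.Re (c i * x%:C%C ^+ i) = complex.Re (c i) * x ^+ i.
  by rewrite -rmorphXn; case: (c i) => a b /=; rewrite mulr0 subr0.
by rewrite e.
Qed.

Lemma norm_absc (z : C) : `|z| = (absc z)%:C%C.
Proof. by []. Qed.

Lemma holomorphic_wnorm_le (h : R[i] -> R[i]) (s M : R) (a t : C) : 0 < s ->
  wnorm_le s h M -> absc (t - a) < s / 2 -> derivable (fun z : C => h (z - a) : C) t 1.
Proof.
move=> s0 hM ta; have s20 : 0 < s / 2 by rewrite divr_gt0.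
have [h' hh'] : exists h' : R[i] -> R[i], forall z v, absc z <= s / 2 -> absc v <= s / 2 / 2 ->
    absc (h (z + v) - h z - v * h' z) <= 2 / (s / 2) ^+ 2 * M * absc v ^+ 2.
  by apply: wnorm_le_deriv; rewrite ?ltW // -splitr.
have M0 := wnorm_le_ge0 hM.
set k := 2 / (s / 2) ^+ 2 * M in hh'.
have k0 : 0 <= k by rewrite mulr_ge0 // divr_ge0 // sqr_ge0.
apply: (@derivable_epsilon C _ t (h' (t - a))) => e e0.
(* In the order of [R[i]] a positive element is real. *)
have [eR eE] : exists eR : R, e = eR%:C%C.
  by exists (complex.Re e); rewrite RRe_real // realE ltW.
rewrite {e}eE in e0 *; have {}e0 : 0 < eR by rewrite ltcR in e0.
pose r := Num.min (s / 2 / 2) (eR / (k + 1)).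
have k1 : 0 < k + 1 by rewrite ltr_wpDl.
have r0 : 0 < r by rewrite lt_min !divr_gt0.
have rC0 : 0 < r%:C%C :> C by rewrite ltcR.
exists r%:C%C => // v v0; rewrite norm_absc lecR le_min => /andP[vs ve].
have := hh' (t - a) v (ltW ta) vs; rewrite [t - a + v]addrC [v + (t - a)]addrA => le_v.
suff key : absc (h' (t - a) - v^-1 * (h (v + t - a) - h (t - a))) < eR.
  by rewrite -ltcR in key; exact: key.
have -> : h' (t - a) - v^-1 * (h (v + t - a) - h (t - a)) =
    - (v^-1 * (h (v + t - a) - h (t - a) - v * h' (t - a))) by field.
rewrite abscN abscM abscV.
have v_gt0 : 0 < absc v by rewrite absc_gt0.
rewrite ltr_pdivrMl //; apply: le_lt_trans le_v _.
rewrite expr2 mulrCA ltr_pM2l //; move: ve; rewrite ler_pdivlMr // mulrDr mulr1 => ve.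
by rewrite mulrC; apply: lt_le_trans ve; rewrite ltrDl.
Qed.
End Complexification.

(** * Complexification *)

Section ComplexGerms.
Variable R : realType.
Notation C := R[i].

Lemma unif_germ_horner2 (P : {poly {poly C}}) (g k : C -> C -> C) :
  unif_germ g -> unif_germ k -> unif_germ (fun z t => P.[g z t, k z t]).
Proof.
move=> hg hk; elim/poly_ind: P => [|P c IH].
  have := unif_germ_cst (0 : C); congr unif_germ; apply/funext => z; apply/funext => t.
  by rewrite horner0 horner0.
have hc : unif_germ (fun z t => c.[k z t]).
  elim/poly_ind: c => [|c a IHc].
    have := unif_germ_cst (0 : C); congr unif_germ; apply/funext => z; apply/funext => t.
    by rewrite horner0.
  have := unif_germD (unif_germM IHc hk) (unif_germ_cst a).
  congr unif_germ; apply/funext => z; apply/funext => t.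
  by rewrite hornerMXaddC.
have := unif_germD (unif_germM IH hg) hc; congr unif_germ; apply/funext => z; apply/funext => t.
by rewrite hornerMXaddC hornerD hornerM hornerC.
Qed.

Lemma unif_germ_shift (a b : C) (P : {poly {poly C}}) :
  unif_germ (fun z t => P.[a + z, b + t]) /\ unif_germ (fun t z => P.[a + z, b + t]).
Proof.
have h1 := unif_germD (unif_germ_cst a) (@unif_germ_fst R).
have h2 := unif_germD (unif_germ_cst b) (@unif_germ_snd R).
have k1 := unif_germD (unif_germ_cst a) (@unif_germ_snd R).
have k2 := unif_germD (unif_germ_cst b) (@unif_germ_fst R).
by split; [exact: unif_germ_horner2 h1 h2|exact: unif_germ_horner2 k1 k2].
Qed.

Lemma unif_germ_quotient (a b : C) (P Q : {poly {poly C}}) : Q.[a, b] != 0 ->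
  unif_germ (fun z t => P.[a + z, b + t] / Q.[a + z, b + t]) /\
  unif_germ (fun t z => P.[a + z, b + t] / Q.[a + z, b + t]).
Proof.
move=> Q0; have [P1 P2] := unif_germ_shift a b P; have [Q1 Q2] := unif_germ_shift a b Q.
by split; apply: unif_germM => //; apply: unif_germV => //; rewrite !addr0.
Qed.

Lemma unif_germ_neq0 (h : C -> C -> C) : unif_germ h -> h 0 0 != 0 ->
  exists2 s, 0 < s & forall z t, absc z <= s -> absc t <= s -> h z t != 0.
Proof.
move=> hh h0; have h00 : 0 < absc (h 0 0) by rewrite absc_gt0.
have [s s0 hs] := hh (absc (h 0 0) / 2) (divr_gt0 h00 (ltr0Sn _ _)).
exists s => // z t zs ts; apply/eqP => hzt.
have := wnorm_le_bound (hs t ts) zs; rewrite hzt sub0r abscN; lra.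
Qed.
End ComplexGerms.

Section Neighborhoods.
Variable R : realType.
Notation C := (R[i] : numFieldType).

Lemma near_toC (a b : C) (s : R) (P : C * C -> Prop) : 0 < s ->
  (forall z t : R[i], absc z <= s -> absc t <= s -> P (a + z, b + t)) ->
  \forall z \near (a, b), P z.
Proof.
move=> s0 hP; apply/nbhs_ballP; exists s%:C%C => /=; first by rewrite ltcR.
move=> [z t] [/=]; rewrite /ball /= => az bt.
have {}az : absc (a - z) <= s by rewrite -lecR; exact: ltW.
have {}bt : absc (b - t) <= s by rewrite -lecR; exact: ltW.
have := hP (z - a) (t - b); rewrite !subrKC; apply.
  by rewrite abscB.
by rewrite abscB.
Qed.

Lemma near_real_line (w : R * R) (tau : R) (P : R * R -> Prop) :
  (\forall z \near w, P z) -> exists2 e, 0 < e & forall x y : R, `|x| < e -> `|y| < e ->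
    P (w.1 + x, w.2 + (tau * x + y)).
Proof.
move=> /nbhs_ballP[e /= e0 hP].
have t1 : 0 < `|tau| + 1 by rewrite ltr_wpDl.
exists (e / (`|tau| + 1)) => [|x y xe ye]; first by rewrite divr_gt0.
apply: hP; split => /=; rewrite /ball /= opprD addrA subrr sub0r normrN.
  apply: lt_le_trans xe _; rewrite ler_pdivrMr // ler_peMr ?(ltW e0) // lerDr.
  exact: normr_ge0.
apply: le_lt_trans (ler_normD _ _) _; rewrite normrM.
move: xe ye; rewrite !ltr_pdivlMr // => xe ye.
rewrite -(ltr_pM2r t1); have := normr_ge0 tau; have := normr_ge0 x => x0 tau0.
have h := ler_wpM2l tau0 (ltW xe).
rewrite mulrDl [e * _]mulrDr mulr1; apply: ler_ltD; last exact: ye.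
by rewrite -mulrA [e * _]mulrC.
Qed.
End Neighborhoods.

Section LocalData.
Variables (R : realType) (N : nat) (f : 'I_N -> {poly {poly R}} * {poly {poly R}}) (w : R * R).
Notation p := (fun i => ratval (f i) w).
Notation g := (fun i => chart (f i) w).

(** The singular locus is a complex one, evaluated at a real point; this extracts from it the two
    real conditions used by the local analysis. *)
Lemma nonsingular_local_data : (forall i, coprimeXY (f i).1 (f i).2) ->
  ~ singular_locus (fun i => ratC (f i)) (toC2 w) ->
  (forall i, (g i).2.[w.1, w.2] != 0) /\
  forall i j, i != j -> (local_d (f i) w).1 * (local_d (f j) w).2 -
    (local_d (f i) w).2 * (local_d (f j) w).1 != 0.
Proof.
move=> cop nsing; have nind i : ~ indeterminacy (f i) w.
  by move=> ind; apply: nsing; left; exists i; exact: indeterminacy_sing_foliation.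
split=> [i|i j ij]; first exact: chart_neq0.
by apply/eqP => e; apply: nsing; right; exists i, j; split=> //; exact: tangency_ratC.
Qed.

Lemma solution_germ_sheared (F : 'I_N -> option R -> R) (tau : R) :
  (forall i, (g i).2.[w.1, w.2] != 0) -> solution_germ f F w ->
  exists2 e, 0 < e & (forall i, ratfun e (sheared (g i) w tau)) /\
    forall x y, `|x| < e -> `|y| < e -> \sum_i F i (param (p i) (sheared (g i) w tau x y)) = 0.
Proof.
move=> g0 /(near_real_line tau)[e e0 he].
have [d d0 hd] : exists2 d, 0 < d & forall i, ratfun d (sheared (g i) w tau) /\
    forall x y, `|x| < d -> `|y| < d -> (g i).2.[w.1 + x, w.2 + (tau * x + y)] != 0.
  apply: finite_radius => [i|i a a' _ aa [h1 h2]]; first exact: ratfun_sheared.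
  by split=> [|x y xa ya]; [exact: ratW h1|apply: h2; exact: lt_le_trans aa].
exists (Num.min d e) => [|]; first by rewrite lt_min d0.
split=> [i|x y]; first by apply: ratW (hd i).1; rewrite ge_min lexx.
rewrite !lt_min => /andP[xd xe] /andP[yd ye]; rewrite -[RHS](he x y xe ye).
apply: eq_bigr => i _; congr (F i _); symmetry; apply: ratval_chart.
exact: (hd i).2.
Qed.

End LocalData.

Lemma sheared00 (R : realType) (f : {poly {poly R}} * {poly {poly R}}) (w : R * R) (tau : R) :
  sheared (chart f w) w tau 0 0 = Defs.coord (ratval f w).
Proof. by rewrite coord_ratval /sheared /chart_val mulr0 !addr0. Qed.

Lemma local_solution_analytic (R : realType) (N : nat)
    (f : 'I_N -> {poly {poly R}} * {poly {poly R}}) (w : R * R) (F : 'I_N -> option R -> R) :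
  (1 < N)%N -> (forall i, (chart (f i) w).2.[w.1, w.2] != 0) ->
  (forall i j, i != j -> (local_d (f i) w).1 * (local_d (f j) w).2 -
    (local_d (f i) w).2 * (local_d (f j) w).1 != 0) ->
  (forall i, measurable_germ (F i) (ratval (f i) w)) -> solution_germ f F w ->
  forall i, rgerm (fun r => F i (param (ratval (f i) w) (Defs.coord (ratval (f i) w) + r))).
Proof.
move=> N1 g0 wedge mF sol.
(* A second index [j] exists, and a zero differential would make its wedge with that of [f j]
   vanish. *)
have v0 i : local_d (f i) w != 0.
  have [j ij] : exists j : 'I_N, i != j.
    case: N N1 i {f F g0 wedge mF sol} => [//|[//|n]] _ i.
    by have [->|i0] := eqVneq i ord0; [exists ord_max|exists ord0].
  by apply: contraNneq (wedge i j ij) => ->; rewrite !mul0r subrr.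
have [tau htau] := generic_direction v0.
have [d d0 [ru sum0]] := solution_germ_sheared tau g0 sol.
pose u i := sheared (chart (f i) w) w tau.
have dxu i : dx (u i) 0 0 = (local_d (f i) w).1 + (local_d (f i) w).2 * tau.
  by rewrite /u dx_sheared // local_d_chart.
have dyu i : dy (u i) 0 0 = (local_d (f i) w).2.
  by rewrite /u dy_sheared // local_d_chart.
have /choice[V hV] i : exists V : set R, open_nbhs (Defs.coord (ratval (f i) w)) V /\
    measurable_fun (V : set (g_sigma_algebraType (completed_algebra_gen (@lebesgue_measure R))))
      (fun t => F i (param (ratval (f i) w) t)).
  by have [V oV mV] := mF i; exists V.
move=> i; rewrite -(sheared00 (f i) w tau).
apply: (@measurable_waves_analytic R N d u (fun i t => F i (param (ratval (f i) w) t)) V) => //.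
- by move=> j; rewrite dxu.
- move=> j k jk; rewrite /slope !dxu !dyu eqr_div //.
  apply: contraNneq (wedge j k jk) => /eqP.
  rewrite -subr_eq0 => /eqP e; rewrite -oppr_eq0 -e; apply/eqP; ring.
- by move=> j; rewrite /u sheared00; have [] := hV j.
- by move=> j; have [] := hV j.
Qed.

Lemma local_solution_complexification (R : realType) (N : nat)
    (f : 'I_N -> {poly {poly R}} * {poly {poly R}}) (w : R * R) (F : 'I_N -> option R -> R) :
  (forall i, (chart (f i) w).2.[w.1, w.2] != 0) -> solution_germ f F w ->
  (forall i, rgerm (fun r => F i (param (ratval (f i) w) (Defs.coord (ratval (f i) w) + r)))) ->
  exists FC : 'I_N -> option (R[i] : numFieldType) -> (R[i] : numFieldType),
    (forall i, complexification (F i) (ratval (f i) w) (FC i)) /\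
    solution_germ (fun i => ratC (f i)) FC (toC2 w).
Proof.
move=> g0 sol rF; pose p i := ratval (f i) w; pose a i := Defs.coord (p i).
have /choice[h hh] i : exists h : R[i] -> R[i], exists sM : R * R, [/\ 0 < sM.1, wnorm_le sM.1 h sM.2 &
    forall x : R, `|x| <= sM.1 -> h x%:C%C = (F i (param (p i) (a i + x)))%:C%C].
  by have [h [s [M [s0 hM hF]]]] := rgerm_ex (rF i); exists h, (s, M).
have {hh}/choice[sM hh] := hh.
(* The power series is read in the parameter of [param] at [p i]: [t] at a finite point, [1 / t] at
   infinity, where [None] has parameter 0. At a finite point the value given to [None] is a mere
   default. *)
pose FC i (o : option (R[i] : numFieldType)) : (R[i] : numFieldType) :=
  h i (if p i is Some b then odflt 0 o - toC b else if o is Some t then t^-1 else 0).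
have FCE i s : FC i (param (omap (@toC R) (p i)) s) = h i (s - toC (a i)).
  rewrite /FC /a; case: (p i) => [b|] //=.
  have -> : toC (0 : R) = 0 by exact: rmorph0.
  by rewrite subr0; case: eqP => [->|_] //; rewrite invrK.
exists FC; split.
  move=> i; have [s0 hM hF] := hh i; split.
    rewrite /holomorphic_germ -/(p i).
    have -> : Defs.coord (omap (@toC R) (p i)) = toC (a i).
      by rewrite /a; case: (p i) => //=; rewrite /toC rmorph0.
    apply/nbhs_ballP; exists ((sM i).1 / 2)%:C%C => /=; first by rewrite ltcR divr_gt0.
    move=> t; rewrite /ball /= => at_.
    have {}at_ : absc (t - toC (a i)) < (sM i).1 / 2 by rewrite abscB -ltcR.
    rewrite (_ : (fun s => _) = fun s => h i (s - toC (a i))); last first.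
      by apply/funext => s; exact: FCE.
    exact: holomorphic_wnorm_le s0 hM at_.
  apply/nbhs_ballP; exists (sM i).1 => // t; rewrite /ball /= distrC => ts.
  have -> : omap (@toC R) (param (p i) t) = param (omap (@toC R) (p i)) (toC t).
    case: (p i) => //=; rewrite toC_eq0; case: ifP => //= _.
    by rewrite /toC fmorphV.
  by rewrite FCE /toC -rmorphB [LHS]hF ?ltW // [a i + _]addrC subrK.
pose q i z t := (ratC (chart (f i) w)).1.[toC w.1 + z, toC w.2 + t] /
  (ratC (chart (f i) w)).2.[toC w.1 + z, toC w.2 + t] : R[i].
have den0 i : (ratC (chart (f i) w)).2.[toC w.1, toC w.2] != 0.
  by rewrite /ratC /= horner2_toC toC_eq0.
have qE i (x y : R) : q i x%:C%C y%:C%C = toC (sheared (chart (f i) w) w 0 x y).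
  rewrite /q /ratC /= /toC -!rmorphD /= !horner2_toC /toC -fmorph_div.
  by rewrite /sheared mul0r add0r.
have q0 i : q i 0 0 = toC (a i) by rewrite /a -(sheared00 (f i) w 0) -qE.
pose H z t := \sum_i h i (q i z t - q i 0 0).
have H1 : unif_germ H.
  apply: unif_germ_sum => i; have [s0 hM _] := hh i.
  by apply: unif_germ_comp s0 hM _; exact: (unif_germ_quotient _ (den0 i)).1.
have H2 : unif_germ (fun t z => H z t).
  apply: unif_germ_sum => i; have [s0 hM _] := hh i.
  by apply: (unif_germ_comp (h := fun t z => q i z t)) s0 hM _; exact: (unif_germ_quotient _ (den0 i)).2.
have [e e0 [re sum0]] := solution_germ_sheared 0 g0 sol.
have n0 : `|0 : R| < e by rewrite normr0.
have [e1 e10 he1] : exists2 e1, 0 < e1 & forall i, forall x y : R, `|x| < e1 -> `|y| < e1 ->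
    `|sheared (chart (f i) w) w 0 x y - a i| <= (sM i).1.
  apply: finite_radius => [i|i d d' _ dd hd x y xd yd]; last by apply: hd; exact: lt_le_trans dd.
  have [s0 _ _] := hh i; rewrite /a -(sheared00 (f i) w 0).
  exact: jcont0_bound (rat_jcont (re i) n0 n0) s0.
have [s s0 H0] : exists2 s, 0 < s & forall z t, absc z <= s -> absc t <= s -> H z t = 0.
  apply: (@unif_germ_eq0 _ _ (Num.min e e1) H1 H2); first by rewrite lt_min e0.
  move=> x y; rewrite !lt_min => /andP[xe xe1] /andP[ye ye1].
  have := congr1 (@toC R) (sum0 x y xe ye); rewrite /toC rmorph0 rmorph_sum /= => <-.
  apply: eq_bigr => i _; have [_ _ hF] := hh i.
  rewrite q0 qE /toC -rmorphB hF; last exact: he1.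
  by rewrite [a i + _]addrC subrK.
(* Where the chart denominators do not vanish, the projective values are read in the coordinates
   fixed at [w], so the required sum is [H]. *)
have [s' s'0 hs'] : exists2 s', 0 < s' & forall i, forall z t, absc z <= s' -> absc t <= s' ->
    (ratC (chart (f i) w)).2.[toC w.1 + z, toC w.2 + t] != 0.
  apply: finite_radius => [i|i d d' _ dd hd z t zd td]; last by apply: hd; exact: le_trans dd.
  apply: unif_germ_neq0; first exact: (unif_germ_shift _ _ _).1.
  by rewrite !addr0.
apply: (@near_toC R _ _ (Num.min s s')); first by rewrite lt_min s0.
move=> z t; rewrite !le_min => /andP[zs zs'] /andP[ts ts'].
rewrite -[RHS](H0 z t zs ts); apply: eq_bigr => i _.
have den_neq0 : (chart (ratC (f i)) (toC2 w)).2.[toC w.1 + z, toC w.2 + t] != 0.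
  by rewrite chart_ratC; exact: hs'.
rewrite (@ratval_chart _ (ratC (f i)) (toC2 w) (toC w.1 + z, toC w.2 + t) den_neq0).
by rewrite ratval_ratC FCE /chart_val chart_ratC q0.
Qed.

Theorem proposition1 (R : realType) (N : nat) (hN : (3 <= N)%N)
  (U : 'I_N -> {fraction {poly {poly R}}})
  (hU : forall i : 'I_N, nonconstant (U i))
  (omega : R * R)
  (homega : ~ singular_locus (fun i => ratC (lowest_terms (U i))) (toC2 omega))
  (F : 'I_N -> option R -> R)
  (hmeas : forall i : 'I_N,
     measurable_germ (F i) (ratval (lowest_terms (U i)) omega))
  (hsol : solution_germ (fun i => lowest_terms (U i)) F omega) :
  (forall i : 'I_N, analytic_germ (F i) (ratval (lowest_terms (U i)) omega)) /\
  exists FC : 'I_N -> option (R[i] : numFieldType) -> (R[i] : numFieldType),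
    (forall i : 'I_N,
       complexification (F i) (ratval (lowest_terms (U i)) omega) (FC i)) /\
    solution_germ (fun i => ratC (lowest_terms (U i))) FC (toC2 omega).
Proof.
have cop i : coprimeXY (lowest_terms (U i)).1 (lowest_terms (U i)).2.
  by have [] := lowest_termsP (U i).
have [g0 wedge] := nonsingular_local_data cop homega.
have rF := local_solution_analytic (ltnW hN) g0 wedge hmeas hsol.
split; last exact: local_solution_complexification.
move=> i; have [h [s [M [s0 hM hF]]]] := rgerm_ex (rF i).
exact: analytic_germ_of s0 hM hF.
Qed.
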